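(* Let $L\in(0,\infty]$ and let $\|\cdot\|_{X(0,L)}$ be a rearrangement-invariant function norm on $(0,L)$. Let $\varphi\colon(0,L)\to(0,\infty)$ be a measurable function that is equivalent to a continuous nondecreasing function. Set $\xi=\frac1\varphi$ and assume that $\xi$ satisfies the averaging condition $$\operatorname*{ess\,sup}_{t\in(0,L)}\frac1{t\,\xi(t)}\int_0^t\xi(s)\,ds<\infty.$$ Set $\psi(t)=\frac{t}{\int_0^t\xi(s)\,ds}$, $t\in(0,L)$. Consider the following three statements. (i) The operator $T_\varphi$ is bounded on $X'(0,L)$. (ii) $X(0,L)\in\operatorname{Int}\big(\Lambda^1_\xi(0,L),L^\infty(0,L)\big)$. (iii) $X'(0,L)\in\operatorname{Int}\big(L^1(0,L),M_\psi(0,L)\big)$. If $L<\infty$, then the three statements are equivalent to each other. If $L=\infty$, then (i) implies (ii), and (iii) implies (i).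
   Context: Conventions: $\frac1\infty=0\cdot\infty=0$. $\mathfrak{M}(0,L)$ is the set of (Lebesgue) measurable functions on $(0,L)$ with values in $[-\infty,\infty]$, and $\mathfrak{M}^+(0,L)$ is the subset of those that are nonnegative a.e. For $f\in\mathfrak M(0,L)$, $f^*(t)=\inf\{\lambda\in(0,\infty):|\{s\in(0,L):|f(s)|>\lambda\}|\le t\}$, $t\in(0,\infty)$, is its nonincreasing rearrangement, and $f^{**}(t)=\frac1t\int_0^tf^*(s)\,ds$. Functions $f,g$ are equimeasurable, $f\sim g$, if $|\{|f|>\lambda\}|=|\{|g|>\lambda\}|$ for every $\lambda\in(0,\infty)$. Two positive functions on $(0,L)$ are equivalent if each is bounded pointwise by a constant multiple of the other. A rearrangement-invariant function norm on $(0,L)$ is a functional $\|\cdot\|_{X(0,L)}\colon\mathfrak{M}^+(0,L)\to[0,\infty]$ such that, for all $f,g,f_k\in\mathfrak M^+(0,L)$ and $\lambda\in[0,\infty)$: (P1) $\|f\|=0$ iff $f=0$ a.e., $\|\lambda f\|=\lambda\|f\|$, $\|f+g\|\le\|f\|+\|g\|$; (P2) $f\le g$ a.e. implies $\|f\|\le\|g\|$; (P3) $f_k\nearrow f$ a.e. implies $\|f_k\|\nearrow\|f\|$; (P4) $\|\chi_E\|<\infty$ for every measurable $E$ of finite measure; (P5) for every measurable $E$ of finite measure there is a finite constant $C_E>0$ with $\int_E f\le C_E\|f\|$ for all $f$; (P6) $\|f\|=\|g\|$ whenever $f\sim g$. It is extended to $\mathfrak M(0,L)$ by $\|f\|=\|\,|f|\,\|$,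 and $X(0,L)=\{f\in\mathfrak M(0,L):\|f\|_{X(0,L)}<\infty\}$ is the induced rearrangement-invariant function space. The associate function norm is $\|f\|_{X'(0,L)}=\sup\{\int_0^Lf(t)g(t)\,dt: g\in\mathfrak M^+(0,L),\|g\|_{X(0,L)}\le1\}$, $f\in\mathfrak M^+(0,L)$, and $X'(0,L)$ is the corresponding space. $X(0,L)\hookrightarrow Y(0,L)$ means that there is $C>0$ with $\|f\|_{Y(0,L)}\le C\|f\|_{X(0,L)}$ for all $f\in\mathfrak M(0,L)$. For $\varphi\colon(0,L)\to(0,\infty)$ measurable, $T_\varphi f(t)=\frac1{\varphi(t)}\operatorname*{ess\,sup}_{s\in[t,L)}\varphi(s)f^*(s)$, $t\in(0,L)$, $f\in\mathfrak M(0,L)$. $T_\varphi$ is bounded on $X'(0,L)$ if $\|T_\varphi f\|_{X'(0,L)}\le C\|f\|_{X'(0,L)}$ for some $C$ and all $f$. $\Lambda^1_\xi(0,L)$ is given by the functional $\|f\|_{\Lambda^1_\xi(0,L)}=\int_0^Lf^*(s)\xi(s)\,ds$ (under the present assumptions equivalent to a rearrangement-invariant function norm, and so treated as a rearrangement-invariant function space); $M_\psi(0,L)$ is given by $\|f\|_{M_\psi(0,L)}=\sup_{t\in(0,L)}\psi(t)f^{**}(t)$. For rearrangement-invariant function spaces $X_0,X_1$ over $(0,L)$: $X_0\cap X_1$ has norm $\max\{\|f\|_{X_0},\|f\|_{X_1}\}$ and $X_0+X_1$ has norm $\inf_{f=g+h}(\|g\|_{X_0}+\|h\|_{X_1})$.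 $X$ is an intermediate space between $X_0$ and $X_1$ if $X_0\cap X_1\hookrightarrow X\hookrightarrow X_0+X_1$. A linear operator $T\colon X_0+X_1\to X_0+X_1$ is admissible for $(X_0,X_1)$ if it is bounded on both $X_0$ and $X_1$. $X\in\operatorname{Int}(X_0,X_1)$ means that $X$ is an interpolation space with respect to $(X_0,X_1)$, i.e., $X$ is intermediate and every admissible operator for the couple is bounded on $X$. *)

(* Defs.v *)
From HB Require Import structures.
From mathcomp Require Import all_boot all_order all_algebra.
From mathcomp Require Import all_classical all_reals all_analysis.
From mathcomp Require Import measurable_realfun ess_sup_inf.

Set Implicit Arguments.
Unset Strict Implicit.
Unset Printing Implicit Defensive.

Import Order.TTheory GRing.Theory Num.Theory.
Import numFieldNormedType.Exports.

Local Open Scope classical_set_scope.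
Local Open Scope ring_scope.
Local Open Scope ereal_scope.

(* The real line with the sigma-algebra of Lebesgue (not merely Borel)
   measurable sets, which is the domain of completed_lebesgue_measure.  Its
   carrier is convertible to R, but on R itself type inference finds the Borel
   sigma-algebra, hence the explicit structure in the next two definitions. *)
Definition lebesgue_line (R : realType) : measurableType _ :=
  caratheodory_type ((wlength (@idfun R))^*)%mu.

Notation leb := completed_lebesgue_measure.

Definition leb_measurable (R : realType) (E : set R) : Prop :=
  @measurable _ (lebesgue_line R) E.

Definition leb_measurable_fun (R : realType) d (U : measurableType d)
    (D : set R) (f : R -> U) : Prop :=
  @measurable_fun _ _ (lebesgue_line R) U D f.

(* The interval (0, L), with L possibly infinite.  A function on (0, L) is
   represented by a function on R; its values outside (0, L) never matter. *)
Definition ival (R : realType) (L : \bar R) : set R :=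
  [set t : R | (0 < t)%R /\ t%:E < L].

Definition meas_fun (R : realType) (L : \bar R) (f : R -> \bar R) : Prop :=
  leb_measurable_fun (ival L) f.

Definition meas_fun_nneg (R : realType) (L : \bar R) (f : R -> \bar R) : Prop :=
  meas_fun L f /\ {ae leb, forall t, ival L t -> 0 <= f t}.

(* Padding by -oo makes this the essential supremum relative to E. *)
Definition ess_sup_on (R : realType) (E : set R)
    (f : R -> \bar R) : \bar R :=
  ess_sup leb (patch (fun=> -oo) E f).

Definition distribution_fun (R : realType) (L : \bar R) (f : R -> \bar R)
    (l : R) : \bar R :=
  leb [set s : R | ival L s /\ l%:E < `|f s|].

Definition rearrangement (R : realType) (L : \bar R) (f : R -> \bar R)
    (t : R) : \bar R :=
  ereal_inf [set l%:E | l in [set l : R |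
    (0 < l)%R /\ distribution_fun L f l <= t%:E]].

Definition max_rearrangement (R : realType) (L : \bar R) (f : R -> \bar R)
    (t : R) : \bar R :=
  (t^-1)%:E *
  \int[leb]_(s in `]0%R, t[%classic)
    rearrangement L f s.

Definition equimeasurable (R : realType) (L : \bar R) (f g : R -> \bar R) :
    Prop :=
  forall l : R, (0 < l)%R -> distribution_fun L f l = distribution_fun L g l.

(* A functional on the functions on (0, L). *)
Notation functional R := ((Real.sort R -> \bar (Real.sort R)) ->
  \bar (Real.sort R)).

Record ri_norm (R : realType) (L : \bar R) (N : functional R) : Prop := {
  rin_ge0 : forall f, meas_fun_nneg L f -> 0 <= N f ;
  rin_eq0 : forall f, meas_fun_nneg L f ->
    N f = 0 <-> ae_eq leb (ival L) f (fun=> 0) ;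
  rinZ : forall (a : R) f, (0 <= a)%R -> meas_fun_nneg L f ->
    N (fun t => a%:E * f t) = a%:E * N f ;
  rin_triangle : forall f g, meas_fun_nneg L f -> meas_fun_nneg L g ->
    N (f \+ g) <= N f + N g ;
  rin_mono : forall f g, meas_fun_nneg L f -> meas_fun_nneg L g ->
    {ae leb, forall t, ival L t -> f t <= g t} ->
    N f <= N g ;
  rin_fatou : forall (f_ : nat -> R -> \bar R) (f : R -> \bar R),
    (forall k, meas_fun_nneg L (f_ k)) -> meas_fun_nneg L f ->
    {ae leb, forall t, ival L t ->
      nondecreasing_seq (fun k => f_ k t) /\ f_ k t @[k --> \oo] --> f t} ->
    nondecreasing_seq (fun k => N (f_ k)) /\ N (f_ k) @[k --> \oo] --> N f ;
  rin_indic : forall E : set R, leb_measurable E ->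
    E `<=` ival L -> leb E < +oo -> N (fun t => (\1_E t)%:E) < +oo ;
  rin_local : forall E : set R, leb_measurable E ->
    E `<=` ival L -> leb E < +oo ->
    exists C : R, (0 < C)%R /\ forall f, meas_fun_nneg L f ->
      \int[leb]_(t in E) f t <= C%:E * N f ;
  rin_equi : forall f g, meas_fun_nneg L f -> meas_fun_nneg L g ->
    equimeasurable L f g -> N f = N g
}.

(* Extension of a functional from nonnegative to all measurable functions. *)
Definition ext_norm (R : realType) (N : functional R) : functional R :=
  fun f => N (fun t => `|f t|).

Definition assoc_norm (R : realType) (L : \bar R) (N : functional R) :
    functional R :=
  fun f => ereal_sup [set \int[leb]_(t in ival L) (f t * g t) | g in
    [set g : R -> \bar R | meas_fun_nneg L g /\ N g <= 1]].

(* The functionals below act on all measurable functions on (0, L); the space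
   of such a functional N consists of the f with N f < +oo. *)
Definition fspace (R : realType) (L : \bar R) (N : functional R)
    (f : R -> \bar R) : Prop :=
  meas_fun L f /\ N f < +oo.

Definition embeds (R : realType) (L : \bar R) (N N' : functional R) : Prop :=
  exists C : R, (0 < C)%R /\ forall f, meas_fun L f -> N' f <= C%:E * N f.

Definition L1_norm (R : realType) (L : \bar R) : functional R :=
  fun f => 'N[leb]_1 [f \_ (ival L)].

Definition Linfty_norm (R : realType) (L : \bar R) : functional R :=
  fun f => 'N[leb]_+oo [f \_ (ival L)].

Definition Lambda1_norm (R : realType) (L : \bar R) (xi : R -> R) :
    functional R :=
  fun f => \int[leb]_(s in ival L) (rearrangement L f s * (xi s)%:E).

Definition Mpsi_norm (R : realType) (L : \bar R) (psi : R -> \bar R) :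
    functional R :=
  fun f => ereal_sup [set psi t * max_rearrangement L f t | t in ival L].

Definition cap_norm (R : realType) (N0 N1 : functional R) : functional R :=
  fun f => maxe (N0 f) (N1 f).

Definition sum_norm (R : realType) (L : \bar R) (N0 N1 : functional R) :
    functional R :=
  fun f => ereal_inf [set N0 gh.1 + N1 gh.2 | gh in
    [set gh : (R -> \bar R) * (R -> \bar R) |
      [/\ meas_fun L gh.1, meas_fun L gh.2 &
          ae_eq leb (ival L) f (gh.1 \+ gh.2)]]].

Definition intermediate (R : realType) (L : \bar R) (N0 N1 N : functional R) :
    Prop :=
  embeds L (cap_norm N0 N1) N /\ embeds L N (sum_norm L N0 N1).

(* Linear operators on a space V of functions on (0, L), functions that agree
   a.e. being identified.  The values of T outside V never matter. *)
Record linear_operator (R : realType) (L : \bar R)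
    (V : (R -> \bar R) -> Prop) (T : (R -> \bar R) -> R -> \bar R) : Prop := {
  linop_stable : forall f, V f -> V (T f) ;
  linop_ae : forall f g, V f -> V g ->
    ae_eq leb (ival L) f g -> ae_eq leb (ival L) (T f) (T g) ;
  linopD : forall f g, V f -> V g ->
    ae_eq leb (ival L) (T (f \+ g)) (T f \+ T g) ;
  linopZ : forall (a : R) f, V f ->
    ae_eq leb (ival L) (T (fun t => a%:E * f t)) (fun t => a%:E * T f t)
}.

(* The inequality is void when N f = +oo, since C is positive. *)
Definition bounded_on (R : realType) (L : \bar R) (N : functional R)
    (T : (R -> \bar R) -> R -> \bar R) : Prop :=
  exists C : R, (0 < C)%R /\ forall f, meas_fun L f -> N (T f) <= C%:E * N f.

Definition admissible (R : realType) (L : \bar R) (N0 N1 : functional R)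
    (T : (R -> \bar R) -> R -> \bar R) : Prop :=
  [/\ linear_operator L (fspace L (sum_norm L N0 N1)) T,
      bounded_on L N0 T & bounded_on L N1 T].

(* The space of N belongs to Int(X0, X1), where X0, X1 are the spaces of N0, N1. *)
Definition interpolation (R : realType) (L : \bar R) (N0 N1 N : functional R) :
    Prop :=
  intermediate L N0 N1 N /\
  forall T, admissible L N0 N1 T -> bounded_on L N T.

Definition sup_operator (R : realType) (L : \bar R) (phi : R -> R)
    (f : R -> \bar R) (t : R) : \bar R :=
  ((phi t)^-1)%:E *
  ess_sup_on [set s : R | (t <= s)%R /\ s%:E < L]
    (fun s => (phi s)%:E * rearrangement L f s).

Definition equivalent_on (R : realType) (L : \bar R) (f g : R -> R) : Prop :=
  exists C : R, (0 < C)%R /\ forall t, ival L t ->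
    (f t <= C * g t)%R /\ (g t <= C * f t)%R.

Definition equiv_continuous_nondecreasing (R : realType) (L : \bar R)
    (phi : R -> R) : Prop :=
  exists phi0 : R -> R,
    [/\ forall t, ival L t -> (0 < phi0 t)%R,
        forall t, ival L t -> {for t, continuous phi0},
        forall s t, ival L s -> ival L t -> (s <= t)%R -> (phi0 s <= phi0 t)%R
      & equivalent_on L phi phi0].

Definition primitive0 (R : realType) (xi : R -> R) (t : R) : \bar R :=
  \int[leb]_(s in `]0%R, t[%classic) (xi s)%:E.

Definition averaging (R : realType) (L : \bar R) (xi : R -> R) : Prop :=
  ess_sup_on (ival L) (fun t => ((t * xi t)^-1)%:E * primitive0 xi t) < +oo.

(* Main.v *)
(* Replace phi by an equivalent nondecreasing function and write xi = 1/phi,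
   H f (t) = sup_{s >= t} phi(s) f^*(s) and U f = xi (H f); then T_phi is pointwise
   equivalent to U, and the averaging condition says that the primitive of xi is
   comparable to t xi(t), so that the norm of M_psi is equivalent to
   sup_t phi(t) f^*(t).

   Let U be bounded on X' and let T be admissible.  Cutting f at the height f^*(a)
   gives, in the case of (ii), that the integral of (T f)^* xi over (0, a) is at most
   a constant times that of f^* xi, and in the case of (iii) that the integral of
   (T f)^* over (0, a) is at most a constant times that of U f.  In the second case
   the Hardy-Littlewood-Polya principle concludes.  In the first one, since
   g^* <= xi (H g) with H g nonincreasing, Hardy's lemma bounds the integral of
   |T f| g by a constant times that of f^* (U g), hence by a constant times the
   product of the norm of f in X and that of g in X'; the Lorentz-Luxemburg theorem
   X'' = X concludes.

   Conversely, fix f in X' and choose measurably near maximizers s(t) >= t/e of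
   phi f^*.  The positive operator that maps g to 2 xi(t) phi(s)/s times the integral
   of g over (s/2, s), where s = s(t), maps f^* to at least (U f)/2; it is admissible
   for (L^1, M_psi), and its transpose is admissible for (Lambda^1_xi, L^oo), so U f
   lies in X'.  The bound is uniform in f: otherwise a suitable series of functions
   in X' would be mapped outside X'. *)
Require Import Defs.
From HB Require Import structures.
From mathcomp Require Import all_boot all_order all_algebra.
From mathcomp Require Import all_classical all_reals all_analysis.
From mathcomp Require Import measurable_realfun ess_sup_inf.
From mathcomp Require Import ring lra.
Import Order.TTheory GRing.Theory Num.Theory.
Import numFieldNormedType.Exports.
Local Open Scope classical_set_scope.
Local Open Scope ring_scope.
Local Open Scope ereal_scope.
Set Implicit Arguments.
Unset Strict Implicit.
Unset Printing Implicit Defensive.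

(** * Layer-cake comparison of integrals *)

(** The operator that recovers U f from f^* depends on f, so each application of the interpolation
    property gives a constant depending on f; hence the separate uniformity argument. Near
    maximizers exist only where H f is finite. Under (iii) this finiteness comes from the embedding
    of X' into the sum of L^1 and M_psi; under (ii) it comes from the inclusion of X' in L^1,
    available when L is finite. In the opposite direction, L finite puts xi in X' and X' in L^1,
    which is what makes X' intermediate.

    The height f^*(a) suits both couples: the part of f above it has a rearrangement vanishing
    beyond a, and the part below it is controlled by f^*(a) and by the values of f^* beyond a.

    In the Lorentz-Luxemburg theorem a projection takes the place of Hahn-Banach separation: a
    bounded function of bounded support has a closest point, in L^2, in a ball of X, and the
    difference of the two is, up to a factor, the separating functional. Passing from X to X' also
    needs resonance, for which nested sets of prescribed measure are built along the levels of
    |u|. *)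

Section layer_cake.
Context {d} {T : measurableType d} {R : realType}.
Context (mu : {sigma_finite_measure set T -> \bar R}).
Implicit Types (D : set T) (u p : T -> \bar R).

(** Setting the layers at levels [l <= 0] to zero lets the outer integral run over the whole line,
    so that Tonelli's theorem applies to a product of full spaces. *)
Definition layer D u p (l : measurableTypeR R) : \bar R :=
  if (0 < l)%R then \int[mu]_(x in D `&` [set x | l%:E < p x]) u x else 0.

(** Tonelli's theorem for the function u(x) on the region 0 < l < p(x): integrating in l first gives
    u(x) p(x), also where p(x) is infinite. *)
Lemma layer_cake D u p : measurable D ->
  measurable_fun D u -> measurable_fun D p ->
  (forall x, D x -> 0 <= u x) -> (forall x, D x -> 0 <= p x) ->
  measurable_fun setT (layer D u p) /\
  \int[mu]_(x in D) (u x * p x) = \int[lebesgue_measure]_l layer D u p l.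
Proof.
move=> mD mu_ mp u0 p0.
pose u' : T -> \bar R := u \_ D; pose p' : T -> \bar R := p \_ D.
have mu' : measurable_fun setT u' by apply/(measurable_restrictT _ mD).
have mp' : measurable_fun setT p' by apply/(measurable_restrictT _ mD).
have u'0 x : 0 <= u' x by rewrite /u' /patch; case: ifPn => // /set_mem /u0.
have p'0 x : 0 <= p' x by rewrite /p' /patch; case: ifPn => // /set_mem /p0.
pose S := [set z : T * measurableTypeR R | (0 < z.2)%R /\ z.2%:E < p' z.1].
have mS : measurable S.
  have -> : S = (setT `&` [set z | 0%:E < z.2%:E]) `&`
    (setT `&` [set z | 0 < p' z.1 - z.2%:E]).
    by apply/seteqP; split => -[x l] /=; rewrite EFinN sube_gt0 lte_fin /S/=; tauto.
  apply: measurableI; apply: emeasurable_fun_o_infty => //.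
    apply/measurable_EFinP; exact: measurable_snd.
  apply: emeasurable_funD.
    by apply: measurableT_comp => //; exact: measurable_fst.
  apply: measurableT_comp => //; apply/measurable_EFinP; exact: measurable_snd.
pose F (z : T * measurableTypeR R) := u' z.1 * (\1_S z)%:E.
have mF : measurable_fun setT F.
  apply: emeasurable_funM.
    by apply: measurableT_comp => //; exact: measurable_fst.
  by apply/measurable_EFinP; exact: measurable_indic.
have F0 z : 0 <= F z by rewrite mule_ge0.
have FE : layer D u p = fubini_G mu F.
  apply/funext => l; apply/esym; rewrite /layer /fubini_G.
  rewrite [LHS](_ : _ = \int[mu]_x (u' \_ [set x | S (x, l)]) x); last first.
    apply: eq_integral => x _; rewrite /F /= indicE patchE.
    case: ifPn => [|]; first by move/set_mem => h; rewrite mem_set// mule1.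
    by move/negP => h; rewrite memNset ?mule0// => ?; apply: h; rewrite inE.
  rewrite -integral_mkcond; case: ifPn => l0; last first.
    rewrite (_ : [set _ | _] = set0) ?integral_set0// -subset0 => x /= [] /=.
    by rewrite (negbTE l0).
  rewrite (_ : [set x | _] = D `&` [set x | l%:E < p x]).
    by apply: eq_integral => x /set_mem [Dx _]; rewrite /u' patchE mem_set.
  apply/seteqP; split => x; rewrite /S/= /p' patchE.
    by move=> [_]; case: ifPn => [/set_mem|] //; rewrite lte_fin ltNge (ltW l0).
  by move=> [Dx h]; rewrite mem_set.
split; first by rewrite FE; exact: measurable_fun_fubini_tonelli_G.
transitivity (\int[mu]_x \int[lebesgue_measure]_l F (x, l)).
  rewrite integral_mkcond; apply: eq_integral => x _.
  pose A : set (measurableTypeR R) := [set l : R | (0 < l)%R /\ l%:E < p' x].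
  have -> : (fun l => F (x, l)) = (fun l => u' x * (\1_A l)%:E).
    apply/funext => l; rewrite /F /= !indicE; congr (_ * (_%:R)%:E).
  have -> : A = [set` (if p' x is r%:E then `]0%R, r[ else `]0%R, +oo[)].
    apply/seteqP; split => l; rewrite /A/=; have := p'0 x.
      by case: (p' x) => [r| |] //=; rewrite ?lte_fin ?in_itv/= ?andbT// => _ [-> ].
    case: (p' x) => [r| |] //=; rewrite ?lte_fin ?in_itv/= ?andbT// => _.
      by move=> /andP.
    by rewrite ltry.
  have mi : measurable [set` (if p' x is r%:E then `]0%R, r[ else `]0%R, +oo[)].
    by case: (p' x).
  rewrite ge0_integralZl//; last first.
    by apply/measurable_EFinP; exact: measurable_indic.
  rewrite integral_indic//.
  rewrite setIT.
  transitivity (u' x * p' x).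
    by rewrite /u' /p' !patchE; case: ifPn => //; rewrite mul0e.
  congr (_ * _).
  case: (p' x) (p'0 x) => [r| |] //= r0; rewrite lebesgue_measure_itv/=.
    rewrite lte_fin sube0; case: ltP => //; rewrite lee_fin in r0.
    by move=> ?; congr (_%:E); apply/eqP; rewrite eq_le r0 andbT.
  by rewrite ltry.
rewrite (fubini_tonelli F)//; apply: eq_integral => l _; rewrite FE//.
Qed.

End layer_cake.

(** Reduces an inequality between integrals of products to one for each superlevel set of one
    factor. The superlevel sets of a rearrangement are intervals starting at 0, which makes the
    reduced inequalities tractable. *)
Lemma le_integral_layers {d1 d2} {T1 : measurableType d1} {T2 : measurableType d2}
    {R : realType} (m1 : {sigma_finite_measure set T1 -> \bar R})
    (m2 : {sigma_finite_measure set T2 -> \bar R}) (D : set T1) (E : set T2)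
    (u p : T1 -> \bar R) (v q : T2 -> \bar R) :
  measurable D -> measurable E ->
  measurable_fun D u -> measurable_fun D p ->
  measurable_fun E v -> measurable_fun E q ->
  (forall x, D x -> 0 <= u x) -> (forall x, D x -> 0 <= p x) ->
  (forall x, E x -> 0 <= v x) -> (forall x, E x -> 0 <= q x) ->
  (forall l : R, (0 < l)%R ->
     \int[m1]_(x in D `&` [set x | l%:E < p x]) u x <=
     \int[m2]_(x in E `&` [set x | l%:E < q x]) v x) ->
  \int[m1]_(x in D) (u x * p x) <= \int[m2]_(x in E) (v x * q x).
Proof.
move=> mD mE mu mp mv mq u0 p0 v0 q0 H.
have [mL ->] := layer_cake m1 mD mu mp u0 p0.
have [mL' ->] := layer_cake m2 mE mv mq v0 q0.
apply: ge0_le_integral => //.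
- move=> l _; rewrite /layer; case: ifP => // _.
  by apply: integral_ge0 => x [/u0].
- by move=> l _; rewrite /layer; case: ifPn => // /H.
Qed.

(** The factor may be infinite; both sides are then 0 if all terms vanish and +oo otherwise. *)
Lemma nneseriesZle {R : realType} (y : \bar R) (u : nat -> \bar R) : 0 <= y ->
  (forall n, 0 <= u n) -> \sum_(n <oo) (y * u n) = y * \sum_(n <oo) u n.
Proof.
case: y => [y| |]// _ u0; first by rewrite nneseriesZl.
have [uE|/existsNP[n un]] := pselect (forall n, u n = 0).
  by rewrite !eseries0 ?mule0// => n _ _; rewrite uE ?mule0.
have un0 : 0 < u n by rewrite lt0e u0 andbT; exact/eqP.
rewrite [RHS]gt0_mulye; last first.
  apply: lt_le_trans un0 _.
  apply: le_trans (@nneseries_lim_ge _ u xpredT 0 n.+1 (fun k _ _ => u0 k)).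
  by rewrite big_nat_recr//= leeDr// sume_ge0.
apply/eqP; rewrite -leye_eq.
apply: le_trans (@nneseries_lim_ge _ (fun k => +oo * u k) xpredT 0 n.+1 _); last first.
  by move=> k _ _; exact: mule_ge0.
rewrite big_nat_recr//= gt0_mulye// leeDr// sume_ge0// => k _.
exact: mule_ge0.
Qed.

(** * Lebesgue measure on (0, L) and rearrangements *)

Section lebesgue_line_facts.
Context {R : realType}.
Implicit Types (A E : set R) (L : \bar R) (f g : R -> \bar R).

Lemma borel_leb_measurable A : measurable A -> leb_measurable A.
Proof. move=> mA; exact: sub_caratheodory. Qed.

Lemma ivalE L : ival L = if L is r%:E then `]0%R, r[%classic else
  if L == +oo then `]0%R, +oo[%classic else set0.
Proof.
apply/seteqP; split => t; case: L => [r| |] //=; rewrite /ival/= ?in_itv/= ?andbT ?lte_fin ?ltry ?ltNyr ?ltNge ?leNye//.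
- by move=> [-> ->].
- by move=> [].
- by case.
- by move=> /andP.
Qed.

Lemma borel_ival L : measurable (ival L).
Proof. by rewrite ivalE; case: L => [r| |] //=. Qed.

Lemma leb_ival L : 0 <= L -> leb (ival L) = L.
Proof.
move=> L0; rewrite -[LHS]/(lebesgue_measure (ival L)) ivalE.
case: L L0 => [r| |] //= r0; rewrite lebesgue_measure_itv/=.
  rewrite lte_fin sube0; case: ltP => //; rewrite lee_fin in r0.
  by move=> ?; congr (_%:E); apply/eqP; rewrite eq_le r0.
by rewrite ltry.
Qed.

Lemma measurable_ival L : leb_measurable (ival L).
Proof. by apply: borel_leb_measurable; exact: borel_ival. Qed.

Lemma leb_set1 (a : R) : leb [set a] = 0.
Proof. by rewrite -[LHS]/(lebesgue_measure [set a]) lebesgue_measure_set1. Qed.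

Lemma ivalI L (y : \bar R) : ival L `&` [set t | t%:E < y] = ival (mine L y).
Proof.
by apply/seteqP; split => t; rewrite /ival/= lt_min; last first; [by move=> [-> /andP[-> ->]]|by move=> [[-> ->] ->]].
Qed.

Lemma ivalS L L' : L <= L' -> ival L `<=` ival L'.
Proof. by move=> LL' t [t0 tL]; split => //; exact: lt_le_trans LL'. Qed.

Lemma itv_ival (a : R) : `]0%R, a[%classic = ival a%:E.
Proof. by rewrite ivalE. Qed.

Lemma nonincreasing_meas_fun L f :
  (forall s t, ival L s -> ival L t -> (s <= t)%R -> f t <= f s) ->
  meas_fun L f.
Proof.
move=> ni; rewrite /meas_fun /leb_measurable_fun.
apply: (measurability _ (ErealGenOInfty.measurableE R)) => _ [_ [x ->] <-].
apply: borel_leb_measurable; apply: is_interval_measurable.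
move=> s t [Is _] [It /=]; rewrite in_itv/= andbT => ft u /andP[su ut].
have Iu : ival L u.
  split; first exact: lt_le_trans (proj1 Is) su.
  by apply: le_lt_trans (proj2 It); rewrite lee_fin.
by split => //=; rewrite in_itv/= andbT (lt_le_trans ft)// ni.
Qed.

(** Superlevel sets of a nonincreasing function may contain their right endpoint; this discards
    it. *)
Lemma leb_setU1 (D : set R) (a : R) f : leb_measurable D ->
  leb_measurable_fun (D `|` [set a]) f ->
  (forall x, (D `|` [set a]) x -> 0 <= f x) ->
  \int[leb]_(x in D `|` [set a]) f x = \int[leb]_(x in D) f x.
Proof.
move=> mD mf f0.
have ma : leb_measurable [set a] by apply: borel_leb_measurable; exact: measurable_set1.
have mDa : leb_measurable (D `|` [set a]) by exact: (@measurableU _ (lebesgue_line R)).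
have [Da|Da] := pselect (D a).
  congr (integral _ _ _); apply/seteqP; split => x; [by case=> // ->|by left].
rewrite ge0_integral_setU//; last first.
  by apply/disj_setPS => x [/= + xa]; rewrite xa.
rewrite [X in _ + X](_ : _ = 0) ?adde0//.
by apply: null_set_integral => //; [apply: measurable_funS mf|exact: leb_set1].
Qed.

End lebesgue_line_facts.

Lemma leb_ae_imp {R : realType} (E : set R) (P Q : R -> Prop) :
  (forall t, E t -> P t -> Q t) ->
  {ae leb, forall t, E t -> P t} -> {ae leb, forall t, E t -> Q t}.
Proof.
move=> PQ [A [mA A0 PA]]; exists A; split => // t /= nQ; apply: PA => /= nP.
by apply: nQ => Et; apply: PQ => //; exact: nP.
Qed.

Lemma leb_ae_and {R : realType} (E : set R) (P Q : R -> Prop) :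
  {ae leb, forall t, E t -> P t} -> {ae leb, forall t, E t -> Q t} ->
  {ae leb, forall t, E t -> P t /\ Q t}.
Proof.
move=> [A [mA A0 PA]] [B [mB B0 QB]]; exists (A `|` B); split.
- exact: (@measurableU _ (lebesgue_line R)).
- apply/eqP; rewrite eq_le measure_ge0 andbT.
  apply: le_trans (measureU2 _ mA mB) _.
  by rewrite [X in X + _](_ : _ = 0)// [X in _ + X](_ : _ = 0)// adde0.
move=> t /= nPQ; have [At|nAt] := pselect (A t); [by left|right; apply: QB => /= nQ].
apply: nPQ => Et; split; last exact: nQ.
by apply: contrapT => nP; apply: nAt; apply: PA => /= h; apply: nP; exact: h.
Qed.

Lemma cvg_ereal_le {R : realType} (u : nat -> \bar R) (l B : \bar R) :
  u n @[n --> \oo] --> l -> (forall n, u n <= B) -> l <= B.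
Proof.
move=> c uB; rewrite -(cvg_lim _ c)//; apply: lime_le; last exact: nearW.
by apply/cvg_ex; exists l.
Qed.

Lemma ereal_between_ge0 {R : realType} (x y : \bar R) : 0 <= x -> x < y ->
  exists2 l : R, (0 < l)%R & x < l%:E < y.
Proof.
move=> x0 xy; have : x \is a fin_num by rewrite ge0_fin_numE// (lt_le_trans xy)// leey.
case: x x0 xy => [r| |]// r0 xy _; rewrite lee_fin in r0; case: y xy => [q| |]//.
  rewrite lte_fin => rq; exists ((r + q) / 2)%R; last by rewrite !lte_fin; case: (midf_lt rq) => -> ->.
  by apply: le_lt_trans r0 _; case: (midf_lt rq).
by move=> _; exists (r + 1)%R; [rewrite ltr_wpDl|rewrite ltry lte_fin ltrDl ltr01].
Qed.

Section rearrangement_facts.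
Context {R : realType} {L : \bar R}.
Hypothesis L0 : 0 < L.
Implicit Types (f g h u v w : R -> \bar R) (l s t a : R).
Local Notation D := (distribution_fun L).
Local Notation I := (ival L).
Local Notation "f ^*" := (rearrangement L f).

Lemma measurable_superlevel_abs f l : meas_fun L f ->
  leb_measurable [set s | I s /\ l%:E < `|f s|].
Proof.
move=> mf; apply: (@emeasurable_fun_o_infty _ (lebesgue_line R) R I) => //.
  exact: measurable_ival.
by apply: (@measurableT_comp _ _ _ (lebesgue_line R) _ _ abse); [exact: abse_measurable|exact: mf].
Qed.

Lemma distribution_fun_le f l : meas_fun L f -> D f l <= L.
Proof.
move=> mf; rewrite -[leRHS](leb_ival (ltW L0)).
apply: le_measure; rewrite ?inE; first exact: measurable_superlevel_abs.
  exact: measurable_ival.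
by move=> s [].
Qed.

Lemma distribution_fun_ge0 f l : 0 <= D f l.
Proof. exact: measure_ge0. Qed.

Lemma ae_le_distribution_fun f g l : meas_fun L f -> meas_fun L g ->
  {ae leb, forall t, I t -> `|f t| <= `|g t|} -> D f l <= D g l.
Proof.
move=> mf mg [N [mN N0 fgN]].
have mfl := measurable_superlevel_abs l mf; have mgl := measurable_superlevel_abs l mg.
apply: (@le_trans _ _ (leb ([set s | I s /\ l%:E < `|g s|] `|` N))).
  apply: le_measure; rewrite ?inE//; first exact: (@measurableU _ (lebesgue_line R)).
  move=> s [Is ls]; have [Ns|Ns] := pselect (N s); [by right|left; split => //].
  apply: lt_le_trans ls _; apply: contrapT => h; apply: Ns; apply: fgN => /=.
  by apply: contra_not h; exact.
apply: le_trans (measureU2 _ _ _) _ => //.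
by rewrite [X in _ + X](_ : _ = 0)// adde0.
Qed.

Lemma le_distribution_fun f g l : meas_fun L f -> meas_fun L g ->
  (forall t, I t -> `|f t| <= `|g t|) -> D f l <= D g l.
Proof. by move=> mf mg fg; apply: ae_le_distribution_fun => //; exact: aeW. Qed.

Lemma distribution_fun_nonincr f l l' : meas_fun L f -> (l <= l')%R -> D f l' <= D f l.
Proof.
move=> mf ll'; apply: le_measure; rewrite ?inE; [exact: measurable_superlevel_abs..|].
by move=> s [Is ls]; split => //; apply: le_lt_trans ls; rewrite lee_fin.
Qed.

(** Right continuity of the distribution function: the set where |f| > l is the increasing union of
    the sets where |f| > l + 1/(n+1). *)
Lemma distribution_fun_right f l t : meas_fun L f -> t%:E < D f l ->
  exists2 l', (l < l')%R & t%:E < D f l'.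
Proof.
move=> mf tl; apply: contrapT => h.
have {}h l' : (l < l')%R -> D f l' <= t%:E.
  by move=> ll'; rewrite leNgt; apply/negP => ?; apply: h; exists l'.
pose F n := [set s | I s /\ (l + n.+1%:R^-1)%:E < `|f s|].
have FE : \bigcup_n F n = [set s | I s /\ l%:E < `|f s|].
  apply/seteqP; split => s.
    by move=> [n _ [Is ls]]; split => //; apply: lt_trans ls; rewrite lte_fin ltrDl.
  move=> [Is]; case E: `|f s| => [r| |] // lr; last first.
    by exists 0%N => //; split => //; rewrite E ltry.
  have rl : (0 < r - l)%R by rewrite subr_gt0 -lte_fin.
  have [n _ /(_ n (leqnn _)) /= nr] := near_infty_natSinv_lt (PosNum rl).
  exists n => //; split => //; rewrite E lte_fin -ltrBrDl; exact: nr.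
have cF : leb (F n) @[n --> \oo] --> D f l.
  rewrite /D -FE; apply: nondecreasing_cvg_mu.
  - by move=> n; exact: measurable_superlevel_abs.
  - by apply: bigcup_measurable => n _; exact: measurable_superlevel_abs.
  - move=> m n mn; apply/subsetPset => s [Is ls]; split => //; apply: le_lt_trans ls.
    by rewrite lee_fin lerD2l lef_pV2 ?posrE// ler_nat ltnS.
move: tl; rewrite ltNge => /negP; apply.
rewrite -(cvg_lim _ cF)//; apply: lime_le; first by apply/cvg_ex; eexists; exact: cF.
by apply: nearW => n; apply: h; rewrite ltrDl.
Qed.

Lemma rearrangement_ge0 f t : 0 <= f^* t.
Proof. by apply: le_ereal_inf_tmp => _ [l [l0 _] <-]; rewrite lee_fin ltW. Qed.

(** The infimum defining the rearrangement runs over positive levels only; the level 0 is reached by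
    adding e > 0 and letting e tend to 0. *)
Lemma rearrangement_le f l t : meas_fun L f -> (0 <= l)%R ->
  D f l <= t%:E -> f^* t <= l%:E.
Proof.
move=> mf l0 dl; apply/lee_addgt0Pr => e e0; rewrite -EFinD.
apply: ereal_inf_lbound; exists (l + e)%R => //; split; first by rewrite ltr_wpDl.
by apply: le_trans dl; apply: distribution_fun_nonincr => //; rewrite lerDl ltW.
Qed.

(** The rearrangement and the distribution function are generalized inverses of each other. The
    implication from right to left is where right continuity enters. All superlevel sets of
    rearrangements are computed from this equivalence. *)
Lemma rearrangement_gt f l t : meas_fun L f -> (0 <= l)%R ->
  (l%:E < f^* t) = (t%:E < D f l).
Proof.
move=> mf l0; apply/idP/idP => [|tl].
  by rewrite !ltNge; apply: contra; exact: rearrangement_le.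
have [l' ll' tl'] := distribution_fun_right mf tl.
apply: (@lt_le_trans _ _ l'%:E) => //; apply: le_ereal_inf_tmp => _ [m [m0 dm] <-].
rewrite lee_fin leNgt; apply/negP => ml'.
move: tl'; rewrite ltNge => /negP; apply; apply: le_trans dm.
by apply: distribution_fun_nonincr => //; exact: ltW.
Qed.

Lemma rearrangement_nonincr f s t : (s <= t)%R -> f^* t <= f^* s.
Proof.
move=> st; apply: ereal_inf_le_tmp => _ [l [l0 dl] <-].
by exists l => //; split => //; apply: le_trans dl _; rewrite lee_fin.
Qed.

Lemma meas_rearrangement f : meas_fun L f^*.
Proof. by apply: nonincreasing_meas_fun => s t _ _; exact: rearrangement_nonincr. Qed.

Lemma superlevel_rearrangement f l : meas_fun L f -> (0 <= l)%R ->
  I `&` [set t | l%:E < f^* t] = ival (D f l).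
Proof.
move=> mf l0; rewrite (_ : [set _ | _] = [set t | t%:E < D f l]).
  by rewrite ivalI (min_idPr _)//; exact: distribution_fun_le.
by apply/seteqP; split => t /=; rewrite rearrangement_gt.
Qed.

Lemma distribution_rearrangement f l : meas_fun L f -> (0 <= l)%R ->
  D f^* l = D f l.
Proof.
move=> mf l0; rewrite -[RHS](leb_ival (distribution_fun_ge0 f l)).
rewrite -superlevel_rearrangement//; congr (leb _).
by apply/seteqP; split => t /= [It]; rewrite gee0_abs ?rearrangement_ge0.
Qed.

Lemma le_rearrangement f g t :
  (forall l, (0 < l)%R -> D f l <= D g l) -> f^* t <= g^* t.
Proof.
move=> fg; apply: ereal_inf_le_tmp => _ [l [l0 dl] <-].
by exists l => //; split => //; apply: le_trans dl; exact: fg.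
Qed.

(** If h(t) < l, then h > l only on a part of (0, t), so the distribution function at l is at most
    t. The inequality can be strict at a jump of h, because the rearrangement is right
    continuous. *)
Lemma rearrangement_noninc_le h t : meas_fun L h ->
  (forall s, I s -> 0 <= h s) ->
  (forall s t, I s -> I t -> (s <= t)%R -> h t <= h s) ->
  I t -> h^* t <= h t.
Proof.
move=> mh h0 nih It; rewrite leNgt; apply/negP => hlt.
have [l l0 /andP[hl lh]] := ereal_between_ge0 (h0 _ It) hlt.
move: lh; rewrite rearrangement_gt ?(ltW l0)// ltNge => /negP; apply.
rewrite -(leb_ival (_ : 0 <= t%:E)); last by rewrite lee_fin ltW//; case: It.
apply: le_measure; rewrite ?inE; [exact: measurable_superlevel_abs|exact: measurable_ival|].
move=> s [Is]; rewrite gee0_abs ?h0// => ls; split; first by case: Is.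
rewrite lte_fin ltNge; apply/negP => ts.
by move: ls; rewrite ltNge => /negP; apply; rewrite (le_trans _ (ltW hl))// nih.
Qed.

End rearrangement_facts.

(** * Integrals of rearrangements *)

Section integrals_of_rearrangements.
Context {R : realType} {L : \bar R}.
Hypothesis L0 : 0 < L.
Implicit Types (f g h u v w p q : R -> \bar R) (l s t a : R) (E : set R).
Local Notation D := (distribution_fun L).
Local Notation I := (ival L).
Local Notation "f ^*" := (rearrangement L f).

Lemma meas_fun_abs L' f : meas_fun L' f -> meas_fun L' (fun t => `|f t|).
Proof.
move=> mf; apply: (@measurableT_comp _ _ _ (lebesgue_line R) _ _ abse);
  [exact: abse_measurable|exact: mf].
Qed.

Lemma meas_funM L' f g : meas_fun L' f -> meas_fun L' g ->
  meas_fun L' (fun t => f t * g t).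
Proof. exact: (@emeasurable_funM _ (lebesgue_line R)). Qed.

Lemma meas_funD L' f g : meas_fun L' f -> meas_fun L' g -> meas_fun L' (f \+ g).
Proof. exact: (@emeasurable_funD _ (lebesgue_line R)). Qed.

Lemma meas_fun_cst L' (c : \bar R) : meas_fun L' (fun=> c).
Proof. exact: (@measurable_cst _ _ (lebesgue_line R)). Qed.

Lemma meas_fun_max L' f g : meas_fun L' f -> meas_fun L' g ->
  meas_fun L' (fun t => maxe (f t) (g t)).
Proof. exact: (@measurable_maxe _ (lebesgue_line R)). Qed.

Lemma meas_fun_min L' f g : meas_fun L' f -> meas_fun L' g ->
  meas_fun L' (fun t => mine (f t) (g t)).
Proof. exact: (@measurable_mine _ (lebesgue_line R)). Qed.

Lemma leb_measurable_funS E L' f : E `<=` ival L' -> meas_fun L' f ->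
  leb_measurable_fun E f.
Proof.
by apply: (@measurable_funS _ _ (lebesgue_line R)); exact: measurable_ival.
Qed.

Lemma meas_funS L1 L2 f : L1 <= L2 -> meas_fun L2 f -> meas_fun L1 f.
Proof. by move=> /ivalS; exact: leb_measurable_funS. Qed.

Lemma leb_le_integral E f g : leb_measurable E ->
  leb_measurable_fun E f -> leb_measurable_fun E g ->
  (forall x, E x -> 0 <= f x) -> (forall x, E x -> f x <= g x) ->
  \int[leb]_(x in E) f x <= \int[leb]_(x in E) g x.
Proof. by move=> mE mf mg f0 fg; exact: ge0_le_integral. Qed.

Lemma leb_le E E' : leb_measurable E -> leb_measurable E' -> E `<=` E' ->
  leb E <= leb E'.
Proof. by move=> mE mE' EE'; apply: le_measure; rewrite ?inE. Qed.

Lemma leb_integralD E f g : leb_measurable E ->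
  leb_measurable_fun E f -> leb_measurable_fun E g ->
  (forall x, E x -> 0 <= f x) -> (forall x, E x -> 0 <= g x) ->
  \int[leb]_(x in E) (f x + g x) =
  \int[leb]_(x in E) f x + \int[leb]_(x in E) g x.
Proof.
move=> mE mf mg f0 g0.
exact: (@ge0_integralD _ (lebesgue_line R) R leb E mE f g f0 mf g0 mg).
Qed.

Lemma leb_integral_cst E (c : \bar R) : leb_measurable E ->
  \int[leb]_(x in E) c = c * leb E.
Proof. by move=> mE; rewrite -(integral_cst leb mE c). Qed.

Lemma leb_integralZl E f (c : R) : leb_measurable E -> leb_measurable_fun E f ->
  (forall x, E x -> 0 <= f x) -> (0 <= c)%R ->
  \int[leb]_(x in E) (c%:E * f x) = c%:E * \int[leb]_(x in E) f x.
Proof.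
move=> mE mf f0 c0.
exact: (@ge0_integralZl_EFin _ (lebesgue_line R) R leb E mE f f0 mf c c0).
Qed.

Lemma leb_ae_eq_integral E f g : leb_measurable E ->
  leb_measurable_fun E f -> leb_measurable_fun E g ->
  {ae leb, forall x, E x -> f x = g x} ->
  \int[leb]_(x in E) f x = \int[leb]_(x in E) g x.
Proof.
by move=> mE mf mg fg; exact: (@ae_eq_integral _ (lebesgue_line R) R leb E g f mE mf mg fg).
Qed.

Lemma leb_subset_integral E E' f : leb_measurable E -> leb_measurable E' ->
  leb_measurable_fun E' f ->
  (forall x, E' x -> 0 <= f x) -> E `<=` E' ->
  \int[leb]_(x in E) f x <= \int[leb]_(x in E') f x.
Proof. by move=> mE mE' mf f0 EE'; exact: ge0_subset_integral. Qed.

Lemma leb_integral_layers E E' u p v q :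
  leb_measurable E -> leb_measurable E' ->
  leb_measurable_fun E u -> leb_measurable_fun E p ->
  leb_measurable_fun E' v -> leb_measurable_fun E' q ->
  (forall x, E x -> 0 <= u x) -> (forall x, E x -> 0 <= p x) ->
  (forall x, E' x -> 0 <= v x) -> (forall x, E' x -> 0 <= q x) ->
  (forall l : R, (0 < l)%R ->
     \int[leb]_(x in E `&` [set x | l%:E < p x]) u x <=
     \int[leb]_(x in E' `&` [set x | l%:E < q x]) v x) ->
  \int[leb]_(x in E) (u x * p x) <= \int[leb]_(x in E') (v x * q x).
Proof. exact: le_integral_layers. Qed.

Lemma integral_level_measure E E' p q :
  leb_measurable E -> leb_measurable E' ->
  leb_measurable_fun E p -> leb_measurable_fun E' q ->
  (forall x, E x -> 0 <= p x) -> (forall x, E' x -> 0 <= q x) ->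
  (forall l : R, (0 < l)%R ->
     leb (E `&` [set x | l%:E < p x]) <= leb (E' `&` [set x | l%:E < q x])) ->
  \int[leb]_(x in E) p x <= \int[leb]_(x in E') q x.
Proof.
move=> mE mE' mp mq p0 q0 H.
under eq_integral do rewrite -[p _]mul1e.
under [leRHS]eq_integral do rewrite -[q _]mul1e.
apply: (@leb_integral_layers E E' (cst 1) p (cst 1) q) => //;
  try exact: (@measurable_cst _ _ (lebesgue_line R)).
move=> l l0; rewrite !integral_cst ?mul1e; first exact: H.
  exact: (@emeasurable_fun_o_infty _ (lebesgue_line R)).
exact: (@emeasurable_fun_o_infty _ (lebesgue_line R)).
Qed.

(** The part of [E] where |f| > l has measure at most the smaller of |E| and [D f l], and this is
    the length of the part of (0, |E|) where f^* > l. *)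
Lemma integral_le_prefix E f : leb_measurable E -> E `<=` I -> meas_fun L f ->
  \int[leb]_(x in E) `|f x| <= \int[leb]_(x in ival (leb E)) f^* x.
Proof.
move=> mE EI mf.
have EL : leb E <= L.
  by rewrite -[leRHS](leb_ival (ltW L0)); apply: le_measure; rewrite ?inE//; exact: measurable_ival.
have mfE := leb_measurable_funS EI (meas_fun_abs mf).
apply: integral_level_measure => //; first exact: measurable_ival.
- exact/meas_funS/meas_rearrangement/EL.
- by move=> x _; exact: rearrangement_ge0.
move=> l l0.
have -> : ival (leb E) `&` [set x | l%:E < f^* x] = ival (mine (leb E) (D f l)).
  rewrite -ivalI; congr (_ `&` _).
  by apply/seteqP; split => t /=; rewrite rearrangement_gt ?(ltW l0).
rewrite leb_ival; last by rewrite le_min !measure_ge0.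
rewrite le_min; apply/andP; split; apply: le_measure; rewrite ?inE//.
- exact: (@emeasurable_fun_o_infty _ (lebesgue_line R)).
- exact: (@emeasurable_fun_o_infty _ (lebesgue_line R)).
- exact: measurable_superlevel_abs.
- by move=> x [Ex ?]; split => //; exact: EI.
Qed.

(** On the layer where |g| > l the claim is [integral_le_prefix], since the corresponding layer of
    g^* is the initial interval of the same measure. *)
Lemma hardy_littlewood f g : meas_fun L f -> meas_fun L g ->
  \int[leb]_(x in I) (`|f x| * `|g x|) <= \int[leb]_(x in I) (f^* x * g^* x).
Proof.
move=> mf mg; apply: leb_integral_layers => //; try exact: measurable_ival.
- exact: meas_fun_abs.
- exact: meas_fun_abs.
- exact: meas_rearrangement.
- exact: meas_rearrangement.
- by move=> x _; exact: rearrangement_ge0.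
- by move=> x _; exact: rearrangement_ge0.
move=> l l0; rewrite superlevel_rearrangement ?(ltW l0)//.
by apply: integral_le_prefix => //; exact: measurable_superlevel_abs.
Qed.

Lemma leb_integral_nondecr_bigcup (F : nat -> set R) u :
  (forall n, leb_measurable (F n)) -> {homo F : n m / (n <= m)%N >-> n `<=` m} ->
  leb_measurable_fun (\bigcup_n F n) u -> (forall x, (\bigcup_n F n) x -> 0 <= u x) ->
  \int[leb]_(x in F n) u x @[n --> \oo] --> \int[leb]_(x in \bigcup_n F n) u x.
Proof.
move=> mF ndF mu u0; apply: ge0_nondecreasing_set_cvg_integral => //.
- by move=> n m nm; apply/subsetPset; exact: ndF.
- move=> n; apply: (@measurable_funS _ _ (lebesgue_line R)) mu.
    by apply: bigcup_measurable => k _; exact: mF.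
  exact: bigcup_sup.
- by move=> n x Fx; apply: u0; exists n.
Qed.

(** Gives countable exhaustions of (0, y) by bounded intervals, uniformly in whether y is finite. *)
Lemma ereal_approx_below (y : \bar R) : -oo < y -> exists b : nat -> R,
  [/\ nondecreasing_seq b, forall n, (b n)%:E < y &
      forall t, t%:E < y -> exists n, (t < b n)%R].
Proof.
case: y => [r| |]// _; last first.
  exists (fun n => n%:R); split => [n m nm|n|t _]; rewrite ?ler_nat ?ltry//.
  by exists (Num.truncn t).+1; exact: truncnS_gt.
exists (fun n => r - n.+1%:R^-1)%R; split => [n m nm|n|t].
- by rewrite lerD2l lerN2 lef_pV2 ?posrE// ler_nat ltnS.
- by rewrite lte_fin gtrDl oppr_lt0 invr_gt0 ltr0n.
rewrite lte_fin => tr; have rt : (0 < r - t)%R by rewrite subr_gt0.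
have [n _ nP] := near_infty_natSinv_lt (PosNum rt).
exists n; rewrite ltrBrDr -ltrBrDl; exact: (nP n (leqnn _)).
Qed.

Lemma prefix_integral_cvg u y (b : nat -> R) : y <= L -> meas_fun L u ->
  (forall x, I x -> 0 <= u x) ->
  nondecreasing_seq b -> (forall n, (b n)%:E < y) ->
  (forall t, t%:E < y -> exists n, (t < b n)%R) ->
  \int[leb]_(x in ival (b n)%:E) u x @[n --> \oo] --> \int[leb]_(x in ival y) u x.
Proof.
move=> yL mu u0 ndb by_ yb.
have IE : ival y = \bigcup_n ival (b n)%:E.
  apply/seteqP; split => x; last by move=> [n _]; apply: ivalS; exact: ltW.
  by move=> [x0 /yb[n xn]]; exists n => //; split => //; rewrite lte_fin.
rewrite IE; apply: leb_integral_nondecr_bigcup => //.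
- by move=> n; exact: measurable_ival.
- by move=> n m nm; apply: ivalS; rewrite lee_fin; exact: ndb.
- by rewrite -IE; exact: meas_funS mu.
- by rewrite -IE => x /(ivalS yL)/u0.
Qed.

Lemma prefix_integral_le u v : meas_fun L u -> meas_fun L v ->
  (forall x, I x -> 0 <= u x) -> (forall x, I x -> 0 <= v x) ->
  (forall a, I a -> \int[leb]_(x in ival a%:E) u x <= \int[leb]_(x in ival a%:E) v x) ->
  forall y, -oo < y -> y <= L -> \int[leb]_(x in ival y) u x <= \int[leb]_(x in ival y) v x.
Proof.
move=> mu mv u0 v0 uv y y0 yL; have [b [ndb by_ yb]] := ereal_approx_below y0.
apply: (lee_cvg_to (prefix_integral_cvg yL mu u0 ndb by_ yb) (prefix_integral_cvg yL mv v0 ndb by_ yb)).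
apply: nearW => n; have [a0|a0] := ltP 0%R (b n).
  by apply: uv; split => //; exact: lt_le_trans (by_ n) yL.
rewrite (_ : ival _ = set0) ?integral_set0// -subset0 => x [x0].
by rewrite lte_fin => xa; have := lt_trans x0 xa; rewrite ltNge a0.
Qed.

(** The set is an initial interval, but it may or may not contain its right endpoint, since [w] is
    not assumed to be continuous from either side. The first alternative includes the empty set and
    all of (0, L). *)
Lemma superlevel_noninc w l : (0 < l)%R ->
  (forall s t, I s -> I t -> (s <= t)%R -> w t <= w s) ->
  exists2 y, 0 <= y <= L &
    (I `&` [set x | l%:E < w x] = ival y \/
     exists a, I a /\ I `&` [set x | l%:E < w x] = ival a%:E `|` [set a]).
Proof.
move=> l0 niw; set A := _ `&` _.
have Adown s t : A t -> (0 < s)%R -> (s <= t)%R -> A s.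
  move=> [It lt] s0 st; have Is : I s.
    by split => //; apply: le_lt_trans (proj2 It); rewrite lee_fin.
  by split => //; apply: lt_le_trans lt _; exact: niw.
pose y := ereal_sup [set maxe 0 t%:E | t in A].
have [A0|/set0P[t0 At0]] := eqVneq A set0.
  exists 0; first by rewrite lexx ltW.
  left; rewrite A0; apply/esym; rewrite -subset0 => x [x0].
  by rewrite lte_fin => xl; have := lt_trans x0 xl; rewrite ltxx.
pose z := ereal_sup [set t%:E | t in A].
have z0 : 0 <= z.
  apply: le_trans (_ : t0%:E <= _); first by rewrite lee_fin ltW//; case: At0 => -[].
  by apply: ereal_sup_ubound; exists t0.
have zL : z <= L by apply: ge_ereal_sup => _ [t [[_ tL] _] <-]; exact: ltW.
have zA : ival z `<=` A.
  move=> x [x0 xz]; have [_ [t At <-] xt] := ereal_sup_gt xz.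
  by apply: Adown At x0 _; rewrite -lee_fin ltW.
exists z; first by rewrite z0.
have [[t [At zt]]|nz] := pselect (exists t, A t /\ z <= t%:E).
  right; exists t; split; first by case: At.
  apply/seteqP; split => [x Ax|x].
    have [->|xt] := eqVneq x t; first by right.
    left; split; first by case: Ax => -[].
    rewrite lte_fin lt_neqAle xt /= -lee_fin; apply: le_trans zt.
    by apply: ereal_sup_ubound; exists x.
  by case=> [[x0 xt]|->//]; apply: Adown At x0 _; rewrite -lee_fin ltW.
left; apply/seteqP; split => // x Ax; split; first by case: Ax => -[].
by rewrite ltNge; apply/negP => zx; apply: nz; exists x.
Qed.

(** Hardy's lemma: up to an endpoint, every layer of the nonincreasing function [w] is an initial
    interval, on which the hypothesis compares the integrals of [u] and [v]. *)
Lemma hardy u v w : meas_fun L u -> meas_fun L v ->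
  (forall x, I x -> 0 <= u x) -> (forall x, I x -> 0 <= v x) ->
  (forall x, I x -> 0 <= w x) ->
  (forall s t, I s -> I t -> (s <= t)%R -> w t <= w s) ->
  (forall a, I a -> \int[leb]_(x in ival a%:E) u x <= \int[leb]_(x in ival a%:E) v x) ->
  \int[leb]_(x in I) (u x * w x) <= \int[leb]_(x in I) (v x * w x).
Proof.
move=> mu mv u0 v0 w0 niw uv; have mw := nonincreasing_meas_fun niw.
apply: leb_integral_layers => //; try exact: measurable_ival.
move=> l l0; have [y /andP[y0 yL] [->|[a [Ia E]]]] := superlevel_noninc l0 niw.
  by apply: prefix_integral_le => //; apply: lt_le_trans y0; rewrite ltNyr.
have aI : ival a%:E `|` [set a] `<=` I.
  by rewrite -E => x [].
have mu' := leb_measurable_funS aI mu; have mv' := leb_measurable_funS aI mv.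
rewrite E !leb_setU1//; first exact: uv.
- exact: measurable_ival.
- by move=> x /aI /v0.
- exact: measurable_ival.
- by move=> x /aI /u0.
Qed.

(** The counterpart of [rearrangement_noninc_le]: the superlevel sets of h are initial intervals up
    to an endpoint, of the same length as those of its rearrangement, so under an integral the jumps
    of h do no harm. *)
Lemma integral_noninc_rearrangement v h : meas_fun L v ->
  (forall x, I x -> 0 <= v x) -> (forall x, I x -> 0 <= h x) ->
  (forall s t, I s -> I t -> (s <= t)%R -> h t <= h s) ->
  \int[leb]_(x in I) (v x * h x) <= \int[leb]_(x in I) (v x * h^* x).
Proof.
move=> mv v0 h0 nih; have mh := nonincreasing_meas_fun nih.
apply: leb_integral_layers => //; try exact: measurable_ival.
- exact: meas_rearrangement.
- by move=> x _; exact: rearrangement_ge0.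
move=> l l0; rewrite superlevel_rearrangement ?(ltW l0)//.
have -> : D h l = leb (I `&` [set x | l%:E < h x]).
  by congr (leb _); apply/seteqP; split => x [Ix]; rewrite /= gee0_abs ?h0.
have [y /andP[y0 yL] [->|[a [Ia E]]]] := superlevel_noninc l0 nih.
  by rewrite leb_ival.
have aI : ival a%:E `|` [set a] `<=` I by rewrite -E => x [].
rewrite E leb_setU1//; last 3 first.
- exact: measurable_ival.
- exact: leb_measurable_funS aI mv.
- by move=> x /aI /v0.
apply: leb_subset_integral => //; try exact: measurable_ival.
- apply: leb_measurable_funS mv; apply: ivalS.
  rewrite -E -[leRHS](leb_ival (ltW L0)); apply: le_measure; rewrite ?inE//; last exact: measurable_ival.
  exact: (@emeasurable_fun_o_infty _ (lebesgue_line R) _ _ _ (measurable_ival L)).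
- move=> x [x0 xL]; apply: v0; split => //; apply: lt_le_trans xL _.
  rewrite -E -[leRHS](leb_ival (ltW L0)); apply: le_measure; rewrite ?inE//; last exact: measurable_ival.
  exact: (@emeasurable_fun_o_infty _ (lebesgue_line R) _ _ _ (measurable_ival L)).
apply: ivalS; rewrite -[leLHS](@leb_ival R); last by rewrite lee_fin ltW//; case: Ia.
apply: le_measure; rewrite ?inE//; first exact: measurable_ival.
apply: (@measurableU _ (lebesgue_line R)); first exact: measurable_ival.
by apply: borel_leb_measurable; exact: measurable_set1.
Qed.

Lemma integral_excess f l : meas_fun L f -> (0 <= l)%R ->
  \int[leb]_(x in I) maxe (`|f x| - l%:E) 0 =
  \int[leb]_(x in I) maxe (f^* x - l%:E) 0.
Proof.
move=> mf l0.
have lev g m : (0 < m)%R -> (forall x, 0 <= g x) ->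
    I `&` [set x | m%:E < maxe (g x - l%:E) 0] = I `&` [set x | (l + m)%:E < `|g x|].
  move=> m0 g0; apply/seteqP; split => x [Ix /=]; rewrite lt_max EFinN gee0_abs//.
    by rewrite lteBrDl// [X in _ || X]ltNge lee_fin (ltW m0)/= orbF => ?.
  by move=> ?; split => //; apply/orP; left; rewrite lteBrDl// -EFinD.
have mm g : meas_fun L g -> meas_fun L (fun x => maxe (g x - l%:E) 0).
  by move=> mg; apply: meas_fun_max; [apply: meas_funD => //; exact: meas_fun_cst|exact: meas_fun_cst].
have e m : (0 < m)%R -> leb (I `&` [set x | m%:E < maxe (`|f x| - l%:E) 0]) =
    leb (I `&` [set x | m%:E < maxe (f^* x - l%:E) 0]).
  move=> m0; rewrite !lev//; last by move=> x; exact: rearrangement_ge0.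
  rewrite -[RHS]/(D f^* (l + m)) distribution_rearrangement//; last by rewrite addr_ge0// ltW.
  by congr (leb _); apply/seteqP; split => x [Ix]; rewrite /= abse_id.
have mp := mm _ (meas_fun_abs mf); have mq := mm _ (meas_rearrangement f).
have pos (h : R -> \bar R) x : I x -> 0 <= maxe (h x) 0 by rewrite le_max lexx orbT.
have mI := @measurable_ival R L.
apply/eqP; rewrite eq_le; apply/andP; split.
- by apply: (integral_level_measure mI mI mp mq (pos _) (pos _)) => m m0; rewrite e.
- by apply: (integral_level_measure mI mI mq mp (pos _) (pos _)) => m m0; rewrite e.
Qed.

(** With [excess_le_prefix] this shows that the integral of f^* over (0, a), when f^*(a) is finite,
    is the minimum over l >= 0 of the integral of the positive part of |f| - l, plus l a, and that
    it is attained at l = f^*(a). In this form the integral is visibly subadditive in f. *)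
Lemma prefix_le_excess f a l : meas_fun L f -> I a -> (0 <= l)%R ->
  \int[leb]_(x in ival a%:E) f^* x <=
  \int[leb]_(x in I) maxe (`|f x| - l%:E) 0 + (l * a)%:E.
Proof.
move=> mf Ia l0; have a0 : (0 < a)%R by case: Ia.
have aL : a%:E <= L by rewrite ltW//; case: Ia.
have mfa : meas_fun L f^* := meas_rearrangement f.
have mm : meas_fun L (fun x => maxe (f^* x - l%:E) 0).
  by apply: meas_fun_max; [apply: meas_funD => //; exact: meas_fun_cst|exact: meas_fun_cst].
rewrite integral_excess//.
apply: (@le_trans _ _ (\int[leb]_(x in ival a%:E) (maxe (f^* x - l%:E) 0 + l%:E))).
  apply: leb_le_integral; first exact: measurable_ival.
  - exact: meas_funS mfa.
  - apply: meas_funD; [exact: meas_funS mm|exact: meas_fun_cst].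
  - by move=> x _; exact: rearrangement_ge0.
  - move=> x _; rewrite -leeBlDr//; by rewrite le_max lexx.
rewrite leb_integralD//; last 4 first.
- exact: measurable_ival.
- exact: meas_funS mm.
- exact: meas_fun_cst.
- by move=> x _; rewrite le_max lexx orbT.
rewrite leeD//.
  apply: leb_subset_integral => //; try exact: measurable_ival.
  - by move=> x _; rewrite le_max lexx orbT.
  - exact: ivalS.
by rewrite leb_integral_cst ?leb_ival ?EFinM// ?lee_fin ?ltW//; exact: measurable_ival.
Qed.

Lemma excess_le_prefix f a l : meas_fun L f -> I a -> f^* a = l%:E ->
  \int[leb]_(x in I) maxe (`|f x| - l%:E) 0 + (l * a)%:E <=
  \int[leb]_(x in ival a%:E) f^* x.
Proof.
move=> mf Ia fal; have a0 : (0 < a)%R by case: Ia.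
have aL : a%:E <= L by rewrite ltW//; case: Ia.
have l0 : (0 <= l)%R by rewrite -lee_fin -fal; exact: rearrangement_ge0.
have mfa : meas_fun L f^* := meas_rearrangement f.
have mm : meas_fun L (fun x => maxe (f^* x - l%:E) 0).
  by apply: meas_fun_max; [apply: meas_funD => //; exact: meas_fun_cst|exact: meas_fun_cst].
rewrite integral_excess//.
rewrite (_ : \int[leb]_(x in I) _ = \int[leb]_(x in ival a%:E) maxe (f^* x - l%:E) 0); last first.
  rewrite [LHS]integral_mkcond [RHS]integral_mkcond; apply: eq_integral => x _.
  rewrite !patchE; case: ifPn => [/set_mem Ix|nIx]; case: ifPn => [/set_mem ax|nax] //.
    apply/max_idPr; rewrite sube_le0 -fal; apply: rearrangement_nonincr.
    rewrite leNgt; apply/negP => xa; move/negP: nax; apply; rewrite inE; split; first by case: Ix.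
    by rewrite lte_fin.
  by case/negP: nIx; rewrite inE; apply: ivalS ax.
rewrite (_ : (l * a)%:E = \int[leb]_(x in ival a%:E) l%:E); last first.
  by rewrite leb_integral_cst ?leb_ival ?EFinM// ?lee_fin ?ltW//; exact: measurable_ival.
rewrite -leb_integralD//; last 4 first.
- exact: measurable_ival.
- exact: meas_funS mm.
- exact: meas_fun_cst.
- by move=> x _; rewrite le_max lexx orbT.
apply: leb_le_integral; first exact: measurable_ival.
- apply: meas_funD; [exact: meas_funS mm|exact: meas_fun_cst].
- exact: meas_funS mfa.
- by move=> x _; rewrite adde_ge0// le_max lexx orbT.
- move=> x [x0 xa].
  have h : 0 <= f^* x - l%:E.
    by rewrite suber_ge0// -fal; apply: rearrangement_nonincr; rewrite -lee_fin ltW.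
  by rewrite (max_idPl h) subeK.
Qed.

Lemma mul_le_prefix h a : (forall t, I t -> 0 <= h t) ->
  (forall s t, I s -> I t -> (s <= t)%R -> h t <= h s) -> I a ->
  a%:E * h a <= \int[leb]_(x in ival a%:E) h x.
Proof.
move=> h0 nih Ia; have [a0 /ltW aL] := Ia.
apply: (@le_trans _ _ (\int[leb]_(x in ival a%:E) h a)).
  rewrite leb_integral_cst; last exact: measurable_ival.
  by rewrite leb_ival ?lee_fin ?(ltW a0)// muleC.
apply: leb_le_integral; first exact: measurable_ival.
- exact: meas_fun_cst.
- exact: meas_funS (nonincreasing_meas_fun nih).
- by move=> x _; exact: h0.
move=> x xa; apply: nih => //; first exact: ivalS xa.
by case: xa => _; rewrite lte_fin => /ltW.
Qed.

Lemma mul_rearrangement_le_prefix f a : I a ->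
  a%:E * f^* a <= \int[leb]_(x in ival a%:E) f^* x.
Proof.
apply: mul_le_prefix => [t _|s t _ _]; first exact: rearrangement_ge0.
exact: rearrangement_nonincr.
Qed.

(** Add the minimal representations of [f] and [g], at the heights l = f^*(a) and m = g^*(a), and
    use the height l + m for the sum: the positive part of |f + g| - l - m is at most the sum of the
    positive parts of |f| - l and |g| - m. *)
Lemma prefix_rearrangementD f g a : meas_fun L f -> meas_fun L g -> I a ->
  \int[leb]_(x in ival a%:E) (f \+ g)^* x <=
  \int[leb]_(x in ival a%:E) f^* x + \int[leb]_(x in ival a%:E) g^* x.
Proof.
move=> mf mg Ia; have a0 : (0 < a)%R by case: Ia.
have ge0 h : 0 <= \int[leb]_(x in ival a%:E) h^* x.
  by apply: integral_ge0 => x _; exact: rearrangement_ge0.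
have fin h : meas_fun L h -> \int[leb]_(x in ival a%:E) h^* x < +oo -> exists2 l, (0 <= l)%R & h^* a = l%:E.
  move=> mh hfin; have h0 := @rearrangement_ge0 R L h a.
  have := mul_rearrangement_le_prefix h Ia; case: (h^* a) h0 => [r| |]// r0.
    by exists r.
  by rewrite mulry gtr0_sg// mul1e leye_eq => /eqP E; rewrite E ltxx in hfin.
have [ff|] := ltP (\int[leb]_(x in ival a%:E) f^* x) +oo; last first.
  by rewrite leye_eq => /eqP ->; rewrite addye ?leey// gt_eqF// (lt_le_trans _ (ge0 g))// ltNyr.
have [gf|] := ltP (\int[leb]_(x in ival a%:E) g^* x) +oo; last first.
  by rewrite leye_eq => /eqP ->; rewrite addey ?leey// gt_eqF// (lt_le_trans _ (ge0 f))// ltNyr.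
have [l l0 fl] := fin f mf ff; have [m m0 gm] := fin g mg gf.
apply: le_trans (leeD (excess_le_prefix mf Ia fl) (excess_le_prefix mg Ia gm)).
apply: le_trans (prefix_le_excess (meas_funD mf mg) Ia (addr_ge0 l0 m0)) _.
rewrite mulrDl EFinD addeACA leeD2r//.
have mm h c : meas_fun L h -> meas_fun L (fun x => maxe (`|h x| - c%:E) 0).
  by move=> mh; apply: meas_fun_max; [apply: meas_funD; [exact: meas_fun_abs|exact: meas_fun_cst]|exact: meas_fun_cst].
have pos (h : R -> \bar R) x : 0 <= maxe (h x) 0 by rewrite le_max lexx orbT.
rewrite -leb_integralD//; try exact: measurable_ival; try exact: mm;
  try by move=> x _; rewrite le_max lexx orbT.
apply: leb_le_integral; first exact: measurable_ival.
- by apply: mm; exact: meas_funD.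
- by apply: meas_funD; exact: mm.
- by move=> x _; rewrite le_max lexx orbT.
- move=> x _; rewrite ge_max; apply/andP; split; last by rewrite adde_ge0// le_max lexx orbT.
  apply: (@le_trans _ _ ((`|f x| - l%:E) + (`|g x| - m%:E))); last by rewrite leeD// le_max lexx.
  by rewrite fin_num_oppeD// addeACA leeD2r// lee_abs_add.
Qed.

End integrals_of_rearrangements.

(** * Resonance *)

Section resonance.
Context {R : realType} {L : \bar R}.
Hypothesis L0 : 0 < L.
Implicit Types (f g h u v w p q : R -> \bar R) (l s t a : R) (E : set R).
Local Notation D := (distribution_fun L).
Local Notation I := (ival L).
Local Notation "f ^*" := (rearrangement L f).

(* Ordering points first by decreasing |u|, then from left to right, the initial
   segments are sets on which |u| is as large as possible; the second key
   splits the plateaus of |u|. *)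
Definition initial_segment u l (y : \bar R) : set R :=
  [set t | I t /\ (l%:E < `|u t| \/ `|u t| = l%:E /\ t%:E < y)].

Lemma measurable_level u l : meas_fun L u -> leb_measurable [set t | I t /\ `|u t| = l%:E].
Proof.
move=> mu; rewrite (_ : [set _ | _] = (I `&` [set t | `|u t| <= l%:E]) `\` [set t | I t /\ `|u t| < l%:E]).
  apply: (@measurableD _ (lebesgue_line R)).
    exact: (@emeasurable_fun_infty_c _ (lebesgue_line R) _ _ _ (@measurable_ival R L) (meas_fun_abs mu)).
  exact: (@emeasurable_fun_infty_o _ (lebesgue_line R) _ _ _ (@measurable_ival R L) (meas_fun_abs mu)).
apply/seteqP; split => t /=.
  by move=> [It ->]; rewrite lexx ltxx; split => // -[].
move=> [[It tl] nt]; split => //; apply/eqP; rewrite eq_le tl /= leNgt; apply/negP => h.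
by apply: nt.
Qed.

Lemma measurable_initial_segment u l y : meas_fun L u ->
  leb_measurable (initial_segment u l y).
Proof.
move=> mu; rewrite (_ : initial_segment u l y = [set t | I t /\ l%:E < `|u t|] `|`
   ([set t | I t /\ `|u t| = l%:E] `&` ival y)).
  apply: (@measurableU _ (lebesgue_line R)); first exact: measurable_superlevel_abs.
  by apply: (@measurableI _ (lebesgue_line R)); [exact: measurable_level|exact: measurable_ival].
apply/seteqP; split => t.
  by move=> [It [?|[? ?]]]; [left|right; split => //; split => //; case: It].
by move=> [[It ?]|[[It ?] [_ ?]]]; split => //; [left|right].
Qed.

(** An intermediate value argument in [y]. At y = 0 the measure is at most s, because u^*(s) = l; it
    is continuous from the left, and it grows by at most e when y grows by e. So the largest
    admissible y gives exactly s, provided that the full plateau reaches measure s. *)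
Lemma initial_segment_measure u s l : meas_fun L u -> D u 0%R < +oo ->
  (0 < s)%R -> u^* s = l%:E -> (0 < l)%R ->
  exists y, leb (initial_segment u l y) = s%:E.
Proof.
move=> mu fin s0 usl l0.
pose G := initial_segment u l; pose F y := leb (G y).
have mG y : leb_measurable (G y) by exact: measurable_initial_segment.
have Gmono y y' : y <= y' -> G y `<=` G y'.
  move=> yy' t [It [?|[? ty]]]; split => //; first by left.
  by right; split => //; exact: lt_le_trans yy'.
have Fmono y y' : y <= y' -> F y <= F y' by move=> /Gmono ?; exact: leb_le.
have F0 : F 0 <= s%:E.
  rewrite (_ : F 0 = D u l); first by rewrite leNgt -rearrangement_gt// ?ltW// usl ltxx.
  congr (leb _); apply/seteqP; split => t; last by move=> [It ?]; split => //; left.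
  move=> [It [?|[_ t0]]]; split => //.
  by move: t0; rewrite lte_fin ltNge (ltW (proj1 It)).
pose z := ereal_sup [set y | F y <= s%:E].
have z0 : 0 <= z by apply: ereal_sup_ubound.
have zNy : -oo < z by apply: lt_le_trans z0; rewrite ltNyr.
have [b [ndb bz zb]] := ereal_approx_below zNy.
have Fz : F z <= s%:E.
  have Gz : G z = \bigcup_n G (b n)%:E.
    apply/seteqP; split => t; last by move=> [n _]; apply: Gmono; exact: ltW.
    move=> [It [?|[? /zb[n tn]]]]; first by exists 0%N => //; split => //; left.
    by exists n => //; split => //; right; split => //; rewrite lte_fin.
  have c : leb (G (b n)%:E) @[n --> \oo] --> F z.
    rewrite /F Gz; apply: nondecreasing_cvg_mu => //.
      by move=> n; exact: mG.
      by apply: bigcup_measurable => n _; exact: mG.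
    by move=> n m nm; apply/subsetPset; apply: Gmono; rewrite lee_fin; exact: ndb.
  apply: (cvg_ereal_le c) => n; have [y Fy ny] := ereal_sup_gt (bz n).
  by apply: le_trans Fy; apply: Fmono; exact: ltW.
exists z; apply/eqP; rewrite eq_le Fz /=; have ub y : F y <= s%:E -> y <= z by move=> ?; exact: ereal_sup_ubound.
case: (z) z0 Fz zNy ub => [x| |]// x0 Fz _ ub.
  apply/lee_addgt0Pr => e e0.
  have : s%:E < F (x + e)%:E.
    rewrite ltNge; apply/negP => h; have := ub _ h.
    by rewrite lee_fin leNgt ltrDl e0.
  move=> /ltW/le_trans; apply.
  have me : leb_measurable `[x, (x + e)%R[%classic by apply: borel_leb_measurable.
  apply: (@le_trans _ _ (leb (G x%:E `|` `[x, (x + e)%R[%classic))).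
    have mU : leb_measurable (G x%:E `|` `[x, (x + e)%R[%classic).
      exact: (@measurableU _ (lebesgue_line R) _ _ (mG _) me).
    apply: (leb_le (mG _) mU).
    move=> t [It [?|[? txe]]]; first by left; split => //; left.
    have [tx|xt] := ltP t x; first by left; split => //; right.
    by right; rewrite /= in_itv/= xt.
  apply: le_trans (measureU2 _ (mG _) me) _ => //; rewrite leeD2l//.
  change (lebesgue_measure `[x, (x + e)%R[%classic <= e%:E).
  by rewrite lebesgue_measure_itv/= lte_fin ltrDl e0 -EFinB addrAC subrr add0r.
(* The case y = +oo, where the whole plateau is included. Each level [m n] lies strictly below l =
   u^*(s), so it is exceeded on a set of measure greater than s. These sets decrease to the set
   where |u| >= l, and their measures are finite. *)
pose m n := (l - l / n.+2%:R)%R.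
have m0 n : (0 < m n < l)%R.
  by rewrite /m subr_gt0 gtrDl oppr_lt0 divr_gt0// andbT ltr_pdivrMr// ltr_pMr// ltr1n.
pose S n := [set t | I t /\ (m n)%:E < `|u t|].
have c : leb (S n) @[n --> \oo] --> leb (\bigcap_n S n).
  apply: nonincreasing_cvg_mu.
  - by apply: le_lt_trans fin; apply: distribution_fun_nonincr => //; rewrite ltW//; case/andP: (m0 0%N).
  - by move=> n; exact: measurable_superlevel_abs.
  - by apply: bigcap_measurable => [|n _]; [exists 0%N|exact: measurable_superlevel_abs].
  - move=> n k nk; apply/subsetPset => t [It ?]; split => //; apply: le_lt_trans (_ : (m k)%:E < _) => //.
    by rewrite lee_fin lerD2l lerN2 ler_wpM2l ?(ltW l0)// lef_pV2 ?posrE// ler_nat.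
apply: (@le_trans _ _ (leb (\bigcap_n S n))).
  rewrite -(cvg_lim _ c)//; apply: lime_ge; first by apply/cvg_ex; eexists; exact: c.
  apply: nearW => n; case/andP: (m0 n) => mn0 mnl; rewrite ltW// -[leb _]/(D u (m n)).
  by rewrite -rearrangement_gt// ?ltW// usl.
apply: le_measure; rewrite ?inE//.
  by apply: bigcap_measurable => [|n _]; [exists 0%N|exact: measurable_superlevel_abs].
  exact: mG.
move=> t St; have [It _] := St 0%N Logic.I; split => //.
have : l%:E <= `|u t|.
  rewrite leNgt; apply/negP => tl.
  have [r rE] : exists r, `|u t| = r%:E.
    by move: tl; case: (u t) => [r _| |]//; exists `|r|%R.
  move: tl; rewrite rE lte_fin => rl.
  have rl0 : (0 < (l - r) / l)%R by rewrite divr_gt0// subr_gt0.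
  have [n _ nP] := near_infty_natSinv_lt (PosNum rl0).
  have [_] := St n Logic.I; rewrite rE lte_fin; apply/negP; rewrite -leNgt /m lerBrDl -lerBrDr.
  rewrite ler_pdivrMr// mulrC -ler_pdivrMr//; last by rewrite subr_gt0.
  have := nP n (leqnn _) => /= h.
  rewrite -[(l / _)%R]invf_div (le_trans (_ : _ <= n.+1%:R)%R) ?ler_nat//.
  by rewrite -[n.+1%:R]invrK lef_pV2 ?posrE ?invr_gt0// ltW.
by rewrite le_eqVlt => /orP[/eqP <-|?]; [right; rewrite ltry|left].
Qed.

(** Put l = u^*(s). A set [G s] that contains all points with |u| > l, lies where |u| >= l, and has
    measure s satisfies: the integral of |u| over it is that of the positive part of |u| - l, plus l
    s, which bounds the integral of u^* over (0, s) by [prefix_le_excess]. If l = 0, the set where u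
    is nonzero serves, and it may be smaller than s. Nestedness is what allows a function to be
    rearranged along these sets. *)
Lemma optimal_sets u : meas_fun L u -> (exists M : R, forall x, I x -> `|u x| <= M%:E) ->
  D u 0%R < +oo ->
  exists G : R -> set R, forall s, (0 < s)%R ->
   [/\ leb_measurable (G s), G s `<=` I, leb (G s) <= s%:E,
       forall s', (s <= s')%R -> G s `<=` G s' &
       I s -> \int[leb]_(x in ival s%:E) u^* x <= \int[leb]_(x in G s) `|u x|].
Proof.
move=> mu [M uM] fin.
have ufin s : (0 < s)%R -> exists2 l, (0 <= l)%R & u^* s = l%:E.
  move=> s0; have : u^* s < +oo.
    apply: (@le_lt_trans _ _ (Num.max M 1)%:E); last by rewrite ltry.
    apply: (rearrangement_le mu); first by rewrite le_max ler01 orbT.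
    rewrite (_ : D u _ = 0) ?lee_fin//.
      exact: ltW.
    rewrite /distribution_fun (_ : [set _ | _] = set0) ?measure0// -subset0 => x [Ix].
    by rewrite ltNge => /negP; apply; rewrite (le_trans (uM _ Ix))// lee_fin le_max lexx.
  have := @rearrangement_ge0 R L u s; case: (u^* s) => [r| |]// r0 _.
  by exists r.
have Gex s : exists G : set R, (0 < s)%R ->
    [/\ leb_measurable G, forall x, G x -> I x /\ u^* s <= `|u x| /\ 0 < `|u x|, leb G <= s%:E,
      forall x, I x -> u^* s < `|u x| -> G x &
      (u^* s = 0 /\ forall x, I x -> 0 < `|u x| -> G x) \/
      exists l y, [/\ (0 < l)%R, u^* s = l%:E, G = initial_segment u l y & leb G = s%:E]].
  have [s0|] := pselect (0 < s)%R; last by exists set0.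
  have [l l0 ul] := ufin s s0.
  move: l0; rewrite le_eqVlt => /orP[/eqP l0|l0].
    rewrite -l0 in ul; exists [set x | I x /\ 0 < `|u x|] => _; rewrite ul; split.
    - exact: measurable_superlevel_abs.
    - by move=> x [Ix ux]; split => //; split => //; exact: ltW.
    - by rewrite leNgt -[leb _]/(D u 0%R) -rearrangement_gt// ul ltxx.
    - by [].
    - by left.
  have [y yE] := initial_segment_measure mu fin s0 ul l0.
  exists (initial_segment u l y) => _; rewrite ul; split.
  - exact: measurable_initial_segment.
  - by move=> x [Ix [lx|[-> _]]]; split => //; split; rewrite ?lexx ?lte_fin// ?(ltW lx)//; apply: lt_trans lx; rewrite lte_fin.
  - by rewrite yE.
  - by move=> x Ix ux; split => //; left.
  - by right; exists l, y.
have [G GP] := choice Gex; exists G => s s0.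
have [mG GI Gs Gu Gd] := GP s s0; split => //.
- by move=> x /GI[].
- move=> s' ss'; have s'0 : (0 < s')%R by exact: lt_le_trans ss'.
  have [mG' GI' Gs' Gu' Gd'] := GP s' s'0.
  move: ss'; rewrite le_eqVlt => /orP[/eqP ->//|ss'].
  case: Gd' => [[_ h] x /GI [Ix [_ ?]]|[l' [y' [l'0 us' GE' Gs'E]]]]; first exact: h.
  have us'l : u^* s' <= u^* s by apply: rearrangement_nonincr; exact: ltW.
  case: Gd => [[us _]|[l [y [l0 us GE GsE]]]].
    by move: us'l; rewrite us us' lee_fin leNgt l'0.
  move: us'l; rewrite us us' lee_fin le_eqVlt => /orP[/eqP ll'|ll']; last first.
    move=> x /GI[Ix [ux _]]; apply: Gu' => //; rewrite us'; apply: lt_le_trans ux.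
    by rewrite us lte_fin.
  have [yy'|y'y] := leP y y'.
    rewrite GE GE' ll' => x [Ix [?|[? xy]]]; split => //; first by left.
    by right; split => //; exact: lt_le_trans yy'.
  (* Both segments lie at the same level and y' < y, so the inclusion goes the wrong way; this
     contradicts the measures s < s'. *)
  have : G s' `<=` G s.
    rewrite GE GE' ll' => x [Ix [?|[? xy]]]; split => //; first by left.
    by right; split => //; exact: lt_trans y'y.
  by move/(leb_le mG' mG); rewrite GsE Gs'E lee_fin leNgt ss'.
move=> Is; have [l l0 ul] := ufin s s0.
apply: le_trans (prefix_le_excess L0 mu Is l0) _.
have GII : G s `<=` I by move=> x /GI[].
have mm : meas_fun L (fun x => maxe (`|u x| - l%:E) 0).
  by apply: meas_fun_max; [apply: meas_funD; [exact: meas_fun_abs|exact: meas_fun_cst]|exact: meas_fun_cst].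
have -> : \int[leb]_(x in I) maxe (`|u x| - l%:E) 0 = \int[leb]_(x in G s) maxe (`|u x| - l%:E) 0.
  rewrite [LHS]integral_mkcond [RHS]integral_mkcond; apply: eq_integral => x _.
  rewrite !patchE; case: ifPn => [/set_mem Ix|nIx]; case: ifPn => [/set_mem ax|nax] //.
    apply/max_idPr; rewrite sube_le0 leNgt; apply/negP => h; move/negP: nax; apply; rewrite inE.
    by apply: Gu => //; rewrite ul.
  by case/negP: nIx; rewrite inE; exact: GII.
have -> : (l * s)%:E = \int[leb]_(x in G s) l%:E.
  rewrite leb_integral_cst//; case: Gd => [[us _]|[l' [y [_ _ _ ->]]]]; last by rewrite EFinM.
  have l00 : l = 0%R by apply: EFin_inj; rewrite -ul.
  by rewrite l00 mul0r mul0e.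
have m1 := leb_measurable_funS GII mm.
have m2 : leb_measurable_fun (G s) (fun=> l%:E) by exact: (@measurable_cst _ _ (lebesgue_line R)).
have p1 x : G s x -> 0 <= maxe (`|u x| - l%:E) 0 by rewrite le_max lexx orbT.
have p2 x : G s x -> 0 <= l%:E by rewrite lee_fin.
rewrite -(leb_integralD mG m1 m2 p1 p2).
apply: leb_le_integral => //.
- apply: leb_measurable_funS (meas_funD mm (meas_fun_cst _)) => //.
- exact: leb_measurable_funS (meas_fun_abs mu).
- by move=> x _; rewrite adde_ge0// ?lee_fin// le_max lexx orbT.
move=> x /GI[_ [ux _]]; have h : 0 <= `|u x| - l%:E by rewrite suber_ge0// -ul.
by rewrite (max_idPl h) subeK.
Qed.

(** The function [h] is g^* transported along the nested sets [G s]. It exceeds l exactly on the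
    union of the [G s] with s < [D g l], a set of measure at most [D g l] on which the integral of
    |u| is at least that of u^* over (0, [D g l]). *)
Lemma resonance_bounded u g (B : \bar R) : meas_fun L u -> meas_fun L g ->
  (exists M : R, forall x, I x -> `|u x| <= M%:E) -> D u 0%R < +oo ->
  (forall h, meas_fun L h -> (forall x, 0 <= h x) ->
    (forall l, (0 < l)%R -> D h l <= D g l) ->
    \int[leb]_(x in I) (`|u x| * h x) <= B) ->
  \int[leb]_(x in I) (u^* x * g^* x) <= B.
Proof.
move=> mu mg bu fin uB; have [G GP] := optimal_sets mu bu fin.
(* The value 0 is adjoined for the points that belong to no [G s]. *)
pose h x := ereal_sup [set y | y = 0 \/ exists s, [/\ (0 < s)%R, G s x & y = g^* s]].
have h0 x : 0 <= h x by apply: ereal_sup_ubound; left.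
have hE l x : (0 <= l)%R -> (l%:E < h x) <-> exists s, [/\ (0 < s)%R, s%:E < D g l & G s x].
  move=> l0; split.
    move=> /ereal_sup_gt[_ [->|[s [s0 Gs ->]]]].
      by rewrite ltNge lee_fin l0.
    by rewrite rearrangement_gt// => ?; exists s.
  move=> [s [s0 sl Gs]]; rewrite -rearrangement_gt// in sl.
  by apply: lt_le_trans sl _; apply: ereal_sup_ubound; right; exists s.
have seg l : (0 <= l)%R -> exists b : nat -> R,
    [/\ forall n, (0 < b n)%R -> (b n)%:E < D g l,
        [set x | I x /\ l%:E < h x] = \bigcup_n (if (0 < b n)%R then G (b n) else set0),
        nondecreasing_seq b &
        (forall n, (b n)%:E < D g l) /\ forall t, t%:E < D g l -> exists n, (t < b n)%R].
  move=> l0; have [b [ndb bD Db]] : exists b : nat -> R,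
    [/\ nondecreasing_seq b, forall n, (b n)%:E < D g l &
      forall t, t%:E < D g l -> exists n, (t < b n)%R].
    by apply: ereal_approx_below; apply: lt_le_trans (measure_ge0 _ _); rewrite ltNyr.
  exists b; split => //.
  apply/seteqP; split => x.
    move=> [Ix /(hE _ _ l0)[s [s0 /Db[n sn] Gsx]]]; exists n => //.
    rewrite (lt_trans s0 sn); have [_ _ _ /(_ (b n) (ltW sn)) + _] := GP s s0; exact.
  move=> [n _]; case: ifPn => // bn0 Gx; have [_ GI _ _ _] := GP _ bn0.
  by split; [exact: GI|apply/(hE _ _ l0); exists (b n)].
pose Gb (b : nat -> R) n := if (0 < b n)%R then G (b n) else set0.
have mGb b n : leb_measurable (Gb b n).
  rewrite /Gb; case: ifPn => [/GP[]//|_]; exact: (@measurable0 _ (lebesgue_line R)).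
have ndGb b : nondecreasing_seq b -> {homo Gb b : n m / (n <= m)%N >-> n `<=` m}.
  move=> ndb n m nm; rewrite /Gb; case: ifPn => [bn0|_ x]//.
  by rewrite (lt_le_trans bn0 (ndb _ _ nm)); have [_ _ _ + _] := GP _ bn0; apply; exact: ndb.
have mhl l : (0 <= l)%R -> leb_measurable [set x | I x /\ l%:E < h x].
  by move=> /seg[b [_ -> _ _]]; apply: bigcup_measurable => n _; exact: mGb.
have mh : meas_fun L h.
  rewrite /meas_fun /leb_measurable_fun.
  apply: (measurability _ (ErealGenOInfty.measurableE R)) => _ [_ [l ->] <-].
  have [l0|l0] := leP 0%R l.
    rewrite (_ : _ `&` _ = [set x | I x /\ l%:E < h x]); first exact: mhl.
    by apply/seteqP; split => x [Ix]; rewrite /= in_itv/= andbT.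
  rewrite (_ : _ `&` _ = I); first exact: measurable_ival.
  apply/seteqP; split => x; first by case.
  by move=> Ix; split => //=; rewrite in_itv/= andbT (lt_le_trans _ (h0 x)).
have Dh l : (0 < l)%R -> D h l <= D g l.
  move=> l0; have [b [bD E ndb _]] := seg l (ltW l0).
  rewrite [D h l](_ : _ = leb (\bigcup_n Gb b n)); last first.
    by rewrite -E; congr (leb _); apply/seteqP; split => x [Ix]; rewrite /= gee0_abs.
  have c : leb (Gb b n) @[n --> \oo] --> leb (\bigcup_n Gb b n).
    apply: nondecreasing_cvg_mu => //.
      by move=> n; exact: mGb.
      by apply: bigcup_measurable => n _; exact: mGb.
    by move=> n m nm; apply/subsetPset; exact: ndGb.
  apply: (cvg_ereal_le c) => n; rewrite /Gb; case: ifPn => [bn0|_]; last by rewrite measure0 measure_ge0.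
  by have [_ _ + _ _] := GP _ bn0; move/le_trans; apply; exact/ltW/bD.
apply: le_trans (uB h mh h0 Dh).
apply: leb_integral_layers => //; try exact: measurable_ival.
- exact: meas_rearrangement.
- exact: meas_rearrangement.
- exact: meas_fun_abs.
- by move=> x _; exact: rearrangement_ge0.
- by move=> x _; exact: rearrangement_ge0.
move=> l l0; rewrite (superlevel_rearrangement L0) ?(ltW l0)//.
have [b [bD E ndb [bl lb]]] := seg l (ltW l0).
have c := prefix_integral_cvg (distribution_fun_le L0 l mg) (meas_rearrangement u)
  (fun x _ => rearrangement_ge0 u x) ndb bl lb.
apply: (cvg_ereal_le c) => n; have [bn0|bn0] := ltP 0%R (b n); last first.
  rewrite (_ : ival _ = set0) ?integral_set0 ?integral_ge0// -subset0 => x [x0].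
  by rewrite lte_fin => xa; have := lt_trans x0 xa; rewrite ltNge bn0.
have [mG GI _ _ Gint] := GP _ bn0.
apply: le_trans (Gint _) _.
  by split => //; apply: lt_le_trans (bl n) _; exact: distribution_fun_le.
apply: leb_subset_integral => //.
- exact: mhl (ltW l0).
- by apply: leb_measurable_funS (meas_fun_abs mu) => x [].
rewrite -[I `&` _]/([set x | I x /\ l%:E < h x]).
by rewrite E => x Gx; exists n => //; rewrite bn0.
Qed.

(** The test functions are those whose distribution function is dominated by that of [g], rather
    than equal to it; they still have norm at most that of |g|, and no set of exactly the right
    measure has to be found. The function [u] is approximated from below by |u| cut at height n and
    restricted to x < n. *)
Lemma resonance u g (B : \bar R) : meas_fun L u -> meas_fun L g ->
  (forall h, meas_fun L h -> (forall x, 0 <= h x) ->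
    (forall l, (0 < l)%R -> D h l <= D g l) ->
    \int[leb]_(x in I) (`|u x| * h x) <= B) ->
  \int[leb]_(x in I) (u^* x * g^* x) <= B.
Proof.
move=> mu mg uB.
pose U (n : nat) (x : R) : \bar R := if (x < n%:R)%R then mine `|u x| n%:R%:E else 0.
have U0 n x : 0 <= U n x by rewrite /U; case: ifP => // _; rewrite le_min abse_ge0 lee_fin/=.
have Uu n x : U n x <= `|u x| by rewrite /U; case: ifP => // _; rewrite ge_min lexx.
have mU n : meas_fun L (U n).
  rewrite (_ : U n = fun x => mine `|u x| n%:R%:E * (\1_([set y : R | (y < n%:R)%R]) x)%:E).
    apply: meas_funM; first by apply: meas_fun_min; [exact: meas_fun_abs|exact: meas_fun_cst].
    have mA : leb_measurable [set y : R | (y < n%:R)%R].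
      rewrite (_ : [set y : R | (y < n%:R)%R] = `]-oo, n%:R[%classic); first exact: borel_leb_measurable.
      by apply/seteqP; split => y; rewrite /= in_itv.
    apply: (@measurable_funTS _ _ (lebesgue_line R)).
    by apply/(@measurable_EFinP _ (lebesgue_line R)); exact: (@measurable_indic _ (lebesgue_line R)).
  apply/funext => x; rewrite /U indicE; case: ifPn => xn.
    by rewrite mem_set// mule1.
  by rewrite memNset ?mule0//= => h; rewrite h in xn.
have ndU x : nondecreasing_seq (U ^~ x).
  move=> n m nm; rewrite /U; case: ifPn => xn; last by case: ifP => // _; rewrite le_min abse_ge0 lee_fin/=.
  rewrite (lt_le_trans xn) ?ler_nat// le_min !ge_min lexx/= lee_fin ler_nat nm orbT//.
have cU l : D (U n) l @[n --> \oo] --> D u l.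
  have -> : D u l = leb (\bigcup_n [set x | I x /\ l%:E < `|U n x|]).
    congr (leb _); apply/seteqP; split => x; last first.
      by move=> [n _ [Ix]]; rewrite gee0_abs// => h; split => //; exact: lt_le_trans (Uu n x).
    move=> [Ix lx].
    have [n ln] : exists n : nat, (maxe l%:E x%:E < n%:R%:E).
      exists (Num.truncn (Num.max l x)).+1; rewrite -EFin_max lte_fin; exact: truncnS_gt.
    exists n => //; split => //; rewrite gee0_abs//; move: ln; rewrite gt_max => /andP[ln].
    by rewrite lte_fin => xn; rewrite /U xn lt_min lx.
  apply: nondecreasing_cvg_mu.
  - by move=> n; exact: measurable_superlevel_abs.
  - by apply: bigcup_measurable => n _; exact: measurable_superlevel_abs.
  - move=> n m nm; apply/subsetPset => x [Ix]; rewrite !gee0_abs// => h; split => //=.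
    by rewrite gee0_abs//; apply: lt_le_trans (ndU x _ _ nm).
have UB n : \int[leb]_(x in I) ((U n)^* x * g^* x) <= B.
  apply: resonance_bounded => //.
  - exists n%:R => x _; rewrite gee0_abs// /U; case: ifP; rewrite ?lee_fin// => _.
    by rewrite ge_min lexx orbT.
  - apply: (@le_lt_trans _ _ (leb (ival n%:R%:E))); last by rewrite leb_ival ?ltry// lee_fin.
    apply: leb_le; [exact: measurable_superlevel_abs|exact: measurable_ival|].
    move=> x [[x0 _]]; rewrite gee0_abs// /U; case: ifP; rewrite ?ltxx// => xn _.
  - move=> h mh h0 Dh; apply: le_trans (uB h mh h0 Dh).
    apply: leb_le_integral; first exact: measurable_ival.
    + by apply: meas_funM => //; exact: meas_fun_abs.
    + by apply: meas_funM => //; exact: meas_fun_abs.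
    + by move=> x _; rewrite mule_ge0.
    + by move=> x _; rewrite lee_wpmul2r// gee0_abs.
have ndD n m l : (n <= m)%N -> D (U n) l <= D (U m) l.
  by move=> nm; apply: le_distribution_fun => // x _; rewrite !gee0_abs//; exact: ndU.
have ndr x : nondecreasing_seq (fun n => (U n)^* x).
  by move=> n m nm; apply: le_rearrangement => l _; exact: ndD.
have cr x : (U n)^* x @[n --> \oo] --> u^* x.
  rewrite (_ : u^* x = ereal_sup (range (fun n => (U n)^* x))).
    by apply: ereal_nondecreasing_cvgn; exact: ndr.
  apply/eqP; rewrite eq_le; apply/andP; split; last first.
    apply: ge_ereal_sup => _ [n _ <-]; apply: le_rearrangement => l _.
    by apply: le_distribution_fun => // y _; rewrite gee0_abs.
  rewrite leNgt; apply/negP => h.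
  have s0 : 0 <= ereal_sup (range (fun n => (U n)^* x)).
    by apply: (@le_trans _ _ ((U 0%N)^* x)); [exact: rearrangement_ge0|apply: ereal_sup_ubound; exists 0%N].
  have [l l0 /andP[sl lu]] := ereal_between_ge0 s0 h.
  have : D u l <= x%:E.
    apply: (cvg_ereal_le (cU l)) => n; rewrite leNgt -rearrangement_gt ?ltW//; apply/negP => /(lt_trans sl).
    by rewrite ltNge => /negP; apply; apply: ereal_sup_ubound; exists n.
  by rewrite leNgt -rearrangement_gt ?ltW// lu.
pose W n x := (U n)^* x * g^* x.
have -> : \int[leb]_(x in I) (u^* x * g^* x) = \int[leb]_(x in I) limn (W ^~ x).
  apply: eq_integral => x _; apply/esym/cvg_lim => //.
  (* Multiplication is discontinuous at 0 times +oo, so the points where a factor vanishes are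
     treated apart. *)
  have [g0|g0] := eqVneq (g^* x) 0.
    by rewrite g0 mule0 (_ : W ^~ x = cst 0); [exact: cvg_cst|apply/funext => n; rewrite /W /= g0 mule0].
  have [u0|u0] := eqVneq (u^* x) 0.
    rewrite u0 mul0e (_ : W ^~ x = cst 0); first exact: cvg_cst.
    apply/funext => n; rewrite /W /= (_ : (U n)^* x = 0) ?mul0e//.
    apply/eqP; rewrite eq_le rearrangement_ge0 andbT -u0; apply: le_rearrangement => l _.
    by apply: le_distribution_fun => // y _; rewrite gee0_abs.
  have md : u^* x *? g^* x by apply: neq0_mule_def; rewrite mule_neq0.
  exact: (cvgeM md (cr x) (cvg_cst _)).
have mW n : meas_fun L (W n) := meas_funM (meas_rearrangement _) (meas_rearrangement _).
have W0 n x : I x -> 0 <= W n x by move=> _; rewrite /W mule_ge0// rearrangement_ge0.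
have ndW x : I x -> {homo W ^~ x : n m / (n <= m)%N >-> n <= m}.
  by move=> _ n m nm; apply: lee_wpmul2r; [exact: rearrangement_ge0|exact: ndr].
rewrite (monotone_convergence leb (@measurable_ival R L) mW W0 ndW).
apply: lime_le; last by apply: nearW => n; exact: UB.
apply: ereal_nondecreasing_is_cvgn => n m nm.
apply: (leb_le_integral (@measurable_ival R L) (mW n) (mW m) (W0 n)) => x Ix.
exact: ndW.
Qed.
End resonance.

(** * The Lorentz-Luxemburg theorem *)

Section lorentz_luxemburg.
Context {R : realType} {L : \bar R} {N : functional R}.
Hypothesis L0 : 0 < L.
Hypothesis N_ri : ri_norm L N.
Implicit Types (f g : R -> \bar R).
Local Notation I := (ival L).

Lemma nneg_of_ge0 f : meas_fun L f -> (forall x, 0 <= f x) -> meas_fun_nneg L f.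
Proof. by move=> mf f0; split => //; apply: aeW. Qed.

Lemma norm0 : N (fun=> 0) = 0.
Proof.
by apply/(rin_eq0 N_ri); [apply: nneg_of_ge0 => //; exact: meas_fun_cst|exact: ae_eq_refl].
Qed.

Lemma norm_le f g : meas_fun L f -> meas_fun L g -> (forall x, 0 <= f x) ->
  (forall x, f x <= g x) -> N f <= N g.
Proof.
move=> mf mg f0 fg; apply: (rin_mono N_ri).
- exact: nneg_of_ge0.
- by apply: nneg_of_ge0 => // x; exact: le_trans (fg x).
- by apply: aeW => x _.
Qed.

Lemma sup_norm_le (f_ : nat -> R -> \bar R) f (K : \bar R) :
  (forall n, meas_fun L (f_ n)) -> meas_fun L f ->
  (forall n x, 0 <= f_ n x) -> (forall x, 0 <= f x) ->
  (forall x, nondecreasing_seq (f_ ^~ x)) -> (forall x, f_ n x @[n --> \oo] --> f x) ->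
  (forall n, N (f_ n) <= K) -> N f <= K.
Proof.
move=> mf_ mf f_0 f0 nd c NK.
have [|_] := rin_fatou N_ri (fun n => nneg_of_ge0 (mf_ n) (f_0 n)) (nneg_of_ge0 mf f0).
  by apply: aeW => x _; split; [exact: nd|exact: c].
by move/cvg_ereal_le; apply.
Qed.

(** Turns bounds in L^2 into bounds in L^1 on a set of finite measure, with a weight that can be
    tuned. *)
Lemma young_half (p q y : R) : (p * q = 1)%R -> (0 <= p)%R ->
  (y <= q / 2 + p / 2 * y ^+ 2)%R.
Proof.
move=> pq p0; have : (0 <= p * (q - y) ^+ 2)%R by rewrite mulr_ge0// sqr_ge0.
have -> : (p * (q - y) ^+ 2 = q * (p * q) - 2 * y * (p * q) + p * y ^+ 2)%R by ring.
rewrite pq; lra.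
Qed.

Lemma sqr_sub_le (x y c : R) : (0 <= x <= c)%R -> (0 <= y <= c)%R ->
  ((x - y) ^+ 2 <= c ^+ 2)%R.
Proof. by move=> ? ?; rewrite -subr_ge0 subr_sqr mulr_ge0//; lra. Qed.

(** [A] and [B] are values of a quadratic functional at the two ends of a step of length t; the
    conclusion is the first-order condition, up to a term in t. *)
Lemma quadratic_step (A B C D F t : R) : (0 < t)%R -> (A <= B)%R ->
  (B + 2 * t * C = A + 2 * t * D + t ^+ 2 * F)%R -> (C <= D + t * (F / 2))%R.
Proof.
move=> t0 AB e; have : (0 <= t * (2 * (D + t * (F / 2) - C)))%R.
  have -> : (t * (2 * (D + t * (F / 2) - C)) = B - A)%R.
    rewrite (_ : B = A + 2 * t * D + t ^+ 2 * F - 2 * t * C)%R; last by rewrite -e; ring.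
    by field.
  by rewrite subr_ge0.
by rewrite pmulr_rge0// => ?; lra.
Qed.

Lemma le_of_small_steps (B C V : R) : (0 <= V)%R ->
  (forall t, (0 < t <= 1)%R -> (B <= C + t * V)%R) -> (B <= C)%R.
Proof.
move=> V0 key; apply/ler_addgt0Pr => e e0.
have c0 : (0 < V + 1 + e)%R by lra.
have t1 : (0 < e / (V + 1 + e) <= 1)%R.
  by rewrite divr_gt0//= ler_pdivrMr// mul1r; lra.
apply: le_trans (key _ t1) _; rewrite lerD2l mulrAC ler_pdivrMr// ler_pM2l//.
by lra.
Qed.

(** * Projection in L^2 onto a ball of the norm *)

Section projection.
Variables (r : R -> R) (M a K : R).
Hypothesis a0 : (0 < a)%R.
Hypothesis aL : a%:E <= L.
Hypothesis mr : leb_measurable_fun I r.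
Hypothesis r0 : forall x, (0 <= r x)%R.
Hypothesis rM : forall x, (r x <= M)%R.
Hypothesis r_out : forall x, ~ ival a%:E x -> r x = 0%R.
Hypothesis K0 : (0 <= K)%R.

Local Notation E := (ival a%:E).
Local Notation IE u := (\int[leb]_(x in E) (u x)%:E).

Let mE : leb_measurable E := @measurable_ival R a%:E.
Let EI : E `<=` I := ivalS aL.
Let M0 : (0 <= M)%R := le_trans (r0 0%R) (rM 0%R).

Let mes (u : R -> R) := leb_measurable_fun I u.

Let mesE u : mes u -> leb_measurable_fun E (EFin \o u).
Proof.
move=> mu; apply/(@measurable_EFinP _ (lebesgue_line R)).
exact: (@measurable_funS _ _ (lebesgue_line R) _ _ _ _ (@measurable_ival R L) EI mu).
Qed.

Let mesI u : mes u -> meas_fun L (EFin \o u).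
Proof. by move=> mu; apply/(@measurable_EFinP _ (lebesgue_line R)). Qed.

Let mesD u v : mes u -> mes v -> mes (fun x => u x + v x)%R.
Proof. exact: (@measurable_funD _ (lebesgue_line R)). Qed.
Let mesB u v : mes u -> mes v -> mes (fun x => u x - v x)%R.
Proof. exact: (@measurable_funB _ (lebesgue_line R)). Qed.
Let mesM u v : mes u -> mes v -> mes (fun x => u x * v x)%R.
Proof. exact: (@measurable_funM _ (lebesgue_line R)). Qed.
Let mesX u : mes u -> mes (fun x => u x ^+ 2)%R.
Proof. by move=> mu; apply: mesM. Qed.
Let mesc c : mes (fun=> c).
Proof. exact: (@measurable_cst _ _ (lebesgue_line R)). Qed.
Let mes_min u v : mes u -> mes v -> mes (fun x => Num.min (u x) (v x)).
Proof. exact: (@measurable_minr _ (lebesgue_line R)). Qed.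

Let IE_D u v : mes u -> mes v -> (forall x, (0 <= u x)%R) -> (forall x, (0 <= v x)%R) ->
  IE (fun x => u x + v x)%R = IE u + IE v.
Proof.
move=> mu mv u0 v0; under eq_integral do rewrite EFinD.
by apply: leb_integralD => //; try exact: mesE; move=> x _; rewrite lee_fin.
Qed.

Let IE_Z c u : mes u -> (0 <= c)%R -> (forall x, (0 <= u x)%R) ->
  IE (fun x => c * u x)%R = c%:E * IE u.
Proof.
move=> mu c0 u0; under eq_integral do rewrite EFinM.
have u0E x : E x -> 0 <= (EFin \o u) x by rewrite lee_fin.
exact: (@ge0_integralZl_EFin _ (lebesgue_line R) R leb E mE (EFin \o u) u0E (mesE mu) c c0).
Qed.

Let IE_le u v : mes u -> mes v -> (forall x, (0 <= u x)%R) ->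
  (forall x, E x -> (u x <= v x)%R) -> IE u <= IE v.
Proof.
move=> mu mv u0 uv; apply: (leb_le_integral mE (mesE mu) (mesE mv)) => x Ex.
  by rewrite lee_fin.
by rewrite lee_fin; exact: uv.
Qed.

Let IE_ge0 u : (forall x, (0 <= u x)%R) -> 0 <= IE u.
Proof. by move=> u0; apply: integral_ge0 => x _; rewrite lee_fin. Qed.

Let IE_bound u c : mes u -> (forall x, (0 <= u x)%R) ->
  (forall x, E x -> (u x <= c)%R) -> IE u <= (c * a)%:E.
Proof.
move=> mu u0 uc; apply: (@le_trans _ _ (IE (fun=> c))); first exact: IE_le.
by rewrite leb_integral_cst// leb_ival ?EFinM// lee_fin ltW.
Qed.

Let IE_fin u c : mes u -> (forall x, (0 <= u x)%R) ->
  (forall x, E x -> (u x <= c)%R) -> IE u \is a fin_num.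
Proof.
move=> mu u0 uc; rewrite ge0_fin_numE ?IE_ge0//.
by apply: le_lt_trans (IE_bound mu u0 uc) _; rewrite ltry.
Qed.

(** The convex set onto which [r] is projected. The bound w <= r keeps all integrals finite and
    costs nothing, since replacing w by its minimum with r lowers both the norm and the distance to
    r. *)
Let adm (w : R -> R) := [/\ mes w, forall x, (0 <= w x)%R, forall x, (w x <= r x)%R &
  N (EFin \o w) <= K%:E].

Let J (w : R -> R) := IE (fun x => (r x - w x) ^+ 2)%R.

Let J0 w : 0 <= J w.
Proof. by apply: IE_ge0 => x; exact: sqr_ge0. Qed.

Let adm0 : adm (fun=> 0%R).
Proof. by split => //; rewrite (_ : _ \o _ = fun=> 0)// norm0 lee_fin. Qed.

Let adm_le w v : adm w -> mes v -> (forall x, (0 <= v x)%R) -> (forall x, (v x <= w x)%R) -> adm v.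
Proof.
move=> [mw w0 wr Nw] mv v0 vw; split => // [x|]; first exact: le_trans (wr x).
by apply: le_trans Nw; apply: norm_le; [exact: mesI|exact: mesI|..] => x; rewrite lee_fin.
Qed.

Let norm_comb u v (s t : R) : mes u -> mes v -> (forall x, (0 <= u x)%R) ->
  (forall x, (0 <= v x)%R) -> N (EFin \o u) <= K%:E -> N (EFin \o v) <= K%:E ->
  (0 <= s)%R -> (0 <= t)%R -> (s + t = 1)%R ->
  N (EFin \o (fun x => s * u x + t * v x)%R) <= K%:E.
Proof.
move=> mu mv u0 v0 Nu Nv s0 t0 st.
have nu : meas_fun_nneg L (EFin \o u) by apply: nneg_of_ge0; [exact: mesI|move=> x; rewrite lee_fin].
have nv : meas_fun_nneg L (EFin \o v) by apply: nneg_of_ge0; [exact: mesI|move=> x; rewrite lee_fin].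
have nsu : meas_fun_nneg L (fun x => s%:E * (EFin \o u) x).
  by apply: nneg_of_ge0; [apply: meas_funM; [exact: meas_fun_cst|exact: mesI]|move=> x; rewrite mule_ge0// lee_fin].
have ntv : meas_fun_nneg L (fun x => t%:E * (EFin \o v) x).
  by apply: nneg_of_ge0; [apply: meas_funM; [exact: meas_fun_cst|exact: mesI]|move=> x; rewrite mule_ge0// lee_fin].
apply: le_trans (rin_triangle N_ri nsu ntv) _.
rewrite !(rinZ N_ri)//; apply: (@le_trans _ _ (s%:E * K%:E + t%:E * K%:E)).
  by rewrite leeD// lee_wpmul2l// lee_fin.
by rewrite -!EFinM -EFinD -mulrDl st mul1r.
Qed.

Let d := ereal_inf [set J w | w in adm].

Let d0 : 0 <= d.
Proof. by apply: le_ereal_inf_tmp => _ [w _ <-]. Qed.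

Let dJ w : adm w -> d <= J w.
Proof. by move=> aw; apply: ereal_inf_lbound; exists w. Qed.

Let sq_bound w x : (0 <= w x)%R -> (w x <= r x)%R -> ((r x - w x) ^+ 2 <= M ^+ 2)%R.
Proof.
move=> w0 wr; rewrite lerXn2r ?nnegrE ?subr_ge0//.
by rewrite (le_trans _ (rM x))// gerBl.
Qed.

Let J_fin w : adm w -> J w \is a fin_num.
Proof.
move=> [mw w0 wr Nw]; apply: (@IE_fin _ (M ^+ 2)%R).
- by apply: mesX; exact: mesB.
- by move=> x; exact: sqr_ge0.
- by move=> x _; exact: sq_bound.
Qed.

Let d_fin : d \is a fin_num.
Proof.
rewrite ge0_fin_numE//; apply: le_lt_trans (dJ adm0) _.
by rewrite -ge0_fin_numE//; exact: J_fin.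
Qed.

(* The set of admissible functions is convex, so the parallelogram law makes
   every minimizing sequence of J Cauchy in L^2. *)
Let close u v (e : R) : adm u -> adm v -> J u <= d + e%:E -> J v <= d + e%:E ->
  IE (fun x => (u x - v x) ^+ 2)%R <= (4 * e)%:E.
Proof.
move=> au av Ju Jv; have [mu u0 ur Nu] := au; have [mv v0 vr Nv] := av.
pose m x := (2^-1 * u x + 2^-1 * v x)%R.
have mm : mes m by apply: mesD; apply: mesM.
have am : adm m.
  split => //.
  - by move=> x; rewrite addr_ge0// mulr_ge0.
  - by move=> x; rewrite /m; have := ur x; have := vr x; lra.
  - by apply: norm_comb => //; lra.
have mB w : mes w -> mes (fun x => (r x - w x) ^+ 2)%R by move=> mw; apply: mesX; exact: mesB.
have muv : mes (fun x => (u x - v x) ^+ 2)%R by apply: mesX; exact: mesB.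
have sq (p : R -> R) x : (0 <= p x ^+ 2)%R by exact: sqr_ge0.
have c0 (c : nat) (p : R -> R) x : (0 <= c%:R^-1 * p x ^+ 2)%R by rewrite mulr_ge0// sqr_ge0.
have e1 : IE (fun x => 4^-1 * (u x - v x) ^+ 2)%R + J m =
          2^-1%:E * J u + 2^-1%:E * J v.
  have i4 : (0 <= 4^-1 :> R)%R by [].
  have i2 : (0 <= 2^-1 :> R)%R by [].
  rewrite -(IE_Z (mB _ mu) i2 (sq _)) -(IE_Z (mB _ mv) i2 (sq _)).
  rewrite -(IE_D (mesM (mesc _) muv) (mB _ mm) (c0 4%N _) (sq _)).
  rewrite -(IE_D (mesM (mesc _) (mB _ mu)) (mesM (mesc _) (mB _ mv)) (c0 2%N _) (c0 2%N _)).
  by apply: eq_integral => x _; congr (_%:E); rewrite /m; field.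
have Ifin : IE (fun x => (u x - v x) ^+ 2)%R \is a fin_num.
  apply: (@IE_fin _ (M ^+ 2)%R muv) => [x|x _]; first exact: sqr_ge0.
  have := u0 x; have := v0 x; have := ur x; have := vr x; have := rM x.
  by move=> *; rewrite -subr_ge0 subr_sqr mulr_ge0//; lra.
have i4 : (0 <= 4^-1 :> R)%R by [].
move: e1; rewrite (IE_Z muv i4 (sq _)).
have := dJ am; move: Ju Jv; rewrite -(fineK Ifin) -(fineK d_fin) -(fineK (J_fin au)) -(fineK (J_fin av)) -(fineK (J_fin am)).
by rewrite -!EFinM -!EFinD !lee_fin => ? ? ? [?]; lra.
Qed.

(** The Fatou property concerns increasing sequences, so a minimizing sequence is replaced by the
    infima of its tails. These are farther from r; telescoping the squares along the sequence bounds
    the loss by consecutive differences, each with factor 2 M because all values lie between 0 and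
    M. *)
Let tail_bound (w : nat -> R -> R) : (forall n x, (0 <= w n x <= r x)%R) ->
  forall n x, ((r x - infs (w ^~ x) n) ^+ 2)%:E <= ((r x - w n x) ^+ 2)%:E +
    \sum_(i <oo) (2 * M * `|w (n + i)%N x - w (n + i).+1 x|)%:E.
Proof.
move=> wr n x; set S := \sum_(i <oo) _.
have t0 i : 0 <= (2 * M * `|w (n + i)%N x - w (n + i).+1 x|)%:E.
  by rewrite lee_fin !mulr_ge0.
have S0 : 0 <= S by apply: nneseries_ge0 => i _ _; exact: t0.
have lb : has_lbound (sdrop (w ^~ x) n) by exists 0%R => _ [k _ <-]; case/andP: (wr k x).
have step k : ((r x - w (n + k)%N x) ^+ 2)%:E <= ((r x - w n x) ^+ 2)%:E +
    \sum_(0 <= i < k) (2 * M * `|w (n + i)%N x - w (n + i).+1 x|)%:E.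
  elim: k => [|k IH]; first by rewrite addn0 big_geq// adde0.
  rewrite big_nat_recr//= addeA; apply: le_trans (leeD2r _ IH).
  rewrite -EFinD lee_fin addnS.
  have [p0 pr] := andP (wr (n + k)%N x); have [q0 qr] := andP (wr (n + k).+1 x).
  set p := w (n + k)%N x in p0 pr *; set q := w (n + k).+1 x in q0 qr *.
  have h : ((p - q) * (2 * r x - p - q) <= `|p - q| * (2 * M))%R.
    apply: le_trans (ler_norm _) _; rewrite normrM ler_wpM2l// ger0_norm; last by lra.
    by have := rM x; lra.
  rewrite -subr_ge0; apply: le_trans (_ : 0 <= `|p - q| * (2 * M) - (p - q) * (2 * r x - p - q))%R _.
    by rewrite subr_ge0.
  by rewrite le_eqVlt; apply/orP; left; apply/eqP; ring.
have partial k : \sum_(0 <= i < k) (2 * M * `|w (n + i)%N x - w (n + i).+1 x|)%:E <= S.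
  by apply: nneseries_lim_ge => i _ _; exact: t0.
have [Sy|] := ltP S +oo; last by rewrite leye_eq => /eqP ->; rewrite addey// leey.
have Sf : S \is a fin_num by rewrite ge0_fin_numE.
have sE : S = (fine S)%:E by rewrite fineK.
have s0 : (0 <= fine S)%R by rewrite fine_ge0.
pose b := ((r x - w n x) ^+ 2 + fine S)%R.
have b0 : (0 <= b)%R by rewrite addr_ge0// sqr_ge0.
rewrite sE -EFinD lee_fin -/b.
have rw k : (n <= k)%N -> (r x - Num.sqrt b <= w k x)%R.
  move=> nk; rewrite lerBlDl -lerBlDr -(@ger0_norm _ (r x - w k x)%R); last first.
    by rewrite subr_ge0; case/andP: (wr k x).
  rewrite -sqrtr_sqr ler_wsqrtr// -lee_fin EFinD -sE.
  by rewrite -(subnKC nk); apply: le_trans (step _) _; rewrite leeD2l.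
have ql : (r x - Num.sqrt b <= infs (w ^~ x) n)%R.
  apply: lb_le_inf; first by exists (w n x); exists n => /=.
  by move=> _ [k nk <-]; exact: rw.
have qr : (infs (w ^~ x) n <= r x)%R.
  by apply: (@le_trans _ _ (w n x)); [apply: ge_inf => //; exists n => /=|case/andP: (wr n x)].
rewrite -[leRHS]sqr_sqrtr// lerXn2r ?nnegrE ?subr_ge0 ?sqrtr_ge0//.
by rewrite lerBlDr -lerBlDl.
Qed.

(** Take a minimizing sequence with errors 8^-n. Consecutive terms are then summably close in L^1,
    so by [tail_bound] the infima of the tails still minimize in the limit. They increase to an
    admissible function by the Fatou property. *)
Let minimizer : exists2 q, adm q & J q <= d.
Proof.
have seq n : exists w, adm w /\ J w <= d + (8^-1 ^+ n)%:E.
  have e0 : (0 < 8^-1 ^+ n :> R)%R by rewrite exprn_gt0.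
  by have [_ [w aw <-] Jw] := lb_ereal_inf_adherent e0 d_fin; exists w; split => //; exact: ltW.
have [w wP] := choice seq.
have aw n : adm (w n) by case: (wP n).
have Jw n : J (w n) <= d + (8^-1 ^+ n)%:E by case: (wP n).
have mw n : mes (w n) by case: (aw n).
have wr n x : (0 <= w n x <= r x)%R by case: (aw n) => _ -> ->.
pose de (n : nat) (x : R) : R := `|w n x - w n.+1 x|%R.
have mde n : mes (de n).
  by apply: (@measurableT_comp _ _ _ (lebesgue_line R) _ _ (@Num.norm _ R)); [exact: normr_measurable|exact: mesB].
have de0 n x : (0 <= de n x)%R by exact: normr_ge0.
have M2 : (0 <= 2 * M)%R by rewrite mulr_ge0.
have Ide n : IE (de n) <= ((a / 2 + 2) * 2^-1 ^+ n)%:E.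
  have cl : IE (fun x => (w n x - w n.+1 x) ^+ 2)%R <= (4 * 8^-1 ^+ n)%:E.
    apply: close => //; apply: le_trans (Jw n.+1) _; rewrite leeD2l// lee_fin.
    by rewrite exprSr ler_piMr ?exprn_ge0 ?invr_ge0// invf_le1// ler1n.
  have m2 : mes (fun x => (w n x - w n.+1 x) ^+ 2)%R by apply: mesX; exact: mesB.
  have p2 (x : R) : (0 <= (w n x - w n.+1 x) ^+ 2)%R by exact: sqr_ge0.
  have cn0 : (0 <= 2 ^+ n / 2 :> R)%R by rewrite divr_ge0// exprn_ge0.
  have q2 (x : R) : (0 <= 2 ^+ n / 2 * (w n x - w n.+1 x) ^+ 2)%R by rewrite mulr_ge0.
  have k2 (x : R) : (0 <= 2^-1 ^+ n / 2 :> R)%R by rewrite divr_ge0// exprn_ge0.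
  (* Young's inequality with weight 2^n: the constant term contributes a/2 times 2^-n, and the
     square, of integral at most 4 times 8^-n, contributes 2 times 4^-n. *)
  apply: (@le_trans _ _ (IE (fun x => 2^-1 ^+ n / 2 + 2 ^+ n / 2 * (w n x - w n.+1 x) ^+ 2)%R)).
    apply: IE_le => //; first by apply: mesD => //; exact: mesM.
    move=> x _; rewrite /de -[((w n x - _) ^+ 2)%R](real_normK (num_real _)); set y := `|_|%R.
    apply: young_half; last exact: exprn_ge0.
    by rewrite -exprMn divff// expr1n.
  rewrite (IE_D (mesc _) (mesM (mesc _) m2) k2 q2) (IE_Z m2 cn0 p2).
  rewrite leb_integral_cst// leb_ival ?lee_fin ?(ltW a0)//.
  apply: (@le_trans _ _ ((2^-1 ^+ n / 2)%:E * a%:E + (2 ^+ n / 2)%:E * (4 * 8^-1 ^+ n)%:E)).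
    by rewrite leeD2l// lee_wpmul2l// lee_fin.
  rewrite -!EFinM -EFinD lee_fin.
  have -> : (8^-1 ^+ n = 2^-1 ^+ n * 2^-1 ^+ n * 2^-1 ^+ n :> R)%R.
    by rewrite -!exprMn; congr (_ ^+ n)%R; field.
  have E1 : (2 ^+ n * 2^-1 ^+ n = 1 :> R)%R by rewrite -exprMn divff// expr1n.
  set y := (2^-1 ^+ n)%R in E1 *.
  have y0 : (0 <= y)%R by rewrite exprn_ge0.
  have y1 : (y <= 1)%R by rewrite exprn_ile1// invf_le1// ler1n.
  have -> : (2 ^+ n / 2 * (4 * (y * y * y)) = 2 * (y * y) * (2 ^+ n * y) :> R)%R by field.
  rewrite E1 mulr1.
  have : (y * y <= y)%R by rewrite ler_piMl.
  clear k2; lra.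
(* The 1 covers the error 8^-n; the rest is 2 M times the sum of the bounds [Ide], a geometric
   series whose sum contributes the last factor 2. *)
pose c := (1 + 2 * M * (a / 2 + 2) * 2)%R.
have c0 : (0 < c)%R by rewrite ltr_wpDr// !mulr_ge0// addr_ge0// divr_ge0// ltW.
have lbw x n : has_lbound (sdrop (w ^~ x) n) by exists 0%R => _ [k _ <-]; case/andP: (wr k x).
have lbw' x : has_lbound (range (w ^~ x)) by exists 0%R => _ [k _ <-]; case/andP: (wr k x).
pose q_ n x := infs (w ^~ x) n.
have mq_ n : mes (q_ n) by apply: (@measurable_fun_infs _ (lebesgue_line R)) => // t _.
have q_0 n x : (0 <= q_ n x)%R.
  apply: lb_le_inf; first by exists (w n x); exists n => /=.
  by move=> _ [k _ <-]; case/andP: (wr k x).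
have q_w n x : (q_ n x <= w n x)%R by apply: ge_inf => //; exists n => /=.
have q_r n x : (q_ n x <= r x)%R by apply: le_trans (q_w n x) _; case/andP: (wr n x).
have aq_ n : adm (q_ n) by apply: adm_le (aw n) _ _ _.
have ndq x : nondecreasing_seq (q_ ^~ x).
  move=> n m nm; apply: lb_le_inf; first by exists (w m x); exists m => /=.
  by move=> _ [k mk <-]; apply: ge_inf => //; exists k => //=; exact: leq_trans mk.
have Jq n : J (q_ n) <= d + (c * 2^-1 ^+ n)%:E.
  have mtail i : mes (fun x => 2 * M * `|w (n + i)%N x - w (n + i).+1 x|)%R.
    by apply: mesM => //; exact: mde.
  have t0 i x : (0 <= 2 * M * `|w (n + i)%N x - w (n + i).+1 x|)%R by rewrite !mulr_ge0.
  have mser : leb_measurable_fun E (fun x => \sum_(i <oo) (2 * M * `|w (n + i)%N x - w (n + i).+1 x|)%:E).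
    apply: (@ge0_emeasurable_sum _ (lebesgue_line R)).
      by move=> i x _ _; rewrite lee_fin.
    by move=> i _; exact: mesE.
  have mJ v : mes v -> leb_measurable_fun E (fun x => ((r x - v x) ^+ 2)%:E).
    by move=> mv; apply: (mesE (u := fun x => (r x - v x) ^+ 2)%R); apply: mesX; exact: mesB.
  have s0 x : 0 <= \sum_(i <oo) (2 * M * `|w (n + i)%N x - w (n + i).+1 x|)%:E.
    by apply: nneseries_ge0 => i _ _; rewrite lee_fin.
  apply: (@le_trans _ _ (\int[leb]_(x in E) (((r x - w n x) ^+ 2)%:E +
      \sum_(i <oo) (2 * M * `|w (n + i)%N x - w (n + i).+1 x|)%:E))).
    apply: (leb_le_integral mE (mJ _ (mq_ n))).
    - exact: (@emeasurable_funD _ (lebesgue_line R) R _ _ _ (mJ _ (mw n)) mser).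
    - by move=> x _; rewrite lee_fin sqr_ge0.
    - by move=> x _; exact: tail_bound.
  rewrite (leb_integralD mE (mJ _ (mw n)) mser); last 2 first.
  - by move=> x _; rewrite lee_fin sqr_ge0.
  - by move=> x _.
  rewrite -/(J (w n)) (@integral_nneseries _ (lebesgue_line R) R leb E mE
    (fun i x => (2 * M * `|w (n + i)%N x - w (n + i).+1 x|)%:E)); last 2 first.
  - by move=> i; exact: mesE.
  - by move=> i x _; rewrite lee_fin.
  have sum_le : \sum_(i <oo) IE (fun x => 2 * M * `|w (n + i)%N x - w (n + i).+1 x|)%R <=
      (2 * M * (a / 2 + 2) * 2 * 2^-1 ^+ n)%:E.
    apply: lime_le.
      by apply: is_cvg_nneseries => i _ _; exact: IE_ge0.
    apply: nearW => k.
    apply: (@le_trans _ _ (\sum_(0 <= i < k) (2 * M * ((a / 2 + 2) * 2^-1 ^+ (n + i)))%:E)).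
      apply: lee_sum => i _; rewrite (IE_Z (mde (n + i)%N) M2 (de0 _)) [leRHS]EFinM.
      by apply: lee_wpmul2l; [rewrite lee_fin|exact: Ide].
    rewrite sumEFin lee_fin.
    have -> : (\sum_(0 <= i < k) 2 * M * ((a / 2 + 2) * 2^-1 ^+ (n + i)) =
       2 * M * (a / 2 + 2) * 2^-1 ^+ n * \sum_(0 <= i < k) 2^-1 ^+ i :> R)%R.
      by rewrite big_distrr/=; apply: eq_bigr => i _; rewrite exprD; ring.
    have geo : (\sum_(0 <= i < k) 2^-1 ^+ i <= 2 :> R)%R.
      suff -> : (\sum_(0 <= i < k) 2^-1 ^+ i = 2 - 2 * 2^-1 ^+ k :> R)%R.
        by rewrite gerBl mulr_ge0// exprn_ge0.
      elim: k => [|k IH]; first by rewrite big_geq// expr0; ring.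
      by rewrite big_nat_recr//= IH exprSr; field.
    rewrite [leRHS](_ : _ = 2 * M * (a / 2 + 2) * 2^-1 ^+ n * 2)%R; last by ring.
    by rewrite ler_wpM2l// !mulr_ge0// ?exprn_ge0// addr_ge0// divr_ge0// ltW.
  apply: le_trans (leeD (Jw n) sum_le) _; rewrite -addeA leeD2l// -EFinD lee_fin.
  rewrite /c [leRHS]mulrDl mul1r lerD2r.
  by rewrite lerXn2r ?nnegrE ?invr_ge0// lef_pV2 ?posrE// ler_nat.
pose q x := sup (range (q_ ^~ x)).
have ubq x : has_ubound (range (q_ ^~ x)) by exists (r x) => _ [k _ <-].
have cq x : q_ n x @[n --> \oo] --> q x by apply: nondecreasing_cvgn => //; exact: ndq.
have q_q n x : (q_ n x <= q x)%R by apply: ub_le_sup => //; exists n.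
have qr x : (q x <= r x)%R by apply: ge_sup; [exists (q_ 0%N x); exists 0%N|move=> _ [k _ <-]].
have mq : mes q.
  by apply: (@measurable_fun_cvg _ (lebesgue_line R) _ _ q_) => // x _; exact: cq.
have q0 x : (0 <= q x)%R by apply: le_trans (q_q 0%N x).
have aq : adm q.
  split => //; apply: (@sup_norm_le (fun n => EFin \o q_ n)).
  - by move=> n; exact: mesI.
  - exact: mesI.
  - by move=> n x; rewrite lee_fin.
  - by move=> x; rewrite lee_fin.
  - by move=> x n m nm; rewrite lee_fin; exact: ndq.
  - by move=> x; apply: cvg_EFin; [exact: nearW|exact: cq].
  - by move=> n; case: (aq_ n).
exists q => //; apply/lee_addgt0Pr => e e0.
pose n := (Num.truncn (c / e)).+1.
have cn : (c * 2^-1 ^+ n <= e)%R.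
  rewrite exprVn ler_pdivrMr ?exprn_gt0// -ler_pdivrMl// mulrC.
  apply: le_trans (ltW (truncnS_gt _)) _; rewrite -natrX ler_nat ltnW//.
  exact: ltn_expl.
apply: (@le_trans _ _ (d + (c * 2^-1 ^+ n)%:E)); last by rewrite leeD2l// lee_fin.
apply: le_trans (Jq n); apply: IE_le.
- by apply: mesX; exact: mesB.
- by apply: mesX; exact: mesB.
- by move=> x; exact: sqr_ge0.
- by move=> x _; rewrite lerXn2r ?nnegrE ?subr_ge0// lerD2l lerN2.
Qed.

(** The first-order condition at the minimizer [q], obtained by moving from [q] towards [w] by a
    small t. It says that r - q, as a functional on the ball, is maximal at [q]. *)
Let variation q w m : adm q -> J q <= d -> mes w -> (forall x, (0 <= w x <= m)%R) ->
  N (EFin \o w) <= K%:E ->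
  IE (fun x => (r x - q x) * w x)%R <= IE (fun x => (r x - q x) * q x)%R.
Proof.
move=> aq Jq mw wm Nw; have [mq q0 qr Nq] := aq.
have w0 x : (0 <= w x)%R by case/andP: (wm x).
have w_m x : (w x <= m)%R by case/andP: (wm x).
have m0 : (0 <= m)%R := le_trans (w0 0%R) (w_m 0%R).
pose g x := (r x - q x)%R.
have g0 x : (0 <= g x)%R by rewrite subr_ge0.
have gM x : (g x <= M)%R by rewrite (le_trans _ (rM x))// gerBl.
have qM x : (q x <= M)%R by rewrite (le_trans (qr x)).
have mg : mes g by exact: mesB.
have mgw : mes (fun x => g x * w x)%R by exact: mesM.
have mgq : mes (fun x => g x * q x)%R by exact: mesM.
have mwq : mes (fun x => (w x - q x) ^+ 2)%R by apply: mesX; exact: mesB.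
have mg2 : mes (fun x => g x ^+ 2)%R by exact: mesX.
have gw0 x : (0 <= g x * w x)%R by rewrite mulr_ge0.
have gq0 x : (0 <= g x * q x)%R by rewrite mulr_ge0.
have wq0 x : (0 <= (w x - q x) ^+ 2)%R by exact: sqr_ge0.
have g20 x : (0 <= g x ^+ 2)%R by exact: sqr_ge0.
have fgw : IE (fun x => g x * w x)%R \is a fin_num.
  by apply: (@IE_fin _ (M * m)%R) => // x _; rewrite ler_pM.
have fgq : IE (fun x => g x * q x)%R \is a fin_num.
  by apply: (@IE_fin _ (M * M)%R) => // x _; rewrite ler_pM.
have fwq : IE (fun x => (w x - q x) ^+ 2)%R \is a fin_num.
  apply: (@IE_fin _ ((M + m) ^+ 2)%R) => // x _.
  apply: sqr_sub_le; first by rewrite w0/= (le_trans (w_m x))// lerDr.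
  by rewrite q0/= (le_trans (qM x))// lerDl.
have fg2 : IE (fun x => g x ^+ 2)%R \is a fin_num := J_fin aq.
rewrite -/g -(fineK fgw) -(fineK fgq) lee_fin.
apply: (@le_of_small_steps _ _ (fine (IE (fun x => (w x - q x) ^+ 2)%R) / 2)%R).
  by rewrite divr_ge0// fine_ge0// IE_ge0.
move=> t /andP[t0 t1].
  pose p x := ((1 - t) * q x + t * w x)%R.
  have mp : mes p by apply: mesD; exact: mesM.
  have p0 x : (0 <= p x)%R by rewrite addr_ge0// mulr_ge0// ?subr_ge0// ltW.
  have Np : N (EFin \o p) <= K%:E.
    by apply: norm_comb => //; [rewrite subr_ge0|exact: ltW|lra].
  (* The point [p] may exceed [r]. Cutting it at [r] makes it admissible and does not increase the
     distance to [r]. *)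
  pose p' x := Num.min (p x) (r x).
  have mp' : mes p' by exact: mes_min.
  have p'0 x : (0 <= p' x)%R by rewrite le_min p0 r0.
  have ap' : adm p'.
    split => //; first by move=> x; rewrite ge_min lexx orbT.
    apply: le_trans Np; apply: norm_le; [exact: mesI|exact: mesI|..] => x; rewrite lee_fin//.
    by rewrite ge_min lexx.
  have mrp : mes (fun x => (r x - p x) ^+ 2)%R by apply: mesX; exact: mesB.
  have rp0 x : (0 <= (r x - p x) ^+ 2)%R by exact: sqr_ge0.
  have frp : IE (fun x => (r x - p x) ^+ 2)%R \is a fin_num.
    apply: (@IE_fin _ ((M + (M + m)) ^+ 2)%R) => // x _.
    have h1 : (p x <= M + m)%R.
      rewrite /p lerD//; first by rewrite (le_trans _ (qM x))// ler_piMl// gerBl ltW.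
      by rewrite (le_trans _ (w_m x))// ler_piMl.
    apply: sqr_sub_le; last by rewrite p0/= (le_trans h1)// lerDr.
    by rewrite r0/= (le_trans (rM x))// lerDl addr_ge0.
  have dle : d <= IE (fun x => (r x - p x) ^+ 2)%R.
    apply: le_trans (dJ ap') _; apply: IE_le => //.
    - by apply: mesX; exact: mesB.
    - by move=> x; exact: sqr_ge0.
    - move=> x _; rewrite /p'; have [pr|rp] := leP (p x) (r x) => //.
      by rewrite subrr expr0n/=.
  have t20 : (0 <= 2 * t)%R by lra.
  have tt0 : (0 <= t ^+ 2)%R by exact: sqr_ge0.
  have cgw x : (0 <= 2 * t * (g x * w x))%R by rewrite mulr_ge0.
  have cgq x : (0 <= 2 * t * (g x * q x))%R by rewrite mulr_ge0.
  have cwq x : (0 <= t ^+ 2 * (w x - q x) ^+ 2)%R by rewrite mulr_ge0.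
  have gcgq x : (0 <= g x ^+ 2 + 2 * t * (g x * q x))%R by rewrite addr_ge0.
  have : IE (fun x => (r x - p x) ^+ 2)%R + (2 * t)%:E * IE (fun x => g x * w x)%R =
      IE (fun x => g x ^+ 2)%R + (2 * t)%:E * IE (fun x => g x * q x)%R +
      (t ^+ 2)%:E * IE (fun x => (w x - q x) ^+ 2)%R.
    rewrite -(IE_Z mgw t20 gw0) -(IE_Z mgq t20 gq0) -(IE_Z mwq tt0 wq0).
    rewrite -(IE_D mrp (mesM (mesc _) mgw) rp0 cgw).
    rewrite -(IE_D mg2 (mesM (mesc _) mgq) g20 cgq).
    rewrite -(IE_D (mesD mg2 (mesM (mesc _) mgq)) (mesM (mesc _) mwq) gcgq cwq).
    by apply: eq_integral => x _; congr (_%:E); rewrite /p /g; ring.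
  have : J q <= IE (fun x => (r x - p x) ^+ 2)%R := le_trans Jq dle.
  move: (fineK frp) (fineK fgw) (fineK fgq) (fineK fwq) (fineK fg2).
  rewrite /J -/(g _); do 5 (set X := fine _; move: X => ? <-).
  rewrite lee_fin -!EFinM -!EFinD => h [e]; exact: quadratic_step t0 h e.
Qed.

(** Let g = r - q with q the projection, and let b be the integral of g q. By [variation], (K/t) g
    belongs to the polar of the unit ball whenever t > 0 and t >= b, so K times the integral of r g
    is at most B t. Since r g = g q + g^2, the choice of t as b plus the integral of g^2 gives K <=
    B unless g vanishes a.e. on the support interval of r. *)
Lemma bounded_norm_le (B : R) : (0 <= B < K)%R ->
  (forall g, meas_fun L g -> (forall x, 0 <= g x) ->
    (forall w, meas_fun_nneg L w -> N w <= 1 -> \int[leb]_(x in I) (g x * w x) <= 1) ->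
    \int[leb]_(x in I) ((r x)%:E * g x) <= B%:E) ->
  N (EFin \o r) <= K%:E.
Proof.
move=> /andP[B0 BK] H; have Kp : (0 < K)%R by exact: le_lt_trans BK.
have [q aq Jq] := minimizer; have [mq q0 qr Nq] := aq.
pose g x := (r x - q x)%R.
have g0 x : (0 <= g x)%R by rewrite subr_ge0.
have gM x : (g x <= M)%R by rewrite (le_trans _ (rM x))// gerBl.
have qM x : (q x <= M)%R by rewrite (le_trans (qr x)).
have mg : mes g by exact: mesB.
have g_out x : ~ E x -> g x = 0%R.
  move=> nE; have := q0 x; have := qr x; rewrite /g r_out// => h1 h2.
  by have -> : q x = 0%R; [apply/eqP; rewrite eq_le h1|rewrite subrr].
have mgq : mes (fun x => g x * q x)%R by exact: mesM.
have mg2 : mes (fun x => g x ^+ 2)%R by exact: mesX.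
have gq0 x : (0 <= g x * q x)%R by rewrite mulr_ge0.
have g20 x : (0 <= g x ^+ 2)%R by exact: sqr_ge0.
have fgq : IE (fun x => g x * q x)%R \is a fin_num.
  by apply: (@IE_fin _ (M * M)%R) => // x _; rewrite ler_pM.
have fg2 : IE (fun x => g x ^+ 2)%R \is a fin_num := J_fin aq.
pose b := fine (IE (fun x => g x * q x)%R).
have bE : IE (fun x => g x * q x)%R = b%:E by rewrite fineK.
have b0 : (0 <= b)%R by rewrite fine_ge0// IE_ge0.
have Ig u : \int[leb]_(x in I) ((g x)%:E * u x) = \int[leb]_(x in E) ((g x)%:E * u x).
  rewrite [LHS]integral_mkcond [RHS]integral_mkcond; apply: eq_integral => x _.
  rewrite !patchE; case: ifPn => [/set_mem Ix|nIx]; case: ifPn => [/set_mem ax|nax] //.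
    rewrite g_out ?mul0e// => ax; move/negP: nax; apply; rewrite inE; exact: ax.
  by case/negP: nIx; rewrite inE; exact: EI.
(* A test function [w] is nonnegative only almost everywhere and need not be bounded, while
   [variation] is stated for bounded nonnegative functions; hence the positive part, the cuts at
   height n, and monotone convergence. *)
have polar w : meas_fun_nneg L w -> N w <= 1 ->
    forall c, (0 <= c)%R -> \int[leb]_(x in I) ((c * K * g x)%:E * w x) <= (c * b)%:E.
  move=> mw Nw c c0.
  pose v x := maxe 0 (K%:E * w x).
  have v0 x : 0 <= v x by rewrite le_max lexx.
  have mw1 : meas_fun L w by case: mw.
  have mv : meas_fun L v.
    by apply: meas_fun_max; [exact: meas_fun_cst|apply: meas_funM => //; exact: meas_fun_cst].
  have Nv : N v <= K%:E.
    have nKw : meas_fun_nneg L (fun x => K%:E * w x).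
      split; first by apply: meas_funM => //; exact: meas_fun_cst.
      by case: mw => _; apply: leb_ae_imp => x _; exact: mule_ge0.
    apply: (@le_trans _ _ (N (fun x => K%:E * w x))).
      apply: (rin_mono N_ri) => //; first exact: nneg_of_ge0.
      by case: nKw => _; apply: leb_ae_imp => x _ h; rewrite /v ge_max lexx andbT.
    rewrite (rinZ N_ri)//.
    by rewrite -[leRHS]mule1 lee_wpmul2l// lee_fin ltW.
  have vae : \int[leb]_(x in I) ((c * K * g x)%:E * w x) =
      \int[leb]_(x in I) (c%:E * ((g x)%:E * v x)).
    apply: leb_ae_eq_integral; first exact: measurable_ival.
    - by apply: meas_funM => //; apply: (mesI (u := fun x => c * K * g x)%R); exact: mesM.
    - by apply: meas_funM; [exact: meas_fun_cst|apply: meas_funM => //; exact: mesI].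
    case: mw => _; apply: leb_ae_imp => x _ wx.
    have Kw0 : 0 <= K%:E * w x by rewrite mule_ge0// lee_fin ltW.
    by rewrite /v (max_idPr Kw0) !EFinM -!muleA; congr (_ * _); rewrite muleCA.
  have mgv : meas_fun L (fun x => (g x)%:E * v x) by apply: meas_funM => //; exact: mesI.
  have gv0 x : I x -> 0 <= (g x)%:E * v x by rewrite mule_ge0 ?lee_fin.
  rewrite vae (leb_integralZl (@measurable_ival R L) mgv gv0 c0).
  rewrite EFinM lee_wpmul2l ?lee_fin//  Ig.
  pose vn (n : nat) x := fine (mine (v x) n%:R%:E).
  have vnE n x : (vn n x)%:E = mine (v x) n%:R%:E.
    rewrite fineK// ge0_fin_numE; last by rewrite le_min v0 lee_fin/=.
    by rewrite gt_min ltry orbT.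
  have mvn n : mes (vn n).
    apply/(@measurable_EFinP _ (lebesgue_line R)).
    rewrite (_ : EFin \o vn n = fun x => mine (v x) n%:R%:E); last by apply/funext => x; exact: vnE.
    by apply: meas_fun_min => //; exact: meas_fun_cst.
  have vn0 n x : (0 <= vn n x)%R by rewrite -lee_fin vnE le_min v0 lee_fin/=.
  have vnn n x : (vn n x <= n%:R)%R by rewrite -lee_fin vnE ge_min lexx orbT.
  have ndv x : nondecreasing_seq (fun n => (vn n x)%:E).
    by move=> n m nm; rewrite !vnE le_min !ge_min lexx/= lee_fin ler_nat nm orbT.
  have cv x : (vn n x)%:E @[n --> \oo] --> v x.
    have -> : v x = ereal_sup (range (fun n => (vn n x)%:E)).
      apply/eqP; rewrite eq_le; apply/andP; split; last first.
        by apply: ge_ereal_sup => _ [n _ <-]; rewrite vnE ge_min lexx.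
      case E1 : (v x) => [y| |]; last by rewrite leNye.
        apply: ereal_sup_ubound; exists (Num.truncn y).+1 => //; rewrite vnE E1.
        by apply/min_idPl; rewrite lee_fin ltW// truncnS_gt.
      rewrite leye_eq; apply/eqP/eqyP => z z0.
      apply: (@le_trans _ _ (Num.truncn z).+1%:R%:E); first by rewrite lee_fin ltW// truncnS_gt.
      by apply: ereal_sup_ubound; exists (Num.truncn z).+1 => //; rewrite vnE E1 (min_idPr _)// leey.
    by apply: ereal_nondecreasing_cvgn; exact: ndv.
  have Hn n : \int[leb]_(x in E) ((g x)%:E * (vn n x)%:E) <= b%:E.
    under eq_integral do rewrite -EFinM.
    rewrite -bE; apply: (variation (m := n%:R)) => //.
      by move=> x; rewrite vn0 vnn.
    apply: le_trans Nv; apply: norm_le => //; first exact: mesI.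
      by move=> x; rewrite lee_fin.
    by move=> x; rewrite /= vnE ge_min lexx.
  pose W (n : nat) x := (g x)%:E * (vn n x)%:E.
  have mW n : leb_measurable_fun E (W n).
    by apply: (@emeasurable_funM _ (lebesgue_line R)); exact: mesE.
  have W0 n x : E x -> 0 <= W n x by move=> _; rewrite mule_ge0 ?lee_fin.
  have ndW x : E x -> {homo W ^~ x : n m / (n <= m)%N >-> n <= m}.
    by move=> _ n m nm; apply: lee_wpmul2l; [rewrite lee_fin|exact: ndv].
  have -> : \int[leb]_(x in E) ((g x)%:E * v x) = \int[leb]_(x in E) limn (W ^~ x).
    apply: eq_integral => x _; apply/esym/cvg_lim => //.
    by apply: cvgeZl => //; exact: cv.
  rewrite (monotone_convergence leb mE mW W0 ndW).
  apply: lime_le; last by apply: nearW => n; exact: Hn.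
  apply: ereal_nondecreasing_is_cvgn => n m nm.
  by apply: (leb_le_integral mE (mW n) (mW m) (W0 n)) => x Ex; exact: ndW.
(* A free t instead of [b] avoids dividing by zero, as [b] may vanish. *)
have step t : (0 < t)%R -> (b <= t)%R -> (K * (b + fine (IE (fun x => g x ^+ 2)%R)) <= B * t)%R.
  move=> t0 bt.
  have Kt0 : (0 <= K / t)%R by rewrite divr_ge0// ltW.
  have mKg : meas_fun L (fun x => (K / t * g x)%:E).
    by apply: (mesI (u := fun x => K / t * g x)%R); exact: mesM.
  have := H (fun x => (K / t * g x)%:E) mKg (fun x => _) _.
  have -> : \int[leb]_(x in I) ((r x)%:E * (K / t * g x)%:E) =
     (K / t)%:E * (IE (fun x => g x * q x)%R + IE (fun x => g x ^+ 2)%R).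
    rewrite -(IE_D mgq mg2 gq0 g20) -(IE_Z (mesD mgq mg2) Kt0); last by move=> x; rewrite addr_ge0.
    transitivity (\int[leb]_(x in I) ((g x)%:E * (K / t * r x)%:E)).
      by apply: eq_integral => x _; rewrite -!EFinM; congr (_%:E); ring.
    rewrite Ig; apply: eq_integral => x _; rewrite -EFinM; congr (_%:E).
    by rewrite /g; ring.
  rewrite bE -[X in _ + X]fineK// -EFinD -EFinM lee_fin => h.
  have {}h : (K / t * (b + fine (IE (fun x => g x ^+ 2)%R)) <= B)%R.
    apply: h => [x|w mw Nw]; first by rewrite lee_fin mulr_ge0.
    rewrite -[leRHS](_ : (t^-1 * t)%:E = 1); last by rewrite mulVf ?gt_eqF.
    rewrite [X in X <= _](_ : _ = \int[leb]_(x in I) ((t^-1 * K * g x)%:E * w x)); last first.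
      by apply: eq_integral => x _; rewrite (mulrC (t^-1)%R).
    have ti : (0 <= t^-1)%R by rewrite invr_ge0 ltW.
    by apply: le_trans (polar w mw Nw _ ti) _; rewrite lee_fin ler_wpM2l.
  by move: h; rewrite mulrAC ler_pdivrMr.
have G0 : fine (IE (fun x => g x ^+ 2)%R) = 0%R.
  apply/eqP; rewrite eq_le [in X in _ && X]fine_ge0 ?andbT; last exact: IE_ge0.
  rewrite leNgt; apply/negP => G0.
  have t0 : (0 < b + fine (IE (fun x => g x ^+ 2)%R))%R by rewrite ltr_wpDl.
  have := step _ t0 _; rewrite lerDl (ltW G0) => /(_ isT).
  by rewrite ler_pM2r// leNgt BK.
have g2ae : ae_eq leb E (EFin \o (fun x => g x ^+ 2)%R) (cst 0).
  apply/(@ae_eq_integral_abs _ (lebesgue_line R)) => //; first exact: mesE.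
  rewrite -[RHS](_ : (fine (IE (fun x => g x ^+ 2)%R))%:E = 0); last by rewrite G0.
  by rewrite fineK//; apply: eq_integral => x _ /=; rewrite ger0_norm// sqr_ge0.
apply: le_trans Nq; apply: (rin_mono N_ri).
- by apply: nneg_of_ge0; [exact: mesI|move=> x; rewrite lee_fin].
- by apply: nneg_of_ge0; [exact: mesI|move=> x; rewrite lee_fin].
have [A [mA A0 EA]] := g2ae; exists A; split => // x /= nrq; apply: EA => /= h.
apply: nrq => Ix; rewrite lee_fin; have [Ex|nEx] := pselect (E x); last by rewrite r_out.
have /eqP := h Ex; rewrite eqe sqrf_eq0 /g subr_eq0 => /eqP ->; exact: lexx.
Qed.

End projection.
(** Cut f at height n and restrict it to x < n, apply the bounded case with the radius B + e, whose
    strict excess over B is required there, and pass to the limit by the Fatou property. *)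
Lemma lorentz_luxemburg_le f (B : R) : meas_fun L f -> (forall x, 0 <= f x) -> (0 <= B)%R ->
  (forall g, meas_fun L g -> (forall x, 0 <= g x) ->
    (forall w, meas_fun_nneg L w -> N w <= 1 -> \int[leb]_(x in I) (g x * w x) <= 1) ->
    \int[leb]_(x in I) (f x * g x) <= B%:E) ->
  N f <= B%:E.
Proof.
move=> mf f0 B0 H.
pose u (n : nat) (x : R) : \bar R :=
  if x \in ival (mine L n%:R%:E) then mine (f x) n%:R%:E else 0.
have uE n x : u n x = (fine (u n x))%:E.
  rewrite fineK// /u; case: ifP => // _; rewrite ge0_fin_numE; last by rewrite le_min f0 lee_fin/=.
  by rewrite gt_min ltry orbT.
have u0 n x : 0 <= u n x by rewrite /u; case: ifP => // _; rewrite le_min f0 lee_fin/=.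
have un n x : u n x <= n%:R%:E by rewrite /u; case: ifP; rewrite ?ge_min ?lexx ?orbT// lee_fin.
have uf n x : u n x <= f x by rewrite /u; case: ifP => _; rewrite ?ge_min ?lexx.
have mu n : meas_fun L (u n).
  rewrite (_ : u n = fun x => mine (f x) n%:R%:E * (\1_(ival (mine L n%:R%:E)) x)%:E).
    apply: meas_funM; first by apply: meas_fun_min => //; exact: meas_fun_cst.
    apply: (@measurable_funTS _ _ (lebesgue_line R)).
    apply/(@measurable_EFinP _ (lebesgue_line R)).
    by apply: (@measurable_indic _ (lebesgue_line R)); exact: measurable_ival.
  apply/funext => x; rewrite /u indicE; case: ifP => h; first by rewrite mule1.
  by rewrite mule0.
have ndu x : nondecreasing_seq (u ^~ x).
  move=> n m nm; have nm' : n%:R%:E <= m%:R%:E :> \bar R by rewrite lee_fin ler_nat.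
  rewrite /u; case: ifPn => [/set_mem h|_]; last by case: ifP => // _; rewrite le_min f0 lee_fin/=.
  case: ifPn => [_|/negP]; first by rewrite le_min !ge_min lexx/= nm' orbT.
  by case; rewrite inE; apply: ivalS h; rewrite le_min !ge_min lexx/= nm' orbT.
pose v x := if x \in I then f x else 0.
have v0 x : 0 <= v x by rewrite /v; case: ifP.
have cu x : u n x @[n --> \oo] --> v x.
  have -> : v x = ereal_sup (range (u ^~ x)); last by apply: ereal_nondecreasing_cvgn; exact: ndu.
  apply/eqP; rewrite eq_le; apply/andP; split; last first.
    apply: ge_ereal_sup => _ [n _ <-]; rewrite /u /v; case: ifPn => [/set_mem h|_]; last exact: v0.
    case: ifPn => [_|/negP]; first by rewrite ge_min lexx.
    by case; rewrite inE; apply: ivalS h; rewrite ge_min lexx.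
  rewrite /v; case: ifPn => [/set_mem Ix|_]; last first.
    by apply: (le_trans (u0 0%N x)); apply: ereal_sup_ubound; exists 0%N.
  have big (y : R) : y%:E <= f x -> y%:E <= ereal_sup (range (u ^~ x)).
    move=> yf; pose n := (Num.truncn (Num.max x y)).+1.
    have : (Num.max x y < n%:R)%R by exact: truncnS_gt.
    rewrite gt_max => /andP[xn yn].
    apply: (@le_trans _ _ (u n x)); last by apply: ereal_sup_ubound; exists n.
    rewrite /u; case: ifPn => [_|/negP[]]; first by rewrite le_min yf lee_fin ltW.
    by rewrite inE -ivalI.
  case E : (f x) (f0 x) big => [y| |]// _ big; first exact: big.
  rewrite leye_eq; apply/eqP/eqyP => z z0; apply: big; exact: leey.
have mv : meas_fun L v.
  apply: (@emeasurable_fun_cvg _ (lebesgue_line R) _ _ u) => //.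
apply: (@le_trans _ _ (N v)).
  apply: (rin_mono N_ri); [exact: nneg_of_ge0|exact: nneg_of_ge0|].
  by apply: aeW => x Ix; rewrite /v mem_set.
apply: (sup_norm_le mu mv u0 v0 ndu cu) => n.
apply/lee_addgt0Pr => e e0; rewrite -EFinD.
(* For n = 0 the interval is empty, and the bounded case requires positive length. *)
have [n0|n0] := posnP n.
  rewrite (_ : u n = fun=> 0) ?norm0 ?lee_fin ?addr_ge0// ?(ltW e0)//.
  by apply/funext => x; apply/eqP; rewrite eq_le u0 andbT; have := un n x; rewrite n0.
have a0 : (0 < fine (mine L n%:R%:E))%R.
  rewrite fine_gt0// lt_min L0 lte_fin ltr0n n0/=.
  by rewrite gt_min ltry orbT.
have aE : (fine (mine L n%:R%:E))%:E = mine L n%:R%:E.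
  rewrite fineK// ge0_fin_numE; last by rewrite le_min (ltW L0) lee_fin/=.
  by rewrite gt_min ltry orbT.
have uE2 : EFin \o (fine \o u n) = u n by apply/funext => x; rewrite /= -uE.
have mu2 : meas_fun L (EFin \o (fine \o u n)) by rewrite uE2.
rewrite -uE2.
apply: (@bounded_norm_le (fine \o u n) n%:R (fine (mine L n%:R%:E)) (B + e)%R _ _ _ _ _ _ _ B).
- exact: a0.
- by rewrite aE ge_min lexx.
- exact/(@measurable_EFinP _ (lebesgue_line R)).
- by move=> x; rewrite -lee_fin /= -uE.
- by move=> x; rewrite -lee_fin /= -uE.
- by rewrite aE => x nx; rewrite /= /u memNset.
- by rewrite addr_ge0// ltW.
- by rewrite B0 ltrDl.
move=> g mg g0 gw; apply: le_trans (H g mg g0 gw).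
apply: leb_le_integral; first exact: measurable_ival.
- exact: (meas_funM mu2).
- exact: meas_funM.
- by move=> x _; rewrite /= -uE mule_ge0.
- by move=> x _; rewrite /= -uE lee_wpmul2r.
Qed.

End lorentz_luxemburg.

(** * The associate norm *)

Lemma leb_integralZle {R : realType} (E : set R) (f : R -> \bar R) (k : \bar R) :
  leb_measurable E -> leb_measurable_fun E f -> (forall x, E x -> 0 <= f x) -> 0 <= k ->
  \int[leb]_(x in E) (k * f x) = k * \int[leb]_(x in E) f x.
Proof.
by move=> mE mf f0 k0; exact: (@ge0_integralZl _ (lebesgue_line R) R leb E mE f mf k f0 k0).
Qed.

Section associate_norm.
Context {R : realType} {L : \bar R} {N : functional R}.
Hypothesis L0 : 0 < L.
Hypothesis N_ri : ri_norm L N.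
Implicit Types (f g h u w : R -> \bar R).
Local Notation D := (distribution_fun L).
Local Notation I := (ival L).
Local Notation "f ^*" := (rearrangement L f).
Local Notation A := (assoc_norm L N).

Lemma norm_abs w : meas_fun_nneg L w -> N (fun t => `|w t|) = N w.
Proof.
move=> nw; have [mw w0] := nw.
have naw : meas_fun_nneg L (fun t => `|w t|).
  by apply: nneg_of_ge0 => // t; [exact: meas_fun_abs].
apply/eqP; rewrite eq_le; apply/andP; split; apply: (rin_mono N_ri) => //.
  by apply: leb_ae_imp w0 => t _ wt; rewrite gee0_abs.
by apply: leb_ae_imp w0 => t _ wt; rewrite gee0_abs.
Qed.

Lemma norm_rearrangement w : meas_fun L w -> (forall x, 0 <= w x) -> N (w^*) = N w.
Proof.
move=> mw w0; apply: (rin_equi N_ri).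
- by apply: nneg_of_ge0 => [|t]; [exact: meas_rearrangement|exact: rearrangement_ge0].
- exact: nneg_of_ge0.
- by move=> l l0; apply: distribution_rearrangement => //; exact: ltW.
Qed.

Lemma norm_le_distribution u w : meas_fun L u -> meas_fun L w ->
  (forall x, 0 <= u x) -> (forall x, 0 <= w x) ->
  (forall l, (0 < l)%R -> D u l <= D w l) -> N u <= N w.
Proof.
move=> mu mw u0 w0 uw; rewrite -norm_rearrangement// -(norm_rearrangement mw)//.
apply: (norm_le N_ri); try exact: meas_rearrangement.
- by move=> x; exact: rearrangement_ge0.
- by move=> x; apply: le_rearrangement => l l0; exact: uw.
Qed.

(** The definition admits test functions that are nonnegative only almost everywhere; replacing w by
    |w| changes neither the integral nor the norm. *)
Lemma assoc_ub f (B : \bar R) : meas_fun L f -> (forall x, I x -> 0 <= f x) ->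
  (forall w, meas_fun L w -> (forall x, 0 <= w x) -> N w <= 1 ->
    \int[leb]_(x in I) (f x * w x) <= B) -> A f <= B.
Proof.
move=> mf f0 H; apply: ge_ereal_sup => _ [w [nw Nw] <-].
have [mw w0] := nw; have maw := meas_fun_abs mw.
have -> : \int[leb]_(x in I) (f x * w x) = \int[leb]_(x in I) (f x * `|w x|).
  apply: leb_ae_eq_integral; first exact: measurable_ival.
  - exact: meas_funM.
  - exact: meas_funM.
  - by apply: leb_ae_imp w0 => x _ wx; rewrite gee0_abs.
by apply: H => //; rewrite norm_abs.
Qed.

Lemma assoc_eq f g : (forall x, I x -> f x = g x) -> A f = A g.
Proof.
move=> fg; congr ereal_sup; apply/seteqP; split => _ [w Nw <-]; exists w => //.
  by apply: eq_integral => x /set_mem /fg ->.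
by apply: eq_integral => x /set_mem /fg ->.
Qed.

Lemma assoc_ge f w : meas_fun L w -> (forall x, 0 <= w x) -> N w <= 1 ->
  \int[leb]_(x in I) (f x * w x) <= A f.
Proof.
by move=> mw w0 Nw; apply: ereal_sup_ubound; exists w => //; split => //; exact: nneg_of_ge0.
Qed.

Lemma assoc_ge0 f : 0 <= A f.
Proof.
apply: (@le_trans _ _ (\int[leb]_(x in I) (f x * (cst 0 x)))).
  by rewrite integral0_eq// => x _; rewrite mule0.
by apply: assoc_ge => //; [exact: meas_fun_cst|rewrite (norm0 N_ri)].
Qed.

Lemma assoc_le f g : meas_fun L f -> meas_fun L g -> (forall x, I x -> 0 <= f x) ->
  (forall x, I x -> f x <= g x) -> A f <= A g.
Proof.
move=> mf mg f0 fg; apply: assoc_ub => // w mw w0 Nw.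
apply: le_trans (assoc_ge g mw w0 Nw); apply: leb_le_integral; first exact: measurable_ival.
- exact: meas_funM.
- exact: meas_funM.
- by move=> x Ix; rewrite mule_ge0// f0.
- by move=> x Ix; rewrite lee_wpmul2r// fg.
Qed.

Lemma assoc_holder f w (c : R) : meas_fun L f -> (forall x, I x -> 0 <= f x) ->
  meas_fun L w -> (forall x, 0 <= w x) -> (0 < c)%R -> N w <= c%:E ->
  \int[leb]_(x in I) (f x * w x) <= c%:E * A f.
Proof.
move=> mf f0 mw w0 c0 Nw.
have ci0 : (0 <= c^-1)%R by rewrite invr_ge0 ltW.
pose v x := (c^-1)%:E * w x.
have mv : meas_fun L v by apply: meas_funM => //; exact: meas_fun_cst.
have v0 x : 0 <= v x by rewrite mule_ge0// lee_fin.
have Nv : N v <= 1.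
  rewrite (rinZ N_ri)//; last exact: nneg_of_ge0.
  apply: (@le_trans _ _ ((c^-1)%:E * c%:E)); first by rewrite lee_wpmul2l// lee_fin.
  by rewrite -EFinM mulVf// gt_eqF.
rewrite (_ : \int[leb]_(x in I) (f x * w x) = c%:E * \int[leb]_(x in I) (f x * v x)).
  by rewrite lee_wpmul2l ?lee_fin ?(ltW c0)//; exact: assoc_ge.
rewrite -leb_integralZl.
- by apply: eq_integral => x _; rewrite /v muleCA (muleA c%:E) -EFinM divff ?gt_eqF// mul1e.
- exact: measurable_ival.
- exact: meas_funM.
- by move=> x Ix; rewrite mule_ge0// f0.
- exact: ltW.
Qed.

Lemma assocZ f (c : R) : meas_fun L f -> (forall x, I x -> 0 <= f x) -> (0 <= c)%R ->
  A (fun x => c%:E * f x) <= c%:E * A f.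
Proof.
move=> mf f0 c0; apply: assoc_ub.
- by apply: meas_funM => //; exact: meas_fun_cst.
- by move=> x Ix; rewrite mule_ge0 ?lee_fin// f0.
move=> w mw w0 Nw; under eq_integral do rewrite -muleA.
rewrite leb_integralZl//; last 3 first.
- exact: measurable_ival.
- exact: meas_funM.
- by move=> x Ix; rewrite mule_ge0// f0.
by rewrite lee_wpmul2l ?lee_fin//; exact: assoc_ge.
Qed.

Lemma assoc_nneseries (f_ : nat -> R -> \bar R) : (forall n, meas_fun L (f_ n)) ->
  (forall n x, 0 <= f_ n x) ->
  A (fun x => \sum_(n <oo) f_ n x) <= \sum_(n <oo) A (f_ n).
Proof.
move=> mf f0; have mI := @measurable_ival R L.
apply: assoc_ub.
- exact: (@ge0_emeasurable_sum _ (lebesgue_line R) R I f_ xpredT (fun n x _ _ => f0 n x) (fun n _ => mf n)).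
- by move=> x _; apply: nneseries_ge0 => n _ _; exact: f0.
move=> w mw w0 Nw.
have mfw n : meas_fun L (fun x => f_ n x * w x) by exact: meas_funM.
have fw0 n x : I x -> 0 <= f_ n x * w x by rewrite mule_ge0.
have -> : \int[leb]_(x in I) ((\sum_(n <oo) f_ n x) * w x) =
    \int[leb]_(x in I) (\sum_(n <oo) (f_ n x * w x)).
  apply: eq_integral => x _; under [RHS]eq_eseriesr do rewrite muleC.
  by rewrite muleC nneseriesZle.
rewrite (@integral_nneseries _ (lebesgue_line R) R leb I mI (fun n x => f_ n x * w x) mfw fw0).
apply: lee_nneseries => [n _|n _]; last exact: assoc_ge.
by move=> _; apply: integral_ge0 => x; exact: fw0.
Qed.

(** The integral of f^* w is at most that of f^* w^* by the Hardy-Littlewood inequality, and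
    resonance bounds the latter through functions h whose distribution function is at most that of
    w, hence of norm at most 1. *)
Lemma assoc_rearrangement f : meas_fun L f -> A (f^*) <= A (fun x => `|f x|).
Proof.
move=> mf; apply: assoc_ub; first exact: meas_rearrangement.
  by move=> x _; exact: rearrangement_ge0.
move=> w mw w0 Nw; apply: (@le_trans _ _ (\int[leb]_(x in I) (f^* x * w^* x))).
  rewrite [leLHS](_ : _ = \int[leb]_(x in I) (`|f^* x| * `|w x|)); last first.
    by apply: eq_integral => x _; rewrite !gee0_abs// rearrangement_ge0.
  apply: le_trans (hardy_littlewood L0 (meas_rearrangement f) mw) _.
  apply: leb_le_integral; first exact: measurable_ival.
  - by apply: meas_funM; exact: meas_rearrangement.
  - by apply: meas_funM; exact: meas_rearrangement.
  - by move=> x _; rewrite mule_ge0// rearrangement_ge0.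
  - move=> x Ix; rewrite lee_wpmul2r ?rearrangement_ge0//.
    apply: (rearrangement_noninc_le (meas_rearrangement f)) => //.
      by move=> s _; exact: rearrangement_ge0.
    by move=> s t _ _; exact: rearrangement_nonincr.
apply: (resonance L0 mf mw) => h mh h0 Dh; apply: assoc_ge => //.
by apply: le_trans Nw; exact: norm_le_distribution.
Qed.

(** Against a test function w, use the Hardy-Littlewood inequality and then Hardy's lemma with the
    nonincreasing weight w^*. *)
Lemma assoc_hardy_littlewood_polya f h (c : R) : meas_fun L f -> (0 <= c)%R ->
  (forall x, I x -> 0 <= h x) ->
  (forall s t, I s -> I t -> (s <= t)%R -> h t <= h s) ->
  (forall a, I a -> \int[leb]_(x in ival a%:E) f^* x <= c%:E * \int[leb]_(x in ival a%:E) h x) ->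
  A (fun x => `|f x|) <= c%:E * A h.
Proof.
move=> mf c0 h0 nih H; have mh := nonincreasing_meas_fun nih.
have mI := @measurable_ival R L.
have mch : meas_fun L (fun x => c%:E * h x) by apply: meas_funM => //; exact: meas_fun_cst.
have ch0 x : I x -> 0 <= c%:E * h x by move=> Ix; rewrite mule_ge0 ?lee_fin ?h0.
apply: le_trans (assocZ mh h0 c0).
apply: assoc_ub; [exact: meas_fun_abs|by move=> x _; exact: abse_ge0|].
move=> w mw w0 Nw.
rewrite [leLHS](_ : _ = \int[leb]_(x in I) (`|f x| * `|w x|)); last first.
  by apply: eq_integral => x _; rewrite [`|w x|]gee0_abs.
apply: le_trans (hardy_littlewood L0 mf mw) _.
apply: (@le_trans _ _ (\int[leb]_(x in I) ((c%:E * h x) * w^* x))).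
  apply: hardy => //; try exact: meas_rearrangement.
  - by move=> x _; exact: rearrangement_ge0.
  - by move=> x _; exact: rearrangement_ge0.
  - by move=> s t _ _; exact: rearrangement_nonincr.
  move=> a Ia; have aL : a%:E <= L by case: Ia => _ /ltW.
  rewrite leb_integralZl//; first exact: H.
  - exact: measurable_ival.
  - exact: meas_funS mh.
  - by move=> x /(ivalS aL) /h0.
apply: assoc_ge; first exact: meas_rearrangement.
  by move=> x; exact: rearrangement_ge0.
by rewrite norm_rearrangement.
Qed.

(** The inequality of X'' = X that matters: the norm of X is tested against the unit ball of X'. *)
Lemma norm_dual_le f (B : R) : meas_fun L f -> (0 <= B)%R ->
  (forall g, meas_fun L g -> (forall x, 0 <= g x) -> A g <= 1 ->
    \int[leb]_(x in I) (`|f x| * g x) <= B%:E) ->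
  N (fun x => `|f x|) <= B%:E.
Proof.
move=> mf B0 H; apply: (lorentz_luxemburg_le L0 N_ri) => //; first exact: meas_fun_abs.
move=> g mg g0 gw; apply: H => //; apply: assoc_ub => // w mw w0 Nw.
by apply: gw => //; exact: nneg_of_ge0.
Qed.

Lemma indic_norm_lty (a : R) : a%:E <= L -> N (fun t => (\1_(ival a%:E) t)%:E) < +oo.
Proof.
move=> aL; apply: (rin_indic N_ri); [exact: measurable_ival|exact: ivalS|].
have [a0|a0] := leP 0%R a; first by rewrite leb_ival ?ltry// lee_fin.
rewrite (_ : ival _ = set0) ?measure0 ?ltry// -subset0 => x [x0].
by rewrite lte_fin => xa; have := lt_trans x0 (lt_trans xa a0); rewrite ltxx.
Qed.

Lemma meas_indic L' L'' : meas_fun L' (fun t : R => (\1_(ival L'') t)%:E).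
Proof.
apply: (@measurable_funTS _ _ (lebesgue_line R)).
apply/(@measurable_EFinP _ (lebesgue_line R)).
by apply: (@measurable_indic _ (lebesgue_line R)); exact: measurable_ival.
Qed.

Lemma integral_ival_indic f (a : R) : a%:E <= L ->
  \int[leb]_(x in I) (f x * (\1_(ival a%:E) x)%:E) = \int[leb]_(x in ival a%:E) f x.
Proof.
move=> aL; rewrite [LHS]integral_mkcond [RHS]integral_mkcond; apply: eq_integral => x _.
rewrite !patchE indicE; case: ifPn => [/set_mem Ix|nIx]; case: ifPn => [/set_mem ax|nax] //.
- by rewrite mule1.
- by rewrite mule0.
- by case/negP: nIx; rewrite inE; exact: ivalS ax.
Qed.

(* P4 for X makes the functions in X' locally integrable. *)
Lemma assoc_prefix (a : R) : a%:E <= L -> exists2 c : R, (0 < c)%R &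
  forall f, meas_fun L f -> (forall x, I x -> 0 <= f x) ->
    \int[leb]_(x in ival a%:E) f x <= c%:E * A f.
Proof.
move=> aL; have := indic_norm_lty aL; set y := N _ => ylt.
have y0 : 0 <= y.
  apply: (rin_ge0 N_ri); apply: nneg_of_ge0; first exact: meas_indic.
  by move=> x; rewrite lee_fin.
have yf : y \is a fin_num by rewrite ge0_fin_numE.
exists (fine y + 1)%R; first by rewrite ltr_wpDl// fine_ge0.
move=> f mf f0; rewrite -integral_ival_indic//.
apply: assoc_holder => //.
- exact: meas_indic.
- by rewrite ltr_wpDl// fine_ge0.
- by rewrite -/y -{1}(fineK yf) lee_fin lerDl.
Qed.

Lemma norm_rearrangement_abs f : meas_fun L f -> N f^* = N (fun x => `|f x|).
Proof.
move=> mf; apply: (rin_equi N_ri).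
- by apply: nneg_of_ge0 => [|t]; [exact: meas_rearrangement|exact: rearrangement_ge0].
- by apply: nneg_of_ge0 => //; exact: meas_fun_abs.
move=> l l0; rewrite distribution_rearrangement//; last exact: ltW.
by rewrite /distribution_fun; congr (leb _); apply/seteqP; split => x /=; rewrite abse_id.
Qed.

Lemma norm_prefix (a : R) : (0 < a)%R -> a%:E <= L -> exists2 c : R, (0 < c)%R &
  forall f, meas_fun L f -> \int[leb]_(x in ival a%:E) f^* x <= c%:E * N (fun x => `|f x|).
Proof.
move=> a0 aL; have lE : leb (ival a%:E) < +oo by rewrite leb_ival ?ltry// lee_fin ltW.
have [c [c0 cP]] := rin_local N_ri (@measurable_ival R a%:E) (ivalS aL) lE.
exists c => // f mf; rewrite -norm_rearrangement_abs//; apply: cP.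
by apply: nneg_of_ge0 => [|t]; [exact: meas_rearrangement|exact: rearrangement_ge0].
Qed.

End associate_norm.

(** * The supremum operator of a nondecreasing weight *)

(** The function H f of the overview, with a genuine supremum. For a nondecreasing weight it does
    not exceed the essential supremum, because f^* is right continuous: values slightly to the right
    of a point come close to, or exceed, the value there. *)
Definition tail_sup (R : realType) (L : \bar R) (phi : R -> R) (f : R -> \bar R)
    (t : R) : \bar R :=
  ereal_sup [set (phi s)%:E * rearrangement L f s | s in
    [set s : R | ival L s /\ (t <= s)%R]].

Definition tail_op (R : realType) (L : \bar R) (phi : R -> R) (f : R -> \bar R)
    (t : R) : \bar R :=
  ((phi t)^-1)%:E * tail_sup L phi f t.

(* For the weights considered here this is equivalent to the Marcinkiewicz norm. *)
Definition weak_norm (R : realType) (L : \bar R) (phi : R -> R) (f : R -> \bar R) :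
    \bar R :=
  ereal_sup [set (phi s)%:E * rearrangement L f s | s in ival L].

Section weight.
Context {R : realType} {L : \bar R} {phi : R -> R}.
Implicit Types (f g h u w : R -> \bar R) (s t a : R).
Local Notation D := (distribution_fun L).
Local Notation I := (ival L).
Local Notation "f ^*" := (rearrangement L f).
Local Notation U := (tail_op L phi).
Local Notation H := (tail_sup L phi).
Local Notation M := (weak_norm L phi).

Hypothesis L0 : 0 < L.
Hypothesis phi_gt0 : forall t, I t -> (0 < phi t)%R.
Hypothesis phi_nd : forall s t, I s -> I t -> (s <= t)%R -> (phi s <= phi t)%R.

Lemma xi_gt0 t : I t -> (0 < (phi t)^-1)%R.
Proof. by move=> It; rewrite invr_gt0 phi_gt0. Qed.

Lemma xi_ge0 t : I t -> 0 <= ((phi t)^-1)%:E.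
Proof. by move=> It; rewrite lee_fin ltW// xi_gt0. Qed.

Lemma xi_nonincr s t : I s -> I t -> (s <= t)%R -> ((phi t)^-1 <= (phi s)^-1)%R.
Proof. by move=> Is It st; rewrite lef_pV2 ?posrE ?phi_gt0// phi_nd. Qed.

Lemma meas_xi : meas_fun L (fun t : R => ((phi t)^-1)%:E).
Proof. by apply: nonincreasing_meas_fun => s t Is It st; rewrite lee_fin xi_nonincr. Qed.

Lemma xi_le_prefix t : I t ->
  (t * (phi t)^-1)%:E <= \int[leb]_(s in ival t%:E) ((phi s)^-1)%:E.
Proof.
move=> It; rewrite EFinM; apply: (mul_le_prefix (h := fun s : R => ((phi s)^-1)%:E)) It.
  exact: xi_ge0.
by move=> s u Is Iu su; rewrite lee_fin xi_nonincr.
Qed.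

Lemma le_tail_sup f s t : I s -> (t <= s)%R -> (phi s)%:E * f^* s <= H f t.
Proof. by move=> Is ts; apply: ereal_sup_ubound; exists s. Qed.

Lemma tail_sup_ge0 f t : I t -> 0 <= H f t.
Proof.
move=> It; apply: le_trans (le_tail_sup f It (lexx t)).
by rewrite mule_ge0 ?lee_fin ?rearrangement_ge0// ltW// phi_gt0.
Qed.

Lemma tail_sup_nonincr f s t : (s <= t)%R -> H f t <= H f s.
Proof.
move=> st; apply: ge_ereal_sup => _ [x [Ix tx] <-].
by apply: le_tail_sup => //; exact: le_trans tx.
Qed.

Lemma tail_op_ge0 f t : I t -> 0 <= U f t.
Proof. by move=> It; rewrite mule_ge0 ?xi_ge0 ?tail_sup_ge0. Qed.

Lemma tail_op_nonincr f s t : I s -> I t -> (s <= t)%R -> U f t <= U f s.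
Proof.
move=> Is It st; apply: lee_pmul; rewrite ?xi_ge0 ?tail_sup_ge0//.
  by rewrite lee_fin xi_nonincr.
exact: tail_sup_nonincr.
Qed.

Lemma meas_tail_op f : meas_fun L (U f).
Proof. by apply: nonincreasing_meas_fun => s t; exact: tail_op_nonincr. Qed.

Lemma phi_xi t : I t -> ((phi t)^-1)%:E * (phi t)%:E = 1.
Proof. by move=> It; rewrite -EFinM mulVf// gt_eqF// phi_gt0. Qed.

Lemma le_tail_op f t : I t -> f^* t <= U f t.
Proof.
move=> It; rewrite -[leLHS]mul1e -(phi_xi It) -muleA.
by rewrite lee_wpmul2l ?xi_ge0//; exact: le_tail_sup.
Qed.

Lemma tail_op_scale (r : R) f g t : (0 <= r)%R -> I t ->
  (forall s, I s -> r%:E * f^* s <= g^* s) -> r%:E * U f t <= U g t.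
Proof.
move=> r0 It fg; rewrite muleCA lee_wpmul2l ?xi_ge0//.
have [->|rn0] := eqVneq r 0%R; first by rewrite mul0e tail_sup_ge0.
have rp : (0 < r)%R by rewrite lt0r rn0.
rewrite -lee_pdivlMl//; apply: ge_ereal_sup => _ [s [Is ts] <-].
rewrite lee_pdivlMl//; apply: le_trans (le_tail_sup g Is ts).
by rewrite muleCA lee_wpmul2l ?fg// lee_fin ltW// phi_gt0.
Qed.

Lemma rearrangement_scale_le (r : R) f g t : (0 < r)%R ->
  (forall s, I s -> r%:E * `|f s| <= `|g s|) -> meas_fun L f -> meas_fun L g ->
  r%:E * f^* t <= g^* t.
Proof.
move=> r0 fg mf mg; apply: le_ereal_inf_tmp => _ [l [l0 Dl] <-].
rewrite -lee_pdivlMl// -EFinM; apply: rearrangement_le.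
- exact: mf.
- by rewrite mulr_ge0// ?invr_ge0 ltW.
apply: le_trans Dl; apply: leb_le.
- exact: measurable_superlevel_abs.
- exact: measurable_superlevel_abs.
move=> x [Ix lx]; split => //; apply: lt_le_trans (fg _ Ix).
by rewrite -lte_pdivrMl.
Qed.

Lemma ival_nonempty : exists t, I t.
Proof.
have fl : mine L 1%:E \is a fin_num.
  by rewrite ge0_fin_numE ?le_min ?(ltW L0) ?lee_fin//= gt_min ltry orbT.
have l0 : (0 < fine (mine L 1%:E))%R by rewrite -lte_fin fineK// lt_min L0/= lte_fin.
exists (fine (mine L 1%:E) / 2)%R; split; first by rewrite divr_gt0.
apply: (@lt_le_trans _ _ (mine L 1%:E)); last by rewrite ge_min lexx.
by rewrite -[ltRHS]fineK// lte_fin ltr_pdivrMr// ltr_pMr// ltr1n.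
Qed.

Lemma le_weak_norm f t : I t -> (phi t)%:E * f^* t <= M f.
Proof. by move=> It; apply: ereal_sup_ubound; exists t. Qed.

Lemma weak_norm_ge0 f : 0 <= M f.
Proof.
have [t It] := ival_nonempty.
apply: le_trans (le_weak_norm f It).
by rewrite mule_ge0 ?rearrangement_ge0// lee_fin ltW// phi_gt0.
Qed.

Lemma rearrangement_le_weak f t : I t -> f^* t <= ((phi t)^-1)%:E * M f.
Proof.
move=> It; rewrite -[leLHS]mul1e -(phi_xi It) -muleA.
by rewrite lee_wpmul2l ?xi_ge0//; exact: le_weak_norm.
Qed.

Lemma weak_norm_le f (B : \bar R) :
  (forall t, I t -> f^* t <= ((phi t)^-1)%:E * B) -> M f <= B.
Proof.
move=> fB; apply: ge_ereal_sup => _ [t It <-].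
have -> : B = (phi t)%:E * (((phi t)^-1)%:E * B).
  by rewrite muleA [_%:E * _%:E]muleC phi_xi// mul1e.
by rewrite lee_wpmul2l ?fB// lee_fin ltW// phi_gt0.
Qed.

Context {c : R}.
Hypothesis avg : forall t, I t ->
  \int[leb]_(s in ival t%:E) ((phi s)^-1)%:E <= (c * (t * (phi t)^-1))%:E.

Lemma prefix_xi_le s t : I s -> I t -> (s <= t)%R ->
  \int[leb]_(x in ival s%:E) ((phi x)^-1)%:E <= \int[leb]_(x in ival t%:E) ((phi x)^-1)%:E.
Proof.
move=> Is It st; have [_ /ltW tL] := It.
apply: leb_subset_integral; [exact: measurable_ival|exact: measurable_ival| | |].
- exact: meas_funS meas_xi.
- by move=> x /(ivalS tL) /xi_ge0.
- by apply: ivalS; rewrite lee_fin.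
Qed.

(** The quantity t xi(t) is comparable to the primitive of xi, which is nondecreasing. In other
    words, phi(t)/t is nonincreasing up to the factor [c]. *)
Lemma xi_quasi_incr s t : I s -> I t -> (s <= t)%R ->
  (s * (phi s)^-1 <= c * (t * (phi t)^-1))%R.
Proof.
move=> Is It st; rewrite -lee_fin; apply: le_trans (xi_le_prefix Is) _.
apply: le_trans (prefix_xi_le Is It st) _; exact: avg.
Qed.

Lemma avg_ge1 : (1 <= c)%R.
Proof.
have [t It] := ival_nonempty; have [t0 _] := It.
have := xi_quasi_incr It It (lexx t).
by rewrite -ler_pdivrMr ?mulr_gt0 ?xi_gt0// divff// gt_eqF// mulr_gt0 ?xi_gt0.
Qed.

End weight.

Section gliding_hump.
Context {R : realType} {L : \bar R} {phi : R -> R} {N : functional R}.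
Hypothesis L0 : 0 < L.
Hypothesis phi_gt0 : forall t, ival L t -> (0 < phi t)%R.
Hypothesis phi_nd : forall s t, ival L s -> ival L t -> (s <= t)%R -> (phi s <= phi t)%R.
Hypothesis N_ri : ri_norm L N.
Local Notation U := (tail_op L phi).
Local Notation A := (assoc_norm L N).

(* A sum of suitably normalised functions f_n with A (U f_n) > 4^n A |f_n| would
   have finite associate norm while its image under U has not. *)
Lemma tail_op_uniformly_bounded :
  (forall f, meas_fun L f -> A (fun x => `|f x|) < +oo -> A (U f) < +oo) ->
  exists C : R, (0 < C)%R /\
    forall f, meas_fun L f -> A (U f) <= C%:E * A (fun x => `|f x|).
Proof.
move=> fin; apply: contrapT => /forallNP no.
have [f_ f_P] : {f_ : nat -> R -> \bar R & forall n, meas_fun L (f_ n) /\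
    (4 ^+ n)%:E * A (fun x => `|f_ n x|) < A (U (f_ n))}.
  apply: (@choice _ _ (fun n f => meas_fun L f /\ (4 ^+ n)%:E * A (fun x => `|f x|) < A (U f))) => n.
  have /not_andP[] := no (4 ^+ n)%R; first by rewrite exprn_gt0.
  move=> /existsNP[f /not_implyP[mf /negP]]; rewrite -ltNge => h.
  by exists f.
(* A positive real number between the two sides is needed for normalization, since A |f_n| may be 0
   and A (U f_n) may be +oo. *)
have [b bP] : {b : nat -> R & forall n, [/\ (0 < b n)%R,
    (4 ^+ n)%:E * A (fun x => `|f_ n x|) <= (b n)%:E & (b n)%:E <= A (U (f_ n))]}.
  apply: (@choice _ _ (fun n b => [/\ (0 < b)%R,
    (4 ^+ n)%:E * A (fun x => `|f_ n x|) <= b%:E & b%:E <= A (U (f_ n))])) => n.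
  have [_ h] := f_P n.
  have [|y y0 /andP[/ltW hy /ltW yA]] := ereal_between_ge0 _ h; last by exists y.
  by rewrite mule_ge0 ?lee_fin ?exprn_ge0//; exact: (assoc_ge0 N_ri).
(* With this factor the n-th term has associate norm at most 2^-n, while its image under U has
   associate norm at least 2^n. *)
pose w n : R := (2 ^+ n / b n)%R.
have w0 n : (0 < w n)%R by have [b0 _ _] := bP n; rewrite divr_gt0// exprn_gt0.
pose g_ n (x : R) := (w n)%:E * `|f_ n x|.
have g0 n x : 0 <= g_ n x by rewrite mule_ge0 ?lee_fin ?(ltW (w0 n)).
have mg n : meas_fun L (g_ n).
  by apply: meas_funM; [exact: meas_fun_cst|apply: meas_fun_abs; case: (f_P n)].
pose g (x : R) := \sum_(n <oo) g_ n x.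
have gg n x : g_ n x <= g x.
  apply: le_trans (@nneseries_lim_ge _ (g_ ^~ x) xpredT 0 n.+1 (fun k _ _ => g0 k x)).
  by rewrite big_nat_recr//= leeDr// sume_ge0.
have gx0 x : 0 <= g x by apply: le_trans (gg 0%N x).
have mgx : meas_fun L g.
  exact: (@ge0_emeasurable_sum _ (lebesgue_line R) R (ival L) g_ xpredT (fun n x _ _ => g0 n x) (fun n _ => mg n)).
have gabs : (fun x => `|g x|) = g by apply/funext => x; rewrite gee0_abs.
have Ag : A (fun x => `|g x|) < +oo.
  rewrite gabs; apply: le_lt_trans (assoc_nneseries N_ri mg g0) _.
  apply: (@le_lt_trans _ _ 2%:E); last exact: ltry.
  apply: le_trans (epsilon_trick0 xpredT (ler0n R 2)).
  apply: lee_nneseries => [n _|n _]; first by move=> _; exact: (assoc_ge0 N_ri).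
  have [b0 fb _] := bP n; have [mf _] := f_P n.
  apply: le_trans (assocZ N_ri (meas_fun_abs mf) _ (ltW (w0 n))) _ => //.
  have -> : (w n)%:E * A (fun x => `|f_ n x|) =
      (w n / 4 ^+ n)%:E * ((4 ^+ n)%:E * A (fun x => `|f_ n x|)).
    by rewrite muleA -EFinM divfK// expf_neq0// pnatr_eq0.
  apply: (@le_trans _ _ ((w n / 4 ^+ n)%:E * (b n)%:E)).
    by rewrite lee_wpmul2l// lee_fin divr_ge0 ?(ltW (w0 n))// exprn_ge0.
  rewrite -EFinM lee_fin /w natrX exprS invfM mulrA divff ?pnatr_eq0// mul1r.
  rewrite (_ : 4 = 2 * 2)%R; last by rewrite -natrM.
  rewrite exprMn [leLHS](_ : _ = 2 ^- n)%R//; have : (2 ^+ n != 0 :> R)%R by rewrite expf_neq0// pnatr_eq0.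
  by move: (2 ^+ n)%R (lt0r_neq0 b0) => p bn pn; field; rewrite bn pn.
have := fin g mgx Ag; apply/negP; rewrite -leNgt.
have big n : (2 ^+ n)%:E <= A (U g).
  have [b0 _ bU] := bP n; have [mf _] := f_P n.
  have Ugn : A (fun x => (w n)%:E * U (f_ n) x) <= A (U g).
    apply: (assoc_le N_ri).
    - by apply: meas_funM; [exact: meas_fun_cst|exact: meas_tail_op].
    - exact: meas_tail_op.
    - by move=> x Ix; rewrite mule_ge0 ?lee_fin ?(ltW (w0 n))// tail_op_ge0.
    move=> x Ix; apply: tail_op_scale => //; first exact: ltW.
    move=> s Is; apply: rearrangement_scale_le => //.
    by move=> y _; rewrite (gee0_abs (gx0 y)); exact: gg.
  apply: le_trans Ugn.
  have : A (U (f_ n)) <= ((w n)^-1)%:E * A (fun x => (w n)%:E * U (f_ n) x).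
    rewrite [leLHS](_ : _ = A (fun x => ((w n)^-1)%:E * ((w n)%:E * U (f_ n) x))).
      apply: (assocZ N_ri).
      - by apply: meas_funM; [exact: meas_fun_cst|exact: meas_tail_op].
      - by move=> x Ix; rewrite mule_ge0 ?lee_fin ?(ltW (w0 n))// tail_op_ge0.
      - by rewrite invr_ge0 ltW.
    by congr A; apply/funext => x; rewrite muleA -EFinM mulVf ?mul1e// gt_eqF.
  move=> /(le_trans bU); rewrite -lee_pdivrMl ?invr_gt0// invrK -EFinM.
  by rewrite /w divfK// gt_eqF.
rewrite leye_eq; apply/eqP/eqyP => y y0.
apply: le_trans (big (Num.truncn y).+1); rewrite lee_fin.
apply: le_trans (ltW (truncnS_gt y)) _.
by rewrite -natrX ler_nat ltnW// ltn_expl.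
Qed.

End gliding_hump.

(** * Passing to an equivalent weight *)

Lemma leb_ae_exists {R : realType} (L : \bar R) (P : R -> Prop) (a : R) (b : \bar R) :
  ival L a -> a%:E < b -> b <= L -> {ae leb, forall t, ival L t -> P t} ->
  exists t, [/\ ival L t, (a < t)%R, t%:E < b & P t].
Proof.
move=> [a0 aL] ab bL [Z [mZ Z0 PZ]]; apply: contrapT => none.
have [d [ad db]] : exists d : R, (a < d)%R /\ d%:E < b.
  have [|d d0 /andP[ad db]] := ereal_between_ge0 _ ab; first by rewrite lee_fin ltW.
  by exists d; rewrite -lte_fin.
have sub : `]a, d[%classic `<=` Z.
  move=> x /=; rewrite in_itv/= => /andP[ax xd]; apply: PZ => /= Px.
  have Ix : ival L x.
    split; first exact: lt_trans ax.
    by apply: lt_le_trans bL; apply: lt_trans db; rewrite lte_fin.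
  apply: none; exists x; split => //; [|exact: Px].
  by apply: lt_trans db; rewrite lte_fin.
have : leb `]a, d[%classic <= leb Z.
  by apply: leb_le sub => //; apply: borel_leb_measurable; exact: measurable_itv.
rewrite [leb Z]Z0 -[leb _]/(lebesgue_measure `]a, d[%classic) lebesgue_measure_itv/=.
by rewrite lte_fin ad -EFinD lee_fin subr_le0 leNgt ad.
Qed.

Section equivalent_weight.
Context {R : realType} {L : \bar R} {phi phi0 : R -> R} {K : R}.
Implicit Types (f g h u w : R -> \bar R) (s t a : R).
Local Notation D := (distribution_fun L).
Local Notation I := (ival L).
Local Notation "f ^*" := (rearrangement L f).
Local Notation U := (tail_op L phi0).
Local Notation H := (tail_sup L phi0).
Local Notation xi := (fun t : R => (phi t)^-1)%R.

Hypothesis L0 : 0 < L.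
Hypothesis phi_meas : leb_measurable_fun I phi.
Hypothesis phi_gt0 : forall t, I t -> (0 < phi t)%R.
Hypothesis phi0_gt0 : forall t, I t -> (0 < phi0 t)%R.
Hypothesis phi0_nd : forall s t, I s -> I t -> (s <= t)%R -> (phi0 s <= phi0 t)%R.
Hypothesis K0 : (0 < K)%R.
Hypothesis phi_le : forall t, I t -> (phi t <= K * phi0 t)%R.
Hypothesis phi0_le : forall t, I t -> (phi0 t <= K * phi t)%R.

Lemma inv_phi_le t : I t -> ((phi t)^-1 <= K * (phi0 t)^-1)%R.
Proof.
move=> It; rewrite -[K]invrK -invfM lef_pV2 ?posrE ?mulr_gt0 ?invr_gt0 ?phi_gt0 ?phi0_gt0//.
by rewrite mulrC ler_pdivrMr// mulrC phi0_le.
Qed.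

Lemma inv_phi0_le t : I t -> ((phi0 t)^-1 <= K * (phi t)^-1)%R.
Proof.
move=> It; rewrite -[K]invrK -invfM lef_pV2 ?posrE ?mulr_gt0 ?invr_gt0 ?phi_gt0 ?phi0_gt0//.
by rewrite mulrC ler_pdivrMr// mulrC phi_le.
Qed.

Lemma meas_inv_phi : meas_fun L (fun t => (xi t)%:E).
Proof.
apply/(@measurable_EFinP _ (lebesgue_line R)).
apply: (@eq_measurable_fun _ _ (lebesgue_line R) _ _ (fun t => phi t `^ (-1))%R).
  by move=> t /set_mem It; rewrite /= powR_inv1// ltW// phi_gt0.
apply: (@measurableT_comp _ _ _ (lebesgue_line R) _ _ (fun x : R => x `^ (-1))%R _ phi) => //.
Qed.

Local Notation P := (primitive0 xi).
Local Notation P0 a := (\int[leb]_(s in ival a%:E) ((phi0 s)^-1)%:E).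

Lemma primitive_le t : I t -> P t <= K%:E * P0 t.
Proof.
move=> [t0 /ltW tL]; rewrite /primitive0 itv_ival -leb_integralZl//.
- apply: leb_le_integral; first exact: measurable_ival.
  + exact: meas_funS meas_inv_phi.
  + by apply: meas_funM; [exact: meas_fun_cst|apply: meas_funS (meas_xi phi0_gt0 phi0_nd)].
  + by move=> x /(ivalS tL) Ix; rewrite lee_fin invr_ge0 ltW// phi_gt0.
  + by move=> x /(ivalS tL) Ix; rewrite -EFinM lee_fin inv_phi_le.
- exact: measurable_ival.
- exact: meas_funS (meas_xi phi0_gt0 phi0_nd).
- by move=> x /(ivalS tL) Ix; exact: (xi_ge0 phi0_gt0).
- exact: ltW.
Qed.

Lemma le_primitive t : I t -> P0 t <= K%:E * P t.
Proof.
move=> [t0 /ltW tL]; rewrite /primitive0 itv_ival -leb_integralZl//.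
- apply: leb_le_integral; first exact: measurable_ival.
  + exact: meas_funS (meas_xi phi0_gt0 phi0_nd).
  + by apply: meas_funM; [exact: meas_fun_cst|apply: meas_funS meas_inv_phi].
  + by move=> x /(ivalS tL) Ix; exact: (xi_ge0 phi0_gt0).
  + by move=> x /(ivalS tL) Ix; rewrite -EFinM lee_fin inv_phi0_le.
- exact: measurable_ival.
- exact: meas_funS meas_inv_phi.
- by move=> x /(ivalS tL) Ix; rewrite lee_fin invr_ge0 ltW// phi_gt0.
- exact: ltW.
Qed.

(** The averaging condition holds almost everywhere, hence at some x between t and the smaller of 2t
    and L. Moving from t to x increases the primitive, and x is at most 2t while 1/phi0 is
    nonincreasing. The factor K occurs twice: in comparing the primitives and in comparing 1/phi
    with 1/phi0 at x. *)
Lemma averaging_everywhere : averaging L xi -> exists c : R, forall t, I t ->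
  P0 t <= (c * (t * (phi0 t)^-1))%:E.
Proof.
move=> av; have : exists2 b : R, (0 <= b)%R & ess_sup_on I (fun t => ((t * xi t)^-1)%:E * P t) <= b%:E.
  move: av; rewrite /averaging; case: ess_sup_on => [b _|//|_].
    by exists (Num.max b 0)%R; rewrite ?lee_fin le_max lexx ?orbT.
  by exists 0%R => //; exact: leNye.
move=> [b b0 /ess_supP bP].
have {bP} bP : {ae leb, forall t, I t -> P0 t <= (K * b * (t * (phi t)^-1))%:E}.
  case: bP => Z [mZ Z0 PZ]; exists Z; split => // t /= nt; apply: PZ => /= tb; apply: nt => It.
  apply: le_trans (le_primitive It) _; rewrite -mulrA EFinM lee_wpmul2l ?lee_fin ?(ltW K0)//.
  move: tb; rewrite /patch mem_set// => tb.
  have tx : (0 < t * (phi t)^-1)%R by rewrite mulr_gt0 ?invr_gt0 ?phi_gt0//; case: It.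
  by rewrite mulrC EFinM -lee_pdivrMl// -[leRHS]mul1e.
exists (2 * (K * K * b))%R => t It; have [t0 tL] := It.
have tm : t%:E < mine L (2 * t)%:E by rewrite lt_min tL lte_fin ltr_pMl// ltr1n.
have mL : mine L (2 * t)%:E <= L by rewrite ge_min lexx.
have [x [Ix tx xm xP]] := leb_ae_exists It tm mL bP.
apply: le_trans (prefix_xi_le phi0_gt0 phi0_nd It Ix (ltW tx)) _.
apply: le_trans xP _; rewrite lee_fin.
have x2t : (x <= 2 * t)%R by move: xm; rewrite lt_min => /andP[_]; rewrite lte_fin => /ltW.
have xinv : ((phi x)^-1 <= K * (phi0 t)^-1)%R.
  apply: le_trans (inv_phi_le Ix) _; rewrite ler_wpM2l ?(ltW K0)//.
  exact: (xi_nonincr phi0_gt0 phi0_nd It Ix (ltW tx)).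
rewrite (_ : (2 * (K * K * b) * (t / phi0 t)) = (K * b) * (2 * t * (K * (phi0 t)^-1)))%R; last by ring.
rewrite ler_wpM2l ?mulr_ge0 ?(ltW K0)// ler_pM//; first by case: Ix => /ltW.
by rewrite invr_ge0 ltW// phi_gt0.
Qed.

Lemma sup_operator_le f t : I t -> sup_operator L phi f t <= (K * K)%:E * U f t.
Proof.
move=> It; have [t0 tL] := It.
have S : ess_sup_on [set s : R | (t <= s)%R /\ s%:E < L]
    (fun s => (phi s)%:E * f^* s) <= K%:E * H f t.
  apply/ess_supP; apply: aeW => s; rewrite /patch; case: ifPn => [|_]; last exact: leNye.
  move=> /set_mem[ts sL]; have Is : I s by split => //; exact: lt_le_trans ts.
  apply: (@le_trans _ _ (K%:E * ((phi0 s)%:E * f^* s))).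
    by rewrite muleA -EFinM lee_wpmul2r ?rearrangement_ge0// lee_fin phi_le.
  by rewrite lee_wpmul2l ?lee_fin ?(ltW K0)// le_tail_sup.
rewrite /sup_operator /tail_op.
rewrite [leRHS](_ : _ = (K%:E * ((phi0 t)^-1)%:E) * (K%:E * H f t)); last first.
  by rewrite EFinM -!muleA; congr (_ * _); rewrite muleCA.
apply: (@le_trans _ _ (((phi t)^-1)%:E * (K%:E * H f t))).
  by rewrite lee_wpmul2l// lee_fin invr_ge0 ltW// phi_gt0.
rewrite lee_wpmul2r ?mule_ge0 ?lee_fin ?(ltW K0) ?tail_sup_ge0//.
exact: inv_phi_le.
Qed.

(** If phi0(s) f^*(s) exceeds K m for the essential supremum m, then f^* exceeds K m / phi0(s) on a
    whole interval to the right of s. There phi f^* > m, because phi0 is nondecreasing and phi0 <= K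
    phi; this contradicts the choice of m. *)
Lemma ess_sup_tail_ge f t : meas_fun L f -> I t ->
  0 <= ess_sup_on [set s : R | (t <= s)%R /\ s%:E < L] (fun s => (phi s)%:E * f^* s) /\
  H f t <= K%:E * ess_sup_on [set s : R | (t <= s)%R /\ s%:E < L] (fun s => (phi s)%:E * f^* s).
Proof.
move=> mf It; have [t0 tL] := It.
set m := ess_sup_on _ _.
have mP : {ae leb, forall x, I x -> (t <= x)%R -> (phi x)%:E * f^* x <= m}.
  have /ess_supP[Z [mZ Z0 PZ]] : m <= m by [].
  exists Z; split => // x /= nx; apply: PZ => /= xm; apply: nx => Ix tx.
  by move: xm; rewrite /patch mem_set//; case: Ix.
have pf x : I x -> 0 <= (phi x)%:E * f^* x.
  by move=> Ix; rewrite mule_ge0 ?rearrangement_ge0// lee_fin ltW// phi_gt0.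
have m0 : 0 <= m.
  have [x [Ix tx _ xP]] := leb_ae_exists It tL (lexx L) mP.
  by apply: le_trans (xP (ltW tx)); exact: pf.
split => //; apply: ge_ereal_sup => _ [s [Is ts] <-]; rewrite leNgt; apply/negP => ms.
have mf' : m \is a fin_num.
  rewrite ge0_fin_numE//; move: ms; case: (m) => [r||]; rewrite ?ltry ?ltNyy//.
  by rewrite gt0_muley ?lte_fin// ltNge leey.
have p0s := phi0_gt0 Is.
pose q := (K * fine m / phi0 s)%R.
have q0 : (0 <= q)%R by rewrite divr_ge0 ?(ltW p0s)// mulr_ge0 ?(ltW K0)// fine_ge0.
have : q%:E < f^* s.
  rewrite -(@lte_pmul2l _ (phi0 s)%:E)//.
  by rewrite -EFinM /q mulrC divfK ?gt_eqF// EFinM fineK.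
rewrite rearrangement_gt// => sD.
have [x [Ix sx xD xP]] := leb_ae_exists Is sD (distribution_fun_le L0 q mf) mP.
have := xP (le_trans ts (ltW sx)); apply/negP; rewrite -ltNge.
have qx : q%:E < f^* x by rewrite rearrangement_gt.
have px := phi_gt0 Ix.
apply: (@le_lt_trans _ _ ((phi x)%:E * q%:E)); last by rewrite lte_pmul2l// lte_fin.
rewrite -[leLHS](fineK mf') -EFinM lee_fin /q mulrA ler_pdivlMr//.
rewrite [leRHS](_ : _ = fine m * (K * phi x))%R; last by ring.
apply: ler_wpM2l; first by rewrite fine_ge0.
by apply: le_trans (phi0_nd Is Ix (ltW sx)) _; exact: phi0_le.
Qed.

Lemma le_sup_operator f t : meas_fun L f -> I t ->
  U f t <= (K * K)%:E * sup_operator L phi f t.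
Proof.
move=> mf It; have [m0 Hm] := ess_sup_tail_ge mf It.
rewrite /sup_operator /tail_op; move: m0 Hm; set S := ess_sup_on _ _ => m0 Hm.
rewrite [leRHS](_ : _ = (K%:E * ((phi t)^-1)%:E) * (K%:E * S)); last first.
  by rewrite EFinM -!muleA; congr (_ * _); rewrite muleCA.
apply: lee_pmul => //.
- by rewrite lee_fin invr_ge0 ltW// phi0_gt0.
- exact: tail_sup_ge0.
- by rewrite -EFinM lee_fin inv_phi0_le.
Qed.

Lemma sup_operator_ge0 f t : meas_fun L f -> I t -> 0 <= sup_operator L phi f t.
Proof.
move=> mf It; rewrite mule_ge0 ?lee_fin ?invr_ge0 ?(ltW (phi_gt0 It))//.
by have [] := ess_sup_tail_ge mf It.
Qed.

Lemma meas_sup_operator f : meas_fun L (sup_operator L phi f).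
Proof.
apply: meas_funM; first exact: meas_inv_phi.
apply: nonincreasing_meas_fun => s t Is It st; apply/ess_supP.
have /ess_supP : ess_sup_on [set x : R | (s <= x)%R /\ x%:E < L]
  (fun x => (phi x)%:E * f^* x) <= ess_sup_on [set x : R | (s <= x)%R /\ x%:E < L]
  (fun x => (phi x)%:E * f^* x) by [].
case=> Z [mZ Z0 PZ]; exists Z; split => // x /= nx; apply: PZ => /= xm; apply: nx.
rewrite [leLHS]/patch; case: ifPn => [/set_mem[tx xL]|_]; last exact: leNye.
by move: xm; rewrite [leLHS]/patch mem_set//; split => //; exact: le_trans tx.
Qed.

Lemma bounded_sup_operatorP (N : functional R) : ri_norm L N ->
  bounded_on L (ext_norm (assoc_norm L N)) (sup_operator L phi) <->
  exists C : R, (0 < C)%R /\ forall f, meas_fun L f ->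
    assoc_norm L N (U f) <= C%:E * assoc_norm L N (fun x => `|f x|).
Proof.
move=> N_ri; have KK : (0 < K * K)%R by rewrite mulr_gt0.
have mU f : meas_fun L (U f) := meas_tail_op phi0_gt0 phi0_nd f.
have Tabs f : meas_fun L f -> assoc_norm L N (fun x => `|sup_operator L phi f x|) =
    assoc_norm L N (sup_operator L phi f).
  by move=> mf; apply: assoc_eq => x Ix; rewrite gee0_abs// sup_operator_ge0.
split=> -[C [C0 CP]].
  exists (K * K * C)%R; split; first by rewrite mulr_gt0.
  move=> f mf; have := CP f mf; rewrite /ext_norm Tabs// => CPf.
  apply: (@le_trans _ _ (assoc_norm L N (fun x => (K * K)%:E * sup_operator L phi f x))).
    apply: (assoc_le N_ri) => //.
    - by apply: meas_funM; [exact: meas_fun_cst|exact: meas_sup_operator].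
    - by move=> x Ix; exact: tail_op_ge0.
    - by move=> x Ix; exact: le_sup_operator.
  apply: le_trans (assocZ N_ri (meas_sup_operator f) _ (ltW KK)) _.
    by move=> x Ix; exact: sup_operator_ge0.
  by rewrite [(K * K * C)%:E]EFinM -muleA lee_wpmul2l// lee_fin ltW.
exists (K * K * C)%R; split; first by rewrite mulr_gt0.
move=> f mf; rewrite /ext_norm Tabs//.
apply: (@le_trans _ _ (assoc_norm L N (fun x => (K * K)%:E * U f x))).
  apply: (assoc_le N_ri).
  - exact: meas_sup_operator.
  - by apply: meas_funM; [exact: meas_fun_cst|exact: mU].
  - by move=> x Ix; exact: sup_operator_ge0.
  - by move=> x Ix; exact: sup_operator_le.
apply: le_trans (assocZ N_ri (mU f) _ (ltW KK)) _.
  by move=> x Ix; exact: tail_op_ge0.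
by rewrite [(K * K * C)%:E]EFinM -muleA lee_wpmul2l ?lee_fin ?(ltW KK)//; exact: CP.
Qed.

Lemma Lambda1_le f : Lambda1_norm L xi f <= K%:E * Lambda1_norm L (fun t => (phi0 t)^-1)%R f.
Proof.
rewrite /Lambda1_norm -leb_integralZl.
- apply: leb_le_integral; first exact: measurable_ival.
  + by apply: meas_funM; [exact: meas_rearrangement|exact: meas_inv_phi].
  + apply: meas_funM; first exact: meas_fun_cst.
    by apply: meas_funM; [exact: meas_rearrangement|exact: meas_xi].
  + by move=> x Ix; rewrite mule_ge0 ?rearrangement_ge0 ?lee_fin ?invr_ge0 ?(ltW (phi_gt0 Ix)).
  + by move=> x Ix; rewrite muleCA -EFinM lee_wpmul2l ?rearrangement_ge0 ?lee_fin ?inv_phi_le.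
- exact: measurable_ival.
- by apply: meas_funM; [exact: meas_rearrangement|exact: meas_xi].
- by move=> x Ix; rewrite mule_ge0 ?rearrangement_ge0 ?lee_fin ?invr_ge0 ?(ltW (phi0_gt0 Ix)).
- exact: ltW.
Qed.

Lemma le_Lambda1 f : Lambda1_norm L (fun t => (phi0 t)^-1)%R f <= K%:E * Lambda1_norm L xi f.
Proof.
rewrite /Lambda1_norm -leb_integralZl.
- apply: leb_le_integral; first exact: measurable_ival.
  + by apply: meas_funM; [exact: meas_rearrangement|exact: meas_xi].
  + apply: meas_funM; first exact: meas_fun_cst.
    by apply: meas_funM; [exact: meas_rearrangement|exact: meas_inv_phi].
  + by move=> x Ix; rewrite mule_ge0 ?rearrangement_ge0 ?lee_fin ?invr_ge0 ?(ltW (phi0_gt0 Ix)).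
  + by move=> x Ix; rewrite muleCA -EFinM lee_wpmul2l ?rearrangement_ge0 ?lee_fin ?inv_phi0_le.
- exact: measurable_ival.
- by apply: meas_funM; [exact: meas_rearrangement|exact: meas_inv_phi].
- by move=> x Ix; rewrite mule_ge0 ?rearrangement_ge0 ?lee_fin ?invr_ge0 ?(ltW (phi_gt0 Ix)).
- exact: ltW.
Qed.

Context {c : R}.
Hypothesis avg : forall t, I t -> P0 t <= (c * (t * (phi0 t)^-1))%:E.
Local Notation psi := (fun t : R => t%:E / P t).

(** The factors t cancel: psi(t) f^**(t) is the integral of f^* over (0, t) divided by that of xi.
    The averaging condition makes the denominator finite. *)
Lemma Mpsi_term f t : I t -> exists2 p : R, [/\ (0 < p)%R, P t = p%:E,
    p%:E <= (K * c * (t * (phi0 t)^-1))%:E & P0 t <= (K * p)%:E] &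
  psi t * max_rearrangement L f t = (p^-1)%:E * \int[leb]_(s in ival t%:E) f^* s.
Proof.
move=> It; have [t0 tL] := It.
have PK := primitive_le It.
have Pc : P t <= (K * c * (t * (phi0 t)^-1))%:E.
  by apply: le_trans PK _; rewrite -mulrA EFinM lee_wpmul2l ?lee_fin ?(ltW K0)// avg.
have P0t := le_primitive It.
have P00 : 0 < P0 t.
  apply: lt_le_trans (xi_le_prefix phi0_gt0 phi0_nd It).
  by rewrite lte_fin mulr_gt0 ?invr_gt0 ?phi0_gt0.
case E : (P t) Pc P0t => [p| |] // Pc P0t; last first.
  by move: (lt_le_trans P00 P0t); rewrite gt0_muleNy ?lte_fin.
have p0 : (0 < p)%R.
  by have := lt_le_trans P00 P0t; rewrite -EFinM lte_fin pmulr_rgt0.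
exists p; first by rewrite -E; split => //; rewrite ?E ?EFinM.
rewrite /max_rearrangement itv_ival inver gt_eqF// -EFinM muleA -EFinM.
by congr (_ %:E * _); rewrite mulrAC divff ?mul1r ?gt_eqF.
Qed.

Lemma Mpsi_ge0 f : 0 <= Mpsi_norm L psi f.
Proof.
have [t It] := ival_nonempty L0.
apply: (@le_trans _ _ (psi t * max_rearrangement L f t)); last first.
  by apply: ereal_sup_ubound; exists t.
have [p [p0 _ _ _] ->] := Mpsi_term f It; rewrite mule_ge0//.
  by rewrite lee_fin invr_ge0 ltW.
by apply: integral_ge0 => x _; exact: rearrangement_ge0.
Qed.

Lemma weak_le_Mpsi f : weak_norm L phi0 f <= (K * c)%:E * Mpsi_norm L psi f.
Proof.
have c0 : (0 < c)%R by apply: lt_le_trans (avg_ge1 L0 phi0_gt0 phi0_nd avg).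
apply: ge_ereal_sup => _ [t It <-]; have [t0 tL] := It.
apply: (@le_trans _ _ ((K * c)%:E * (psi t * max_rearrangement L f t))); last first.
  rewrite lee_wpmul2l ?lee_fin ?mulr_ge0 ?(ltW K0) ?(ltW c0)//.
  by apply: ereal_sup_ubound; exists t.
have [p [p0 _ pc _] ->] := Mpsi_term f It.
apply: (@le_trans _ _ ((K * c)%:E * ((p^-1)%:E * (t%:E * f^* t)))); last first.
  rewrite !lee_wpmul2l ?lee_fin ?invr_ge0 ?mulr_ge0 ?(ltW K0) ?(ltW p0) ?(ltW c0)//.
  exact: mul_rearrangement_le_prefix.
rewrite !muleA -!EFinM lee_wpmul2r ?rearrangement_ge0// lee_fin mulrAC ler_pdivlMr//.
by rewrite mulrC -ler_pdivlMr ?phi0_gt0// -mulrA.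
Qed.

Lemma Mpsi_le_weak f : Mpsi_norm L psi f <= K%:E * weak_norm L phi0 f.
Proof.
apply: ge_ereal_sup => _ [t It <-]; have [t0 tL] := It.
have [p [p0 _ _ P0p] ->] := Mpsi_term f It.
have := weak_norm_ge0 L0 phi0_gt0 f; case E : (weak_norm L phi0 f) => [M| |]// M0; last first.
  by rewrite gt0_muley ?lte_fin// leey.
rewrite lee_pdivrMl//.
apply: (@le_trans _ _ (M%:E * P0 t)); last first.
  rewrite [leRHS](_ : _ = M%:E * (K * p)%:E); first by rewrite lee_wpmul2l.
  by rewrite -!EFinM; congr (_%:E); ring.
have mx := meas_funS (ltW tL) (meas_xi phi0_gt0 phi0_nd).
rewrite -leb_integralZl//.
- apply: leb_le_integral; first exact: measurable_ival.
  + exact: (meas_funS (ltW tL) (meas_rearrangement f)).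
  + by apply: meas_funM; [exact: meas_fun_cst|exact: mx].
  + by move=> x _; exact: rearrangement_ge0.
  + move=> x /(ivalS (ltW tL)) Ix; rewrite muleC -E.
    exact: (rearrangement_le_weak phi0_gt0).
- exact: measurable_ival.
- by move=> x /(ivalS (ltW tL)) Ix; exact: (xi_ge0 phi0_gt0).
Qed.

End equivalent_weight.

(** * Stability of the interpolation property under equivalent norms of the couple *)

Section interpolation_equivalent.
Context {R : realType} {L : \bar R}.
Implicit Types (N : functional R) (f : R -> \bar R).

(** Unlike [embeds], this includes nonmeasurable functions: in [bounded_on] the image T f is not
    assumed to be measurable. *)
Definition dominates N N' := exists C : R, (0 < C)%R /\ forall f, N' f <= C%:E * N f.

Lemma dominates_embeds N N' : dominates N N' -> embeds L N N'.
Proof. by move=> [C [C0 CP]]; exists C; split. Qed.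

Lemma embeds_trans N N' N'' : embeds L N N' -> embeds L N' N'' -> embeds L N N''.
Proof.
move=> [C [C0 CP]] [C' [C'0 C'P]]; exists (C' * C)%R; split; first by rewrite mulr_gt0.
move=> f mf; apply: le_trans (C'P f mf) _; rewrite EFinM -muleA.
by rewrite lee_wpmul2l ?lee_fin ?(ltW C'0)//; exact: CP.
Qed.

Lemma dominates_cap N0 N1 N0' N1' : (forall f, 0 <= N0 f) -> (forall f, 0 <= N1 f) ->
  dominates N0 N0' -> dominates N1 N1' -> dominates (cap_norm N0 N1) (cap_norm N0' N1').
Proof.
move=> p0 p1 [C [C0 CP]] [C' [C'0 C'P]]; exists (Num.max C C'); split.
  by rewrite lt_max C0.
move=> f; rewrite /cap_norm ge_max; apply/andP; split.
  apply: le_trans (CP f) _; apply: lee_pmul => //; rewrite ?lee_fin ?(ltW C0)//.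
    by rewrite le_max lexx.
  by rewrite le_max lexx.
apply: le_trans (C'P f) _; apply: lee_pmul => //; rewrite ?lee_fin ?(ltW C'0)//.
  by rewrite le_max lexx orbT.
by rewrite le_max lexx orbT.
Qed.

Lemma dominates_sum N0 N1 N0' N1' : (forall f, 0 <= N0 f) -> (forall f, 0 <= N1 f) ->
  dominates N0 N0' -> dominates N1 N1' ->
  dominates (sum_norm L N0 N1) (sum_norm L N0' N1').
Proof.
move=> p0 p1 [C [C0 CP]] [C' [C'0 C'P]].
have m0 : (0 < Num.max C C')%R by rewrite lt_max C0.
exists (Num.max C C'); split => // f.
rewrite -lee_pdivrMl//; apply: le_ereal_inf_tmp => _ [[g h] [mg mh fgh] <-] /=.
rewrite lee_pdivrMl//; apply: le_trans (ereal_inf_lbound _) _.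
  by exists (g, h).
rewrite muleDr// ?ge0_adde_def ?inE//; apply: leeD => /=.
  apply: le_trans (CP g) _; apply: lee_pmul => //; rewrite ?lee_fin ?(ltW C0)//.
  by rewrite le_max lexx.
apply: le_trans (C'P h) _; apply: lee_pmul => //; rewrite ?lee_fin ?(ltW C'0)//.
by rewrite le_max lexx orbT.
Qed.

Lemma dominates_fspace N N' f : dominates N N' -> fspace L N f -> fspace L N' f.
Proof.
move=> [C [C0 CP]] [mf Nf]; split => //; apply: le_lt_trans (CP f) _.
by rewrite lte_mul_pinfty// lee_fin ltW.
Qed.

Lemma dominates_bounded N N' T : dominates N N' -> dominates N' N ->
  bounded_on L N T -> bounded_on L N' T.
Proof.
move=> [C [C0 CP]] [C' [C'0 C'P]] [B [B0 BP]]; exists (C * B * C')%R; split.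
  by rewrite !mulr_gt0.
move=> f mf; apply: le_trans (CP _) _; rewrite !EFinM -!muleA.
rewrite lee_wpmul2l ?lee_fin ?(ltW C0)//; apply: le_trans (BP f mf) _.
by rewrite lee_wpmul2l ?lee_fin ?(ltW B0)//; exact: C'P.
Qed.

Lemma interpolation_equivalent N0 N1 N0' N1' N :
  (forall f, 0 <= N0 f) -> (forall f, 0 <= N1 f) ->
  (forall f, 0 <= N0' f) -> (forall f, 0 <= N1' f) ->
  dominates N0 N0' -> dominates N0' N0 -> dominates N1 N1' -> dominates N1' N1 ->
  interpolation L N0 N1 N -> interpolation L N0' N1' N.
Proof.
move=> p0 p1 p0' p1' d0 d0' d1 d1' [[e1 e2] ad]; split.
  split; first exact: embeds_trans (dominates_embeds (dominates_cap p0' p1' d0' d1')) e1.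
  exact: embeds_trans e2 (dominates_embeds (dominates_sum p0 p1 d0 d1)).
move=> T [lT b0 b1]; apply: ad; split.
- rewrite (_ : fspace L (sum_norm L N0 N1) = fspace L (sum_norm L N0' N1'))//.
  apply/funext => f; apply/propext; split; apply: dominates_fspace.
    exact: dominates_sum.
  exact: dominates_sum.
- exact: dominates_bounded b0.
- exact: dominates_bounded b1.
Qed.

End interpolation_equivalent.

(** * The couples and the truncation of a function *)

Section couple_norms.
Context {R : realType} {L : \bar R}.
Implicit Types (f g h : R -> \bar R) (a : R).
Local Notation I := (ival L).
Local Notation D := (distribution_fun L).
Local Notation "f ^*" := (rearrangement L f).
Hypothesis L0 : 0 < L.

Lemma L1_normE f : L1_norm L f = \int[leb]_(x in I) `|f x|.
Proof.
rewrite /L1_norm Lnorm1 [RHS]integral_mkcond; apply: eq_integral => x _.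
by rewrite !patchE; case: ifPn => //; rewrite abse0.
Qed.

Lemma L1_norm_rearrangement f : meas_fun L f -> L1_norm L f = \int[leb]_(x in I) f^* x.
Proof.
move=> mf; rewrite L1_normE.
have := integral_excess L0 mf (lexx 0%R).
by under eq_integral do rewrite sube0 max_l//; under [X in _ = X -> _]eq_integral do rewrite sube0 max_l ?rearrangement_ge0//.
Qed.

Lemma L1_norm_ge0 f : 0 <= L1_norm L f.
Proof. by rewrite L1_normE; apply: integral_ge0. Qed.

Lemma leb_setT_gt0 : 0 < leb [set: R].
Proof.
apply: (lt_le_trans L0); rewrite -[leLHS](leb_ival (ltW L0)); apply: leb_le => //.
  exact: measurable_ival.
exact: (@measurableT _ (lebesgue_line R)).
Qed.

Lemma Linfty_normE f : Linfty_norm L f = ess_sup leb (abse \o (f \_ I)).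
Proof. by rewrite /Linfty_norm unlock; case: ifPn => //; rewrite leb_setT_gt0. Qed.

Lemma Linfty_norm_ge0 f : 0 <= Linfty_norm L f.
Proof. exact: Lnorm_ge0. Qed.

Lemma Linfty_leP f (B : \bar R) : 0 <= B ->
  Linfty_norm L f <= B <-> {ae leb, forall x, I x -> `|f x| <= B}.
Proof.
move=> B0; rewrite Linfty_normE; split.
  move=> /ess_supP[Z [mZ Z0 PZ]]; exists Z; split => // x /= nx; apply: PZ => /= xB.
  by apply: nx => Ix; move: xB; rewrite patchE mem_set.
move=> [Z [mZ Z0 PZ]]; apply/ess_supP; exists Z; split => // x /= nx; apply: PZ => /= xB.
apply: nx; rewrite patchE; case: ifPn => [/set_mem/xB//|_].
by rewrite abse0.
Qed.

Lemma Linfty_norm0 : Linfty_norm L (fun=> 0) = 0.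
Proof.
apply/eqP; rewrite eq_le Linfty_norm_ge0 andbT; apply/Linfty_leP => //.
by apply: aeW => x _; rewrite abse0.
Qed.

Lemma rearrangement_le_Linfty f t : meas_fun L f -> (0 <= t)%R -> f^* t <= Linfty_norm L f.
Proof.
move=> mf t0; have := Linfty_norm_ge0 f; case E : (Linfty_norm L f) => [b| |]// b0; last first.
  by rewrite leey.
apply: rearrangement_le => //.
have /Linfty_leP[|Z [mZ Z0 PZ]] : Linfty_norm L f <= b%:E by rewrite E.
  by [].
apply: (@le_trans _ _ (leb Z)); last by rewrite [leb Z]Z0 lee_fin.
apply: leb_le => //; first exact: measurable_superlevel_abs.
move=> x [Ix bx]; apply: PZ => /= h; move: bx; rewrite ltNge.
by rewrite (h Ix).
Qed.

End couple_norms.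

Section truncation.
Context {R : realType} {L : \bar R}.
Implicit Types (f g h : R -> \bar R) (a l : R).
Local Notation I := (ival L).
Local Notation D := (distribution_fun L).
Local Notation "f ^*" := (rearrangement L f).
Hypothesis L0 : 0 < L.

Definition truncation l f (x : R) : \bar R := maxe (- l%:E) (mine (f x) l%:E).

Definition excess l f (x : R) : \bar R := f x - truncation l f x.

Lemma real_truncation (y l : R) : (0 <= l)%R ->
  [/\ (`|Num.max (- l) (Num.min y l)| <= l)%R, (`|Num.max (- l) (Num.min y l)| <= `|y|)%R &
      (`|y - Num.max (- l) (Num.min y l)| = Num.max (`|y| - l) 0)%R].
Proof.
move=> l0; have nl : (- l <= l)%R by rewrite ge0_cp.
have [yl|yl] := leP y l.
  have [ly|ly] := leP (- l)%R y.
    have yn : (`|y| <= l)%R by rewrite ler_norml ly.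
    by rewrite subrr normr0 max_r// subr_le0.
  have y0 : (y <= 0)%R by rewrite (le_trans (ltW ly))// oppr_le0.
  rewrite normrN (ger0_norm l0) (ler0_norm y0) opprK max_l ?subr_ge0; last by rewrite lerNr ltW.
  have yl0 : (y + l <= 0)%R by rewrite -lerBrDr sub0r ltW.
  by rewrite (ler0_norm yl0) opprD lexx lerNr ltW.
have y0 : (0 <= y)%R := le_trans l0 (ltW yl).
rewrite (max_r nl) (ger0_norm l0) (ger0_norm y0) lexx (ltW yl) ger0_norm ?subr_ge0 ?(ltW yl)//.
by rewrite max_l// subr_ge0 ltW.
Qed.

Lemma truncation_fin_num l f x : truncation l f x \is a fin_num.
Proof.
rewrite /truncation -EFinN; case: (f x) => [y| |]; first by rewrite -EFin_min -EFin_max.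
  by rewrite min_r ?leey// -EFin_max.
by rewrite min_l ?leNye// max_l ?leNye.
Qed.

Lemma truncation_le l f x : (0 <= l)%R -> `|truncation l f x| <= l%:E.
Proof.
move=> l0; have nl : (- l <= l)%R by rewrite ge0_cp.
rewrite /truncation -EFinN; case: (f x) => [y| |].
- by rewrite -EFin_min -EFin_max abse_EFin lee_fin; case: (real_truncation y l0).
- by rewrite min_r ?leey// -EFin_max max_r// abse_EFin lee_fin ger0_norm.
- by rewrite min_l ?leNye// max_l ?leNye// abse_EFin lee_fin normrN ger0_norm.
Qed.

Lemma truncation_le_abs l f x : (0 <= l)%R -> `|truncation l f x| <= `|f x|.
Proof.
move=> l0; have := truncation_le f x l0; rewrite /truncation -EFinN.
case: (f x) => [y| |] h; rewrite ?leey//.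
by rewrite -EFin_min -EFin_max !abse_EFin lee_fin; case: (real_truncation y l0).
Qed.

Lemma abs_excess l f x : (0 <= l)%R -> `|excess l f x| = maxe (`|f x| - l%:E) 0.
Proof.
move=> l0; rewrite /excess; have := truncation_fin_num l f x; rewrite /truncation -EFinN.
case: (f x) => [y| |] h.
- rewrite -EFin_min -EFin_max -[_ - _]EFinB !abse_EFin -[_ + _]EFinD -EFin_max.
  by case: (real_truncation y l0) => _ _ ->.
- by rewrite min_r ?leey// -EFin_max/= max_l// leey.
- by rewrite min_l ?leNye// max_l ?leNye//= max_l// leey.
Qed.

(** An exact identity, even where f is infinite, because the truncation is finite everywhere. *)
Lemma excess_truncation l f : f = excess l f \+ truncation l f.
Proof. by apply/funext => x /=; rewrite /excess subeK// truncation_fin_num. Qed.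

Lemma meas_truncation l f : meas_fun L f -> meas_fun L (truncation l f).
Proof.
move=> mf; apply: meas_fun_max; first exact: meas_fun_cst.
by apply: meas_fun_min => //; exact: meas_fun_cst.
Qed.

Lemma meas_excess l f : meas_fun L f -> meas_fun L (excess l f).
Proof.
move=> mf; apply: (@emeasurable_funB _ (lebesgue_line R)) => //.
exact: meas_truncation.
Qed.

Lemma excess_le_abs l f x : (0 <= l)%R -> `|excess l f x| <= `|f x|.
Proof.
move=> l0; rewrite abs_excess// ge_max abse_ge0 andbT.
by rewrite leeBlDr// leeDl.
Qed.

Lemma rearrangement_excess_le l f t : meas_fun L f -> (0 <= l)%R ->
  (excess l f)^* t <= f^* t.
Proof.
move=> mf l0; apply: le_rearrangement => m m0; apply: le_distribution_fun => //.
  exact: meas_excess.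
by move=> x _; exact: excess_le_abs.
Qed.

Lemma rearrangement_truncation_le l f t : meas_fun L f -> (0 <= l)%R -> 
  (truncation l f)^* t <= f^* t.
Proof.
move=> mf l0; apply: le_rearrangement => m m0; apply: le_distribution_fun => //.
  exact: meas_truncation.
by move=> x _; exact: truncation_le_abs.
Qed.

Lemma Linfty_truncation l f : (0 <= l)%R -> Linfty_norm L (truncation l f) <= l%:E.
Proof.
move=> l0; apply/(Linfty_leP L0); first by rewrite lee_fin.
by apply: aeW => x _; exact: truncation_le.
Qed.

(** The excess over f^*(a) is nonzero only where |f| > f^*(a), a set of measure at most a. *)
Lemma rearrangement_excess_eq0 f a l t : meas_fun L f -> I a -> f^* a = l%:E ->
  (a <= t)%R -> (excess l f)^* t = 0.
Proof.
move=> mf Ia fa at_; have l0 : (0 <= l)%R by rewrite -lee_fin -fa rearrangement_ge0.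
apply/eqP; rewrite eq_le rearrangement_ge0 andbT.
apply: rearrangement_le => //; first exact: meas_excess.
apply: (@le_trans _ _ (D f l)).
  apply: leb_le.
  - by apply: measurable_superlevel_abs; exact: meas_excess.
  - exact: measurable_superlevel_abs.
  - move=> x [Ix]; rewrite abs_excess// lt_max ltxx orbF => h; split => //.
    by move: h; rewrite sube_gt0.
apply: (@le_trans _ _ a%:E); last by rewrite lee_fin.
by rewrite leNgt -rearrangement_gt// fa ltxx.
Qed.

Lemma L1_excess_le f a l : meas_fun L f -> I a -> f^* a = l%:E ->
  L1_norm L (excess l f) <= \int[leb]_(x in ival a%:E) f^* x.
Proof.
move=> mf Ia fa; have l0 : (0 <= l)%R by rewrite -lee_fin -fa rearrangement_ge0.
rewrite L1_normE; under eq_integral do rewrite abs_excess//.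
apply: le_trans (excess_le_prefix L0 mf Ia fa).
by rewrite leeDl// lee_fin mulr_ge0//; case: Ia => /ltW.
Qed.

Lemma Lambda_excess_le f a l (xi : R -> R) : meas_fun L f -> I a -> f^* a = l%:E ->
  meas_fun L (fun t => (xi t)%:E) -> (forall t, I t -> (0 <= xi t)%R) ->
  Lambda1_norm L xi (excess l f) <= \int[leb]_(x in ival a%:E) (f^* x * (xi x)%:E).
Proof.
move=> mf Ia fa mxi xi0; have [a0 aL] := Ia.
have l0 : (0 <= l)%R by rewrite -lee_fin -fa rearrangement_ge0.
rewrite -(integral_ival_indic _ (ltW aL)); apply: leb_le_integral; first exact: measurable_ival.
- by apply: meas_funM => //; exact: meas_rearrangement.
- apply: meas_funM; last exact: meas_indic.
  by apply: meas_funM => //; exact: meas_rearrangement.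
- by move=> x Ix; rewrite mule_ge0 ?rearrangement_ge0 ?lee_fin ?xi0.
move=> x Ix; have [xa|xa] := ltP x a.
  rewrite indicE mem_set ?mule1//; last by split; [case: Ix|rewrite lte_fin].
  by rewrite lee_wpmul2r ?lee_fin ?xi0// rearrangement_excess_le.
rewrite (rearrangement_excess_eq0 mf Ia fa xa) mul0e !mule_ge0 ?rearrangement_ge0 ?lee_fin ?xi0//.
Qed.

End truncation.

(** * Interpolation from the supremum operator *)

Section couple_facts.
Context {R : realType} {L : \bar R}.
Implicit Types (f g h k : R -> \bar R) (N : functional R) (a l t : R).
Local Notation I := (ival L).
Local Notation D := (distribution_fun L).
Local Notation "f ^*" := (rearrangement L f).
Hypothesis L0 : 0 < L.

Lemma sum_norm_le_left N0 N1 f : meas_fun L f -> N1 (fun=> 0) = 0 ->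
  sum_norm L N0 N1 f <= N0 f.
Proof.
move=> mf N10; apply: ereal_inf_lbound; exists (f, fun=> 0) => /=.
  split => //; first exact: meas_fun_cst.
  by apply: aeW => x _; rewrite /= adde0.
by rewrite N10 adde0.
Qed.

Lemma sum_norm_le_right N0 N1 f : meas_fun L f -> N0 (fun=> 0) = 0 ->
  sum_norm L N0 N1 f <= N1 f.
Proof.
move=> mf N00; apply: ereal_inf_lbound; exists (fun=> 0, f) => /=.
  split => //; first exact: meas_fun_cst.
  by apply: aeW => x _; rewrite /= add0e.
by rewrite N00 add0e.
Qed.

Lemma rearrangement0 t : (0 <= t)%R -> (fun=> 0)^* t = 0.
Proof.
move=> t0; apply/eqP; rewrite eq_le rearrangement_ge0 andbT.
have m0 : meas_fun L (fun=> 0) by exact: meas_fun_cst.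
apply: rearrangement_le => //; rewrite /distribution_fun (_ : [set s | _] = set0) ?measure0//.
by rewrite -subset0 => x [_]; rewrite abse0 ltxx.
Qed.

Lemma Lambda1_norm0 (xi : R -> R) : Lambda1_norm L xi (fun=> 0) = 0.
Proof.
by apply: integral0_eq => x [x0 _]; rewrite rearrangement0 ?mul0e// ltW.
Qed.

Lemma L1_norm0 : L1_norm L (fun=> 0) = 0.
Proof. by rewrite L1_normE integral0_eq// => x _; rewrite abse0. Qed.

Lemma weak_norm0 (phi : R -> R) : weak_norm L phi (fun=> 0) = 0.
Proof.
have [t It] := ival_nonempty L0.
rewrite /weak_norm (_ : [set _ | _ in _] = [set 0]) ?ereal_sup1//.
apply/seteqP; split => [_ [s [s0 _] <-]|_ ->] /=; first by rewrite rearrangement0 ?mule0// ltW.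
by exists t => //; case: It => t0 _; rewrite rearrangement0 ?mule0// ltW.
Qed.

(** If |h| <= b almost everywhere, then |f| > m + b forces |g| > m off a null set; take m =
    g^*(t). *)
Lemma rearrangement_add_Linfty f g h (b : R) t : meas_fun L f -> meas_fun L g ->
  (0 <= t)%R -> (0 <= b)%R -> ae_eq leb I f (g \+ h) -> Linfty_norm L h <= b%:E ->
  f^* t <= g^* t + b%:E.
Proof.
move=> mf mg t0 b0 fgh hb; have := @rearrangement_ge0 _ L g t.
case E : (g^* t) => [m| |]// m0; last by rewrite addye// leey.
rewrite lee_fin in m0; rewrite -EFinD; apply: rearrangement_le; rewrite ?addr_ge0//.
have gm : D g m <= t%:E by rewrite leNgt -rearrangement_gt// E ltxx.
apply: le_trans gm.
have bE : 0 <= b%:E by rewrite lee_fin.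
have /(Linfty_leP L0 h bE) hb' := hb.
have [Z [mZ Z0 PZ]] := leb_ae_and fgh hb'.
apply: (@le_trans _ _ (leb ([set s | I s /\ m%:E < `|g s|] `|` Z))).
  apply: leb_le; first exact: measurable_superlevel_abs.
    by apply: (@measurableU _ (lebesgue_line R)) => //; exact: measurable_superlevel_abs.
  move=> x [Ix fx]; have [Zx|nZ] := pselect (Z x); [by right|left; split => //].
  have [fE hxb] : f x = (g \+ h) x /\ `|h x| <= b%:E.
    by apply: contrapT => n; apply: nZ; apply: PZ => /= /(_ Ix).
  rewrite ltNge; apply/negP => gx; move: fx; rewrite ltNge => /negP; apply.
  rewrite fE /= EFinD; apply: le_trans (lee_abs_add _ _) _; exact: leeD.
apply: le_trans (measureU2 _ _ mZ) _; first exact: measurable_superlevel_abs.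
by rewrite [X in _ + X]Z0 adde0.
Qed.

(** Restricts norm estimates to functions with a positive real bound on the norm: the infinite case
    is trivial, and norm 0 is a limit of small bounds. *)
Lemma ereal_le_scale (x y : \bar R) (k : R) : 0 <= y -> (0 < k)%R ->
  (forall c : R, (0 < c)%R -> y <= c%:E -> x <= (k * c)%:E) -> x <= k%:E * y.
Proof.
case: y => [y| |]// y0 k0 H; last by rewrite gt0_muley ?lte_fin ?leey.
rewrite lee_fin in y0; rewrite -EFinM; have [y_gt0|] := ltP 0%R y; first exact: H.
move=> y_le0; have -> : y = 0%R by apply/eqP; rewrite eq_le y_le0.
rewrite mulr0; apply/lee_addgt0Pr => e e0; rewrite add0e.
have -> : e = (k * (e / k))%R by rewrite mulrC divfK// gt_eqF.
apply: H; first by rewrite divr_gt0.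
by rewrite lee_fin (le_trans y_le0)// divr_ge0// ltW.
Qed.

End couple_facts.

Section bounded_tail_op.
Context {R : realType} {L : \bar R} {phi : R -> R} {C : R} {N : functional R}.
Implicit Types (f g h : R -> \bar R) (a t : R) (T : (R -> \bar R) -> R -> \bar R).
Local Notation I := (ival L).
Local Notation D := (distribution_fun L).
Local Notation "f ^*" := (rearrangement L f).
Local Notation U := (tail_op L phi).
Local Notation H := (tail_sup L phi).
Local Notation M := (weak_norm L phi).
Local Notation xi := (fun t : R => (phi t)^-1)%R.
Local Notation Lam := (Lambda1_norm L xi).
Local Notation A := (assoc_norm L N).

Hypothesis L0 : 0 < L.
Hypothesis phi_gt0 : forall t, I t -> (0 < phi t)%R.
Hypothesis phi_nd : forall s t, I s -> I t -> (s <= t)%R -> (phi s <= phi t)%R.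
Hypothesis N_ri : ri_norm L N.
Hypothesis C0 : (0 < C)%R.
Hypothesis U_bounded : forall f, meas_fun L f -> A (U f) <= C%:E * A (fun x => `|f x|).

Let mxi : meas_fun L (fun t => (xi t)%:E) := meas_xi phi_gt0 phi_nd.
Let xi0 t : I t -> 0 <= (xi t)%:E := @xi_ge0 _ _ _ phi_gt0 t.
Let mU f : meas_fun L (U f) := meas_tail_op phi_gt0 phi_nd f.
Let U0 f t : I t -> 0 <= U f t := fun It => tail_op_ge0 phi_gt0 f It.

Lemma assoc_indic_lty (b : R) : (0 < b)%R -> b%:E <= L ->
  A (fun x => (\1_(ival b%:E) x)%:E) < +oo.
Proof.
move=> b0 bL; have lE : leb (ival b%:E) < +oo by rewrite leb_ival ?ltry// lee_fin ltW.
have [k [k0 kP]] := rin_local N_ri (@measurable_ival R b%:E) (ivalS bL) lE.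
apply: (@le_lt_trans _ _ k%:E); last exact: ltry.
apply: (assoc_ub N_ri); first exact: meas_indic.
  by move=> x _.
move=> w mw w0 Nw; under eq_integral do rewrite muleC.
rewrite integral_ival_indic//; apply: le_trans (kP w (nneg_of_ge0 mw w0)) _.
by rewrite -[leRHS]mule1 lee_wpmul2l// lee_fin ltW.
Qed.

Lemma rearrangement_indic_ge (b : R) t : b%:E <= L -> (0 <= t)%R -> (t < b)%R ->
  1 <= (fun x : R => (\1_(ival b%:E) x)%:E)^* t.
Proof.
move=> bL t0 tb; rewrite leNgt; apply/negP => lt1.
have := @rearrangement_ge0 _ L (fun x : R => (\1_(ival b%:E) x)%:E) t.
case E : (_^* t) lt1 => [m| |]//; rewrite lte_fin lee_fin => m1 m0.
have : ~~ (m%:E < (fun x : R => (\1_(ival b%:E) x)%:E)^* t) by rewrite E ltxx.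
rewrite rearrangement_gt//; last exact: meas_indic.
rewrite -leNgt /distribution_fun (_ : [set s | _] = ival b%:E).
  by rewrite leb_ival ?lee_fin ?(le_trans t0 (ltW tb))// leNgt tb.
apply/seteqP; split => x /=; rewrite indicE.
  move=> [Ix]; case: (boolP (x \in ival b%:E)) => [/set_mem//|_].
  by rewrite normr0 lte_fin ltNge m0.
move=> bx; rewrite mem_set// normr1 lte_fin; split => //.
exact: ivalS bx.
Qed.

(** Test the bound for U on the indicator of (0, b), which lies in X' by (P5). Its image is at least
    phi(b/2) xi on (0, b). The point b/2 is used because b may equal L, where phi carries no
    information. *)
Lemma assoc_xi_prefix_lty (b : R) : (0 < b)%R -> b%:E <= L ->
  A (fun x => (xi x)%:E * (\1_(ival b%:E) x)%:E) < +oo.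
Proof.
move=> b0 bL; pose one (x : R) : \bar R := (\1_(ival b%:E) x)%:E.
have m1 : meas_fun L one by exact: meas_indic.
have a0 : (0 < b / 2)%R by rewrite divr_gt0.
have ab : (b / 2 < b)%R by rewrite ltr_pdivrMr// ltr_pMr// ltr1n.
have Ia : I (b / 2)%R by split => //; apply: lt_le_trans bL; rewrite lte_fin.
have pa := phi_gt0 Ia.
apply: (@le_lt_trans _ _ ((phi (b / 2))^-1%:E * A (U one))).
  apply: (@le_trans _ _ (A (fun x => (phi (b / 2))^-1%:E * U one x))); last first.
    by apply: (assocZ N_ri) => //; [exact: U0|rewrite invr_ge0 ltW].
  apply: (assoc_le N_ri).
  - by apply: meas_funM.
  - by apply: meas_funM => //; exact: meas_fun_cst.
  - by move=> x Ix; rewrite mule_ge0 ?xi0 ?lee_fin.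
  move=> x Ix; rewrite indicE; case: (boolP (x \in ival b%:E)) => [/set_mem[x0 xb]|_]; last first.
    by rewrite mule0 mule_ge0 ?U0 ?lee_fin ?invr_ge0 ?(ltW pa).
  rewrite lte_fin in xb; rewrite mule1 /tail_op muleCA -[leLHS]mule1 lee_wpmul2l ?xi0//.
  (* A point of [x, b) at which phi is at least phi(b/2) and the rearranged indicator is still 1. *)
  rewrite lee_pdivlMl//; pose s := Num.max x (b / 2)%R.
  have sb : (s < b)%R by rewrite gt_max xb.
  have Is : I s.
    split; first by rewrite lt_max x0.
    by apply: lt_le_trans bL; rewrite lte_fin.
  have xs : (x <= s)%R by rewrite le_max lexx.
  apply: le_trans (le_tail_sup _ Is xs); rewrite mule1.
  apply: (@le_trans _ _ ((phi s)%:E * 1)).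
    by rewrite mule1 lee_fin phi_nd// le_max lexx orbT.
  by rewrite lee_wpmul2l ?lee_fin ?(ltW (phi_gt0 Is))//; apply: rearrangement_indic_ge => //; case: Is => /ltW.
have := assoc_indic_lty b0 bL; rewrite -/one => A1.
have Aone : A (fun x => `|one x|) < +oo.
  by rewrite (_ : (fun x => _) = one)//; apply/funext => x; rewrite gee0_abs// lee_fin.
apply: (@le_lt_trans _ _ (((phi (b / 2))^-1)%:E * (C%:E * A (fun x => `|one x|)))).
  by rewrite lee_wpmul2l ?lee_fin ?invr_ge0 ?(ltW pa)//; exact: U_bounded.
by rewrite !lte_mul_pinfty// ?lee_fin ?invr_ge0 ?(ltW pa) ?(ltW C0) ?mule_ge0 ?(assoc_ge0 N_ri)//.
Qed.

(** Since H g(a) = phi(a) U g(a) and U g is nonincreasing, a U g(a) is at most the integral of U g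
    over (0, a), which the norm of U g in X' controls. *)
Lemma tail_sup_point_le a : I a -> exists2 k : R, (0 < k)%R & forall g, meas_fun L g ->
  H g a <= k%:E * A (fun x => `|g x|).
Proof.
move=> Ia; have [a0 aL] := Ia; have pa := phi_gt0 Ia.
have [k k0 kP] := assoc_prefix N_ri (ltW aL).
exists (phi a / a * (k * C))%R; first by rewrite !mulr_gt0 ?invr_gt0.
move=> g mg; have -> : H g a = (phi a)%:E * U g a.
  by rewrite muleA [_%:E * _%:E]muleC (phi_xi phi_gt0 Ia) mul1e.
rewrite !EFinM -!muleA lee_wpmul2l ?lee_fin ?(ltW pa)//.
rewrite lee_pdivlMl//; apply: (@le_trans _ _ (\int[leb]_(x in ival a%:E) U g x)).
  by apply: (@mul_le_prefix R L) => // [t|s t]; [exact: U0|exact: tail_op_nonincr].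
apply: le_trans (kP _ (mU g) (U0 g)) _.
by rewrite lee_wpmul2l ?lee_fin ?(ltW k0)//; exact: U_bounded.
Qed.

(** By duality it suffices to bound the integral of f^* g^* for g in the unit ball of X'. To the
    left of a, f^* is bounded by the norm in L^oo and g^* is integrable; to the right, g^* <= xi H
    g(a), and the norm in Lambda^1_xi takes over. *)
Lemma embeds_cap_Lambda_Linfty : embeds L (cap_norm Lam (Linfty_norm L)) (ext_norm N).
Proof.
have [a Ia] := ival_nonempty L0; have [a0 aL] := Ia; have aL' := ltW aL.
have [k k0 kP] := assoc_prefix N_ri aL'; have [k' k'0 k'P] := tail_sup_point_le Ia.
exists (k + k')%R; split; first by rewrite addr_gt0.
move=> f mf; have m0 : 0 <= cap_norm Lam (Linfty_norm L) f.
  by rewrite le_max Linfty_norm_ge0 orbT.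
apply: ereal_le_scale => //; first by rewrite addr_gt0.
move=> m m_gt0; rewrite ge_max => /andP[Lm im].
apply: (norm_dual_le L0 N_ri) => //; first by rewrite mulr_ge0 ?ltW// addr_gt0.
move=> g mg g0 Ag; rewrite mulrDl EFinD.
have mgs : meas_fun L g^* := meas_rearrangement g.
have mfs : meas_fun L f^* := meas_rearrangement f.
have Ag' : A (fun x => `|g x|) <= 1.
  by rewrite (_ : (fun x => _) = g)//; apply/funext => x; rewrite gee0_abs.
rewrite [leLHS](_ : _ = \int[leb]_(x in I) (`|f x| * `|g x|)); last first.
  by apply: eq_integral => x _; rewrite [`|g x|]gee0_abs.
apply: le_trans (hardy_littlewood L0 mf mg) _.
have Hk : H g a <= k'%:E.
  by apply: le_trans (k'P g mg) _; rewrite -[leRHS]mule1 lee_wpmul2l// lee_fin ltW.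
have H0 : 0 <= H g a := tail_sup_ge0 phi_gt0 g Ia.
apply: (@le_trans _ _ (\int[leb]_(x in I) ((m%:E * (g^* x * (\1_(ival a%:E) x)%:E)) +
    k'%:E * (f^* x * (xi x)%:E)))).
  have m1 : meas_fun L (fun x => m%:E * (g^* x * (\1_(ival a%:E) x)%:E)).
    by apply: meas_funM; [exact: meas_fun_cst|apply: meas_funM => //; exact: meas_indic].
  have m2 : meas_fun L (fun x => k'%:E * (f^* x * (xi x)%:E)).
    by apply: meas_funM; [exact: meas_fun_cst|exact: meas_funM].
  apply: leb_le_integral; first exact: measurable_ival.
  - exact: meas_funM.
  - exact: meas_funD.
  - by move=> x _; rewrite mule_ge0 ?rearrangement_ge0.
  move=> x Ix; have [x0 xL] := Ix; have [xa|ax] := ltP x a.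
    rewrite indicE mem_set ?mule1//; apply: (@le_trans _ _ (m%:E * g^* x)).
      rewrite lee_wpmul2r ?rearrangement_ge0//; apply: le_trans im.
      exact: (rearrangement_le_Linfty L0 mf (ltW x0)).
    by rewrite leeDl// !mule_ge0 ?rearrangement_ge0 ?xi0 ?lee_fin ?(ltW k'0).
  apply: (@le_trans _ _ (k'%:E * (f^* x * (xi x)%:E))); last first.
    by rewrite leeDr// !mule_ge0 ?rearrangement_ge0 ?lee_fin ?(ltW m_gt0).
  rewrite muleCA lee_wpmul2l ?rearrangement_ge0//.
  rewrite -[leLHS]mul1e -(phi_xi phi_gt0 Ix) -muleA [leRHS]muleC lee_wpmul2l ?xi0//.
  by apply: le_trans Hk; exact: le_tail_sup.
rewrite leb_integralD//; last 5 first.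
- exact: measurable_ival.
- by apply: meas_funM; [exact: meas_fun_cst|apply: meas_funM => //; exact: meas_indic].
- by apply: meas_funM; [exact: meas_fun_cst|exact: meas_funM].
- by move=> x _; rewrite !mule_ge0 ?rearrangement_ge0 ?lee_fin ?(ltW m_gt0).
- by move=> x Ix; rewrite !mule_ge0 ?rearrangement_ge0 ?xi0 ?lee_fin ?(ltW k'0).
apply: leeD.
  rewrite leb_integralZl; last 4 first.
  - exact: measurable_ival.
  - by apply: meas_funM => //; exact: meas_indic.
  - by move=> x _; rewrite mule_ge0 ?rearrangement_ge0.
  - exact: ltW.
  rewrite integral_ival_indic// mulrC EFinM lee_wpmul2l ?lee_fin ?(ltW m_gt0)//.
  have rg0 x : I x -> 0 <= g^* x by move=> _; exact: rearrangement_ge0.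
  apply: (le_trans (kP _ mgs rg0)); apply: (@le_trans _ _ (k%:E * 1)); last by rewrite mule1.
  apply: lee_wpmul2l; first by rewrite lee_fin ltW.
  exact: (le_trans (assoc_rearrangement L0 N_ri mg)).
rewrite leb_integralZl; last 4 first.
- exact: measurable_ival.
- exact: meas_funM.
- by move=> x Ix; rewrite mule_ge0 ?rearrangement_ge0 ?xi0.
- exact: ltW.
by rewrite EFinM lee_wpmul2l ?lee_fin ?(ltW k'0).
Qed.

(** Cut f at the height f^*(a). The excess is controlled in Lambda^1_xi because xi restricted to (0,
    a) lies in X'. The truncation is bounded by f^*(a), which is at most the mean of f^* over (0,
    a), controlled by (P5). *)
Lemma embeds_sum_Lambda_Linfty : embeds L (ext_norm N) (sum_norm L Lam (Linfty_norm L)).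
Proof.
have [a Ia] := ival_nonempty L0; have [a0 aL] := Ia; have aL' := ltW aL.
have := assoc_xi_prefix_lty a0 aL'; set h := (fun x => _).
have Ah0 := assoc_ge0 N_ri h; have [k k0 kP] := norm_prefix L0 N_ri a0 aL'.
case Ah : (A h) Ah0 => [m| |]// m0 _; rewrite lee_fin in m0.
have m1 : (0 < m + 1)%R by rewrite ltr_wpDl.
exists (m + 1 + k / a)%R; split; first by rewrite addr_gt0// divr_gt0.
move=> f mf; apply: ereal_le_scale; first exact: (rin_ge0 N_ri) (nneg_of_ge0 (meas_fun_abs mf) (fun=> abse_ge0 _)).
  by rewrite addr_gt0// divr_gt0.
move=> b b0 Nb.
have fk : f^* a <= (k / a * b)%:E.
  rewrite (_ : k / a * b = a^-1 * (k * b))%R; last by rewrite mulrA mulrC [(_^-1 * _)%R]mulrC mulrC.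
  rewrite EFinM lee_pdivlMl//.
  apply: le_trans (mul_rearrangement_le_prefix f Ia) _; apply: le_trans (kP f mf) _.
  by rewrite EFinM lee_wpmul2l// lee_fin ltW.
have := @rearrangement_ge0 _ L f a; case E : (f^* a) fk => [l| |]// fk l0.
rewrite [X in sum_norm _ _ _ X](excess_truncation l f).
rewrite lee_fin in l0.
apply: le_trans (ereal_inf_lbound _) _.
  exists (excess l f, truncation l f) => //=; split => //=.
  - exact: meas_excess.
  - exact: meas_truncation.
  - exact: aeW.
rewrite mulrDl EFinD; apply: leeD; last first.
  by apply: le_trans fk; exact: Linfty_truncation.
apply: le_trans (Lambda_excess_le mf Ia E mxi _) _; first by move=> t It; exact: (xi0 It).
rewrite -(integral_ival_indic _ aL').
apply: (@le_trans _ _ (\int[leb]_(x in I) (h x * f^* x))).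
  rewrite le_eqVlt; apply/orP; left; apply/eqP; apply: eq_integral => x _.
  by rewrite -muleA muleC.
rewrite mulrC EFinM; apply: (@le_trans _ _ (b%:E * A h)).
  apply: (assoc_holder N_ri) => //.
  - by apply: meas_funM => //; exact: meas_indic.
  - by move=> x Ix; rewrite mule_ge0 ?xi0.
  - exact: meas_rearrangement.
  - by move=> x; exact: rearrangement_ge0.
  - by rewrite (norm_rearrangement_abs L0 N_ri).
by rewrite Ah lee_wpmul2l ?lee_fin ?(ltW b0)// lerDl.
Qed.

(** Cut f at l = f^*(a). The excess contributes through the bound on Lambda^1_xi. The truncation is
    mapped to a function bounded by a multiple of l, and l <= f^* on (0, a), so the integral of l xi
    is dominated as well. *)
Lemma Lambda_Linfty_prefix_le T : admissible L Lam (Linfty_norm L) T ->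
  exists2 k : R, (0 < k)%R & forall f a, fspace L (sum_norm L Lam (Linfty_norm L)) f -> I a ->
    \int[leb]_(x in ival a%:E) ((T f)^* x * (xi x)%:E) <=
    k%:E * \int[leb]_(x in ival a%:E) (f^* x * (xi x)%:E).
Proof.
move=> [lT [k0 [k00 k0P]] [k1 [k10 k1P]]]; exists (k0 + k1)%R; first by rewrite addr_gt0.
move=> f a Vf Ia; have [mf _] := Vf; have [a0 aL] := Ia; have aL' := ltW aL.
set J := \int[leb]_(x in ival a%:E) (f^* x * (xi x)%:E).
have J0 : 0 <= J.
  by apply: integral_ge0 => x /(ivalS aL') Ix; rewrite mule_ge0 ?rearrangement_ge0 ?xi0.
have [->|Jfin] := eqVneq J +oo; first by rewrite gt0_muley ?leey// lte_fin addr_gt0.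
have fa : f^* a < +oo.
  rewrite ltNge leye_eq; apply/negP => /eqP fa; case/eqP: Jfin; apply/eqP; rewrite -leye_eq.
  have fx0 t : I t -> 0 <= f^* t * (xi t)%:E by move=> It; rewrite mule_ge0 ?rearrangement_ge0 ?xi0.
  have nfx s t : I s -> I t -> (s <= t)%R -> f^* t * (xi t)%:E <= f^* s * (xi s)%:E.
    move=> Is It st; apply: lee_pmul; rewrite ?rearrangement_ge0 ?xi0//.
      exact: rearrangement_nonincr.
    by rewrite lee_fin; exact: (xi_nonincr phi_gt0 phi_nd).
  have := mul_le_prefix fx0 nfx Ia.
  by rewrite fa gt0_mulye ?lte_fin ?invr_gt0 ?phi_gt0// gt0_muley ?lte_fin.
have := @rearrangement_ge0 _ L f a; case E : (f^* a) fa => [l| |]// _ l0.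
rewrite lee_fin in l0.
have Lex := Lambda_excess_le mf Ia E mxi (fun t It => xi0 It).
have m1 := meas_excess l mf; have m2 := meas_truncation l mf.
have V1 : fspace L (sum_norm L Lam (Linfty_norm L)) (excess l f).
  split => //; apply: le_lt_trans (sum_norm_le_left _ m1 (Linfty_norm0 L0)) _.
  by apply: le_lt_trans Lex _; rewrite ltey.
have V2 : fspace L (sum_norm L Lam (Linfty_norm L)) (truncation l f).
  split => //; apply: le_lt_trans (sum_norm_le_right _ m2 (Lambda1_norm0 _)) _.
  by apply: le_lt_trans (Linfty_truncation L0 f l0) _; exact: ltry.
have [mT1 _] := linop_stable lT V1; have [mT _] := linop_stable lT Vf.
have TE : ae_eq leb I (T f) (T (excess l f) \+ T (truncation l f)).
  by rewrite {1}(excess_truncation l f); exact: (linopD lT).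
have k1l : Linfty_norm L (T (truncation l f)) <= (k1 * l)%:E.
  apply: le_trans (k1P _ m2) _; rewrite EFinM lee_wpmul2l ?lee_fin ?(ltW k10)//.
  exact: Linfty_truncation.
have k1l0 : (0 <= k1 * l)%R by rewrite mulr_ge0// ltW.
apply: (@le_trans _ _ (\int[leb]_(x in ival a%:E)
    ((T (excess l f))^* x * (xi x)%:E + (k1 * l)%:E * (xi x)%:E))).
  apply: leb_le_integral; first exact: measurable_ival.
  - apply: (meas_funS aL'); apply: meas_funM => //; exact: meas_rearrangement.
  - apply: (meas_funS aL'); apply: meas_funD; apply: meas_funM => //.
      exact: meas_rearrangement.
    exact: meas_fun_cst.
  - by move=> x /(ivalS aL') Ix; rewrite mule_ge0 ?rearrangement_ge0 ?xi0.
  move=> x /(ivalS aL') Ix; rewrite -muleDl ?ge0_adde_def ?inE ?rearrangement_ge0//.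
  rewrite lee_wpmul2r ?xi0//; case: (Ix) => x0 _.
  exact: (rearrangement_add_Linfty L0 mT mT1 (ltW x0) k1l0 TE k1l).
rewrite leb_integralD; last 5 first.
- exact: measurable_ival.
- by apply: (meas_funS aL'); apply: meas_funM => //; exact: meas_rearrangement.
- by apply: (meas_funS aL'); apply: meas_funM => //; exact: meas_fun_cst.
- by move=> x /(ivalS aL') Ix; rewrite mule_ge0 ?rearrangement_ge0 ?xi0.
- by move=> x /(ivalS aL') Ix; rewrite mule_ge0 ?xi0 ?lee_fin.
rewrite [(k0 + k1)%:E]EFinD ge0_muleDl ?lee_fin ?(ltW k00) ?(ltW k10)//; apply: leeD.
  apply: (@le_trans _ _ (Lam (T (excess l f)))).
    apply: leb_subset_integral.
    - exact: measurable_ival.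
    - exact: measurable_ival.
    - by apply: meas_funM => //; exact: meas_rearrangement.
    - by move=> x Ix; rewrite mule_ge0 ?rearrangement_ge0 ?xi0.
    - exact: ivalS.
  by apply: le_trans (k0P _ m1) _; rewrite lee_wpmul2l ?lee_fin ?(ltW k00).
rewrite leb_integralZl; last 4 first.
- exact: measurable_ival.
- exact: meas_funS mxi.
- by move=> x /(ivalS aL'); exact: xi0.
- exact: k1l0.
rewrite EFinM -muleA lee_wpmul2l ?lee_fin ?(ltW k10)// -leb_integralZl; last 4 first.
- exact: measurable_ival.
- exact: meas_funS mxi.
- by move=> x /(ivalS aL'); exact: xi0.
- exact: l0.
apply: leb_le_integral; first exact: measurable_ival.
- by apply: (meas_funS aL'); apply: meas_funM => //; exact: meas_fun_cst.
- by apply: (meas_funS aL'); apply: meas_funM => //; exact: meas_rearrangement.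
- by move=> x /(ivalS aL') Ix; rewrite mule_ge0 ?xi0 ?lee_fin.
move=> x xa; have Ix := ivalS aL' xa; rewrite lee_wpmul2r ?xi0// -E.
by apply: rearrangement_nonincr; case: xa => _; rewrite lte_fin => /ltW.
Qed.

Lemma integral_mul_le_tail_op f g : meas_fun L f -> meas_fun L g -> (forall x, 0 <= g x) ->
  forall (u : R -> \bar R) (k : R), meas_fun L u -> (0 <= k)%R ->
  (forall a, I a -> \int[leb]_(x in ival a%:E) (u^* x * (xi x)%:E) <=
    k%:E * \int[leb]_(x in ival a%:E) (f^* x * (xi x)%:E)) ->
  \int[leb]_(x in I) (`|u x| * g x) <= k%:E * \int[leb]_(x in I) (U g x * f^* x).
Proof.
move=> mf mg g0 u k mu k0 uf.
have mus : meas_fun L u^* := meas_rearrangement u.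
have mfs : meas_fun L f^* := meas_rearrangement f.
have mgs : meas_fun L g^* := meas_rearrangement g.
have mH : meas_fun L (H g) by apply: nonincreasing_meas_fun => s t _ _; exact: tail_sup_nonincr.
have H0 x : I x -> 0 <= H g x := fun Ix => tail_sup_ge0 phi_gt0 g Ix.
rewrite [leLHS](_ : _ = \int[leb]_(x in I) (`|u x| * `|g x|)); last first.
  by apply: eq_integral => x _; rewrite [`|g x|]gee0_abs.
apply: le_trans (hardy_littlewood L0 mu mg) _.
apply: (@le_trans _ _ (\int[leb]_(x in I) ((u^* x * (xi x)%:E) * H g x))).
  apply: leb_le_integral; first exact: measurable_ival.
  - exact: meas_funM.
  - by apply: meas_funM => //; exact: meas_funM.
  - by move=> x _; rewrite mule_ge0 ?rearrangement_ge0.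
  - move=> x Ix; rewrite -muleA; apply: lee_wpmul2l; first exact: rearrangement_ge0.
    exact: (le_tail_op phi_gt0).
have mfx : meas_fun L (fun x => f^* x * (xi x)%:E) by exact: meas_funM.
have fx0 x : I x -> 0 <= f^* x * (xi x)%:E by move=> Ix; rewrite mule_ge0 ?rearrangement_ge0 ?xi0.
apply: (@le_trans _ _ (\int[leb]_(x in I) ((k%:E * (f^* x * (xi x)%:E)) * H g x))).
  apply: hardy.
  - exact: L0.
  - exact: meas_funM.
  - by apply: meas_funM => //; exact: meas_fun_cst.
  - by move=> x Ix; rewrite mule_ge0 ?rearrangement_ge0 ?xi0.
  - by move=> x Ix; rewrite mule_ge0 ?fx0.
  - exact: H0.
  - by move=> s t _ _; exact: tail_sup_nonincr.
  move=> a Ia; have [_ /ltW aL] := Ia.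
  rewrite leb_integralZl; [exact: uf|exact: measurable_ival|exact: meas_funS mfx| |exact: k0].
  by move=> x /(ivalS aL); exact: fx0.
rewrite le_eqVlt; apply/orP; left; apply/eqP; rewrite -leb_integralZl.
- apply: eq_integral => x _; rewrite /tail_op -!muleA; congr (_ * _).
  by rewrite muleCA; congr (_ * _); rewrite muleC.
- exact: measurable_ival.
- exact: meas_funM.
- by move=> x Ix; rewrite mule_ge0 ?rearrangement_ge0 ?U0.
- exact: k0.
Qed.

Lemma interpolation_Lambda_Linfty :
  interpolation L Lam (Linfty_norm L) (ext_norm N).
Proof.
split; first by split; [exact: embeds_cap_Lambda_Linfty|exact: embeds_sum_Lambda_Linfty].
move=> T adT; have [lT _ _] := adT; have [k k0 kP] := Lambda_Linfty_prefix_le adT.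
exists (k * C)%R; split; first by rewrite mulr_gt0.
move=> f mf; apply: ereal_le_scale.
- exact: (rin_ge0 N_ri) (nneg_of_ge0 (meas_fun_abs mf) (fun=> abse_ge0 _)).
- by rewrite mulr_gt0.
move=> b b0 Nb.
have Vf : fspace L (sum_norm L Lam (Linfty_norm L)) f.
  split => //; have [e [e0 eP]] := embeds_sum_Lambda_Linfty.
  apply: le_lt_trans (eP f mf) _; apply: (@le_lt_trans _ _ (e%:E * b%:E)).
    by rewrite lee_wpmul2l ?lee_fin ?(ltW e0).
  exact: ltry.
have [mT _] := linop_stable lT Vf.
apply: (norm_dual_le L0 N_ri) => //; first by rewrite !mulr_ge0// ltW.
move=> g mg g0 Ag.
apply: le_trans (integral_mul_le_tail_op mf mg g0 mT (ltW k0) (fun a Ia => kP f a Vf Ia)) _.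
rewrite -mulrA EFinM; apply: lee_wpmul2l; first by rewrite lee_fin ltW.
apply: (@le_trans _ _ (b%:E * A (U g))).
  apply: (assoc_holder N_ri) => //.
  - by move=> x Ix; exact: U0.
  - exact: meas_rearrangement.
  - by move=> x; exact: rearrangement_ge0.
  - by rewrite (norm_rearrangement_abs L0 N_ri).
rewrite mulrC EFinM; apply: lee_wpmul2l; first by rewrite lee_fin ltW.
apply: (le_trans (U_bounded mg)); apply: (@le_trans _ _ (C%:E * 1)); last by rewrite mule1.
apply: lee_wpmul2l; first by rewrite lee_fin ltW.
by rewrite (_ : (fun x => _) = g)//; apply/funext => x; rewrite gee0_abs.
Qed.

(** * Interpolation between L^1 and the weak space on a bounded interval *)

Section finite_length.
Hypothesis Lfin : L < +oo.

Let l := fine L.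
Let lE : l%:E = L.
Proof. by rewrite fineK// ge0_fin_numE// ltW. Qed.
Let l0 : (0 < l)%R.
Proof. by rewrite -lte_fin lE. Qed.

(** A bound on the weak norm means that f^* is at most a multiple of xi, and xi lies in X' because
    the interval is bounded: [assoc_xi_prefix_lty] is applied with b = L. *)
Lemma embeds_cap_L1_weak : embeds L (cap_norm (L1_norm L) M) (ext_norm A).
Proof.
have lL : l%:E <= L by rewrite lE.
have := assoc_xi_prefix_lty l0 lL.
rewrite [A _](@assoc_eq _ _ _ _ (fun x => (xi x)%:E)); last first.
  by move=> x Ix; rewrite indicE mem_set ?mule1// lE.
have Ax0 := assoc_ge0 N_ri (fun x => (xi x)%:E).
case Ax : (A _) Ax0 => [m| |]// m0 _; rewrite lee_fin in m0.
have m1 : (0 < m + 1)%R by rewrite ltr_wpDl.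
exists (m + 1)%R; split => // f mf.
apply: ereal_le_scale => //; first by rewrite le_max L1_norm_ge0.
move=> b b0; rewrite ge_max => /andP[_ Mb].
apply: (@le_trans _ _ (b%:E * A (fun x => (xi x)%:E))); last first.
  by rewrite Ax -EFinM lee_fin mulrC ler_wpM2r ?(ltW b0)// lerDl.
apply: (assoc_hardy_littlewood_polya L0 N_ri) => //; first exact: ltW.
  by move=> s t Is It st; rewrite lee_fin; exact: (xi_nonincr phi_gt0 phi_nd).
move=> a Ia; have [_ /ltW aL] := Ia; rewrite -leb_integralZl.
- apply: leb_le_integral; first exact: measurable_ival.
  + exact: meas_funS (meas_rearrangement f).
  + by apply: (meas_funS aL); apply: meas_funM => //; exact: meas_fun_cst.
  + by move=> x _; exact: rearrangement_ge0.
  + move=> x /(ivalS aL) Ix; apply: le_trans (rearrangement_le_weak phi_gt0 f Ix) _.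
    by rewrite muleC; apply: lee_wpmul2r => //; exact: xi0.
- exact: measurable_ival.
- exact: meas_funS mxi.
- by move=> x /(ivalS aL); exact: xi0.
- exact: ltW.
Qed.

(** The indicator of the whole bounded interval lies in X by (P4), so X' is contained in L^1. *)
Lemma embeds_sum_L1_weak : embeds L (ext_norm A) (sum_norm L (L1_norm L) M).
Proof.
have lL : l%:E <= L by rewrite lE.
have [k k0 kP] := assoc_prefix N_ri lL; rewrite lE in kP.
exists k; split => // f mf; apply: le_trans (sum_norm_le_left _ mf (weak_norm0 L0 _)) _.
rewrite L1_normE; exact: (kP _ (meas_fun_abs mf) (fun x _ => abse_ge0 _)).
Qed.

(** For s <= a the truncation contributes at most phi(a) f^*(a), as phi is nondecreasing; beyond a
    its rearrangement is at most f^*. Both bounds are terms of the supremum H f(a). *)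
Lemma weak_truncation_le f a (m : R) : meas_fun L f -> I a -> f^* a = m%:E ->
  M (truncation m f) <= H f a.
Proof.
move=> mf Ia fa; have m0 : (0 <= m)%R by rewrite -lee_fin -fa rearrangement_ge0.
have mt := meas_truncation m mf.
apply: ge_ereal_sup => _ [s Is <-]; have [sa|as_] := leP s a.
  apply: (@le_trans _ _ ((phi a)%:E * f^* a)); last exact: le_tail_sup.
  apply: lee_pmul; rewrite ?rearrangement_ge0 ?lee_fin ?(ltW (phi_gt0 Is)) ?phi_nd// fa.
  apply: le_trans (Linfty_truncation L0 f m0); apply: (rearrangement_le_Linfty L0 mt).
  by case: Is => /ltW.
apply: le_trans (le_tail_sup f Is (ltW as_)).
apply: lee_wpmul2l; first by rewrite lee_fin ltW// phi_gt0.
exact: rearrangement_truncation_le.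
Qed.

(** H f is nonincreasing, so xi H f(a) <= U f on (0, a). If H f(a) is infinite, so is U f there. *)
Lemma tail_sup_le_prefix f a : I a ->
  H f a * \int[leb]_(x in ival a%:E) (xi x)%:E <= \int[leb]_(x in ival a%:E) U f x.
Proof.
move=> Ia; have [a0 /ltW aL] := Ia.
have xi_int : 0 <= \int[leb]_(x in ival a%:E) (xi x)%:E.
  by apply: integral_ge0 => x /(ivalS aL); exact: xi0.
have H0 := tail_sup_ge0 phi_gt0 f Ia.
have le_U x : ival a%:E x -> H f a * (xi x)%:E <= U f x.
  move=> xa; rewrite muleC; apply: lee_wpmul2l; first exact: xi0 (ivalS aL xa).
  by apply: tail_sup_nonincr; case: xa => _; rewrite lte_fin => /ltW.
case E : (H f a) H0 le_U => [b| |]// b0 le_U.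
  rewrite -leb_integralZl.
  - apply: leb_le_integral; first exact: measurable_ival.
    + by apply: (meas_funS aL); apply: meas_funM => //; exact: meas_fun_cst.
    + exact: (meas_funS aL).
    + by move=> x /(ivalS aL) Ix; rewrite mule_ge0 ?xi0.
    + exact: le_U.
  - exact: measurable_ival.
  - exact: meas_funS mxi.
  - by move=> x /(ivalS aL); exact: xi0.
  - by rewrite -lee_fin.
apply: (@le_trans _ _ (\int[leb]_(x in ival a%:E) +oo)).
  rewrite leb_integral_cst; last exact: measurable_ival.
  by rewrite leb_ival ?lee_fin ?(ltW a0)// [+oo * a%:E]gt0_mulye ?lte_fin// leey.
apply: leb_le_integral; first exact: measurable_ival.
- exact: meas_fun_cst.
- exact: (meas_funS aL).
- by move=> x _; exact: leey.
move=> x xa; apply: le_trans (le_U x xa); rewrite gt0_mulye// lte_fin.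
exact: (xi_gt0 phi_gt0 (ivalS aL xa)).
Qed.

(** Cut f at f^*(a). The excess has L^1 norm at most the integral of f^*, hence of U f, over (0, a);
    the truncation has weak norm at most H f(a), and H f(a) xi integrates to at most the integral of
    U f. The images of the pieces are recombined by subadditivity of the integral of the
    rearrangement. *)
Lemma L1_weak_prefix_le T : admissible L (L1_norm L) M T ->
  exists2 k : R, (0 < k)%R & forall f a, fspace L (sum_norm L (L1_norm L) M) f -> I a ->
    \int[leb]_(x in ival a%:E) (T f)^* x <= k%:E * \int[leb]_(x in ival a%:E) U f x.
Proof.
move=> [lT [k0 [k00 k0P]] [k1 [k10 k1P]]]; exists (k0 + k1)%R; first by rewrite addr_gt0.
move=> f a Vf Ia; have [mf _] := Vf; have [a0 aL] := Ia; have aL' := ltW aL.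
set J := \int[leb]_(x in ival a%:E) U f x.
have [->|Jfin] := eqVneq J +oo; first by rewrite gt0_muley ?leey// lte_fin addr_gt0.
have Jlt : J < +oo by rewrite ltey.
have fJ : \int[leb]_(x in ival a%:E) f^* x <= J.
  apply: leb_le_integral; first exact: measurable_ival.
  - exact: meas_funS (meas_rearrangement f).
  - exact: (meas_funS aL').
  - by move=> x _; exact: rearrangement_ge0.
  - by move=> x /(ivalS aL') Ix; exact: (le_tail_op phi_gt0).
have HJ := tail_sup_le_prefix f Ia; rewrite -/J in HJ.
have P0 : 0 < \int[leb]_(x in ival a%:E) (xi x)%:E.
  apply: lt_le_trans (xi_le_prefix phi_gt0 phi_nd Ia).
  by rewrite lte_fin mulr_gt0// (xi_gt0 phi_gt0).
(* Only a finite right-hand side matters. It forces H f(a) and f^*(a) to be finite, so that the cut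
   is possible and both pieces lie in the sum space. *)
have Hfin : H f a < +oo.
  rewrite ltNge leye_eq; apply/negP => /eqP Hf; move: (le_lt_trans HJ Jlt).
  by rewrite Hf gt0_mulye.
have fa : f^* a < +oo.
  have := le_lt_trans (le_trans (mul_rearrangement_le_prefix f Ia) fJ) Jlt.
  by case: (f^* a) => [r| |]; rewrite ?ltry ?ltNyr// gt0_muley ?lte_fin.
have := @rearrangement_ge0 _ L f a; case E : (f^* a) fa => [m| |]// _ m0.
rewrite lee_fin in m0.
have Lex := L1_excess_le L0 mf Ia E; have Mtr := weak_truncation_le mf Ia E.
have m1 := meas_excess m mf; have m2 := meas_truncation m mf.
have V1 : fspace L (sum_norm L (L1_norm L) M) (excess m f).
  split => //; apply: le_lt_trans (sum_norm_le_left _ m1 (weak_norm0 L0 _)) _.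
  exact: le_lt_trans (le_trans Lex fJ) Jlt.
have V2 : fspace L (sum_norm L (L1_norm L) M) (truncation m f).
  split => //; apply: le_lt_trans (sum_norm_le_right _ m2 (@L1_norm0 R L)) _.
  exact: le_lt_trans Mtr Hfin.
have [mT1 _] := linop_stable lT V1; have [mT2 _] := linop_stable lT V2.
have [mT _] := linop_stable lT Vf.
have TE : ae_eq leb I (T f) (T (excess m f) \+ T (truncation m f)).
  by rewrite {1}(excess_truncation m f); exact: (linopD lT).
have TEs t : (T f)^* t <= (T (excess m f) \+ T (truncation m f))^* t.
  apply: le_rearrangement => b b0; apply: ae_le_distribution_fun => //.
    exact: meas_funD.
  by apply: leb_ae_imp TE => x _ ->.
apply: (@le_trans _ _ (\int[leb]_(x in ival a%:E) (T (excess m f) \+ T (truncation m f))^* x)).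
  apply: leb_le_integral; first exact: measurable_ival.
  - exact: meas_funS (meas_rearrangement _).
  - exact: meas_funS (meas_rearrangement _).
  - by move=> x _; exact: rearrangement_ge0.
  - by move=> x _.
apply: le_trans (prefix_rearrangementD L0 mT1 mT2 Ia) _.
have J0 : 0 <= J by apply: integral_ge0 => x /(ivalS aL'); exact: U0.
rewrite [(k0 + k1)%:E]EFinD ge0_muleDl ?lee_fin ?(ltW k00) ?(ltW k10)//; apply: leeD.
  apply: (@le_trans _ _ (L1_norm L (T (excess m f)))).
    rewrite (L1_norm_rearrangement L0 mT1); apply: leb_subset_integral.
    - exact: measurable_ival.
    - exact: measurable_ival.
    - exact: meas_rearrangement.
    - by move=> x Ix; exact: rearrangement_ge0.
    - exact: ivalS.
  apply: le_trans (k0P _ m1) _; apply: lee_wpmul2l; first by rewrite lee_fin ltW.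
  exact: le_trans fJ.
have MT : M (T (truncation m f)) <= k1%:E * H f a.
  by apply: le_trans (k1P _ m2) _; apply: lee_wpmul2l => //; rewrite lee_fin ltW.
have H0 := tail_sup_ge0 phi_gt0 f Ia.
case EH : (H f a) Hfin H0 HJ MT => [b| |]// _; rewrite lee_fin => b0 HJ MT.
apply: le_trans (lee_wpmul2l _ HJ); last by rewrite lee_fin ltW.
rewrite muleA -EFinM in MT *; rewrite -leb_integralZl.
- apply: leb_le_integral; first exact: measurable_ival.
  + exact: meas_funS (meas_rearrangement _).
  + by apply: (meas_funS aL'); apply: meas_funM => //; exact: meas_fun_cst.
  + by move=> x _; exact: rearrangement_ge0.
  + move=> x /(ivalS aL') Ix; apply: le_trans (rearrangement_le_weak phi_gt0 _ Ix) _.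
    by rewrite muleC; apply: lee_wpmul2r => //; exact: xi0.
- exact: measurable_ival.
- exact: meas_funS mxi.
- by move=> x /(ivalS aL'); exact: xi0.
- by rewrite mulr_ge0// ltW.
Qed.

Lemma interpolation_L1_weak : interpolation L (L1_norm L) M (ext_norm A).
Proof.
split; first by split; [exact: embeds_cap_L1_weak|exact: embeds_sum_L1_weak].
move=> T adT; have [lT _ _] := adT; have [k k0 kP] := L1_weak_prefix_le adT.
exists (k * C)%R; split; first by rewrite mulr_gt0.
move=> f mf; have [Af|] := eqVneq (A (fun x => `|f x|)) +oo.
  by rewrite /ext_norm Af gt0_muley ?leey// lte_fin mulr_gt0.
move=> Afin; have Vf : fspace L (sum_norm L (L1_norm L) M) f.
  split => //; have [e [e0 eP]] := embeds_sum_L1_weak.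
  apply: le_lt_trans (eP f mf) _; rewrite lte_mul_pinfty ?lee_fin ?(ltW e0)//.
  by rewrite /ext_norm ltey.
have [mT _] := linop_stable lT Vf.
apply: (@le_trans _ _ (k%:E * A (U f))).
  apply: (assoc_hardy_littlewood_polya L0 N_ri) => //; first exact: ltW.
  - exact: U0.
  - by move=> s t Is It; exact: tail_op_nonincr.
  - by move=> a Ia; exact: kP.
by rewrite EFinM -muleA; apply: lee_wpmul2l; [rewrite lee_fin ltW|exact: U_bounded].
Qed.

End finite_length.

End bounded_tail_op.

(** * Positive integral operators *)

Definition kernel_op (R : realType) (L : \bar R) (K : R -> R -> R) (g : R -> \bar R)
    (t : R) : \bar R :=
  \int[leb]_(x in ival L) ((K t x)%:E * g x).

Section kernel_operator.
Context {R : realType} {L : \bar R} {K : R -> R -> R}.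
Implicit Types (f g h : R -> \bar R) (t x : R) (N : functional R).
Local Notation I := (ival L).
Local Notation T := (kernel_op L K).

Hypothesis K_ge0 : forall t x, I t -> I x -> (0 <= K t x)%R.
Hypothesis mK : forall t, I t -> meas_fun L (fun x : R => (K t x)%:E).
(** No joint measurability of the kernel is assumed, so measurability of the image is a hypothesis;
    the block kernels satisfy it by explicit formulas. *)
Hypothesis mT_ge0 : forall g, meas_fun L g -> (forall x, 0 <= g x) -> meas_fun L (T g).

Lemma pmule_maxe0 (k : R) (y : \bar R) : (0 <= k)%R ->
  maxe (k%:E * y) 0 = k%:E * maxe y 0.
Proof.
move=> k0; have [y0|y0] := leP y 0.
  by rewrite mule0 max_r// mule_ge0_le0.
by rewrite max_l// mule_ge0 ?lee_fin// ltW.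
Qed.

Lemma pmuleD (k : R) (y z : \bar R) : (0 <= k)%R -> k%:E * (y + z) = k%:E * y + k%:E * z.
Proof.
rewrite le_eqVlt => /predU1P[<-|k0]; first by rewrite !mul0e adde0.
case: y => [y| |]; case: z => [z| |];
  rewrite ?(gt0_muley, gt0_muleNy, addeNy, addNye, addey, addye, lte_fin)// -?EFinD -?EFinM -?EFinD ?mulrDr//.
Qed.

Lemma kernel_op_ge0 g t : I t -> (forall x, I x -> 0 <= g x) -> 0 <= T g t.
Proof.
by move=> It g0; apply: integral_ge0 => x Ix; rewrite mule_ge0 ?lee_fin ?K_ge0 ?g0.
Qed.

Lemma meas_kernel_mul g t : I t -> meas_fun L g -> meas_fun L (fun x => (K t x)%:E * g x).
Proof. by move=> It mg; apply: meas_funM => //; exact: mK. Qed.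

Lemma kernel_op_le f g t : I t -> meas_fun L f -> meas_fun L g ->
  (forall x, I x -> 0 <= f x) -> (forall x, I x -> f x <= g x) -> T f t <= T g t.
Proof.
move=> It mf mg f0 fg; apply: leb_le_integral; first exact: measurable_ival.
- exact: meas_kernel_mul.
- exact: meas_kernel_mul.
- by move=> x Ix; rewrite mule_ge0 ?lee_fin ?K_ge0 ?f0.
- by move=> x Ix; apply: lee_wpmul2l; [rewrite lee_fin K_ge0|exact: fg].
Qed.

Lemma abs_kernel_op g t : I t -> meas_fun L g -> `|T g t| <= T (fun x => `|g x|) t.
Proof.
move=> It mg; apply: le_trans (le_abse_integral leb (@measurable_ival R L) (meas_kernel_mul It mg)) _.
rewrite le_eqVlt; apply/orP; left; apply/eqP; apply: eq_integral => x /set_mem Ix.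
by rewrite abseM gee0_abs// lee_fin K_ge0.
Qed.

Lemma meas_kernel_op g : meas_fun L g -> meas_fun L (T g).
Proof.
move=> mg; have mp : meas_fun L (fun x => maxe (g x) 0).
  by apply: meas_fun_max => //; exact: meas_fun_cst.
have mn : meas_fun L (fun x => maxe (- g x) 0).
  apply: meas_fun_max; last exact: meas_fun_cst.
  exact: (@measurableT_comp _ _ _ (lebesgue_line R) _ _ oppe).
apply: (@eq_measurable_fun _ _ (lebesgue_line R) _ _
    (fun t => T (fun x => maxe (g x) 0) t - T (fun x => maxe (- g x) 0) t)).
  move=> t /set_mem It; rewrite [RHS]integralE; congr (_ - _).
    by apply: eq_integral => x /set_mem Ix; rewrite funeposE pmule_maxe0// K_ge0.
  by apply: eq_integral => x /set_mem Ix; rewrite funenegE -muleN pmule_maxe0// K_ge0.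
by apply: (@emeasurable_funB _ (lebesgue_line R)); apply: mT_ge0 => // x; rewrite le_max lexx orbT.
Qed.

Lemma L1_kernel_op_le (B : R) : (0 < B)%R ->
  (forall v, meas_fun L v -> (forall x, 0 <= v x) ->
    \int[leb]_(t in I) T v t <= B%:E * \int[leb]_(x in I) v x) ->
  bounded_on L (L1_norm L) T.
Proof.
move=> B0 BP; exists B; split => // f mf; rewrite !L1_normE.
apply: le_trans (BP _ (meas_fun_abs mf) (fun=> abse_ge0 _)).
apply: leb_le_integral; first exact: measurable_ival.
- by apply: meas_fun_abs; exact: meas_kernel_op.
- by apply: mT_ge0; [exact: meas_fun_abs|move=> x; exact: abse_ge0].
- by move=> x _; exact: abse_ge0.
- by move=> t It; exact: abs_kernel_op.
Qed.

Lemma kernel_op_abs_le_Linfty (B : R) f t : 0 < L -> (0 < B)%R -> meas_fun L f -> I t ->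
  \int[leb]_(x in I) (K t x)%:E <= B%:E ->
  T (fun x => `|f x|) t <= B%:E * Linfty_norm L f.
Proof.
move=> L0 B0 mf It BP.
have := Linfty_norm_ge0 (L := L) f; case E : (Linfty_norm L f) => [b| |]// b0; last first.
  by rewrite gt0_muley ?lte_fin// leey.
have /(Linfty_leP L0 f b0) fb : Linfty_norm L f <= b%:E by rewrite E.
apply: (@le_trans _ _ (\int[leb]_(x in I) (b%:E * (K t x)%:E))).
  apply: (@ae_ge0_le_integral _ (lebesgue_line R) R leb I (@measurable_ival R L)).
  - by move=> x Ix; rewrite mule_ge0 ?lee_fin ?K_ge0.
  - by apply: meas_kernel_mul => //; exact: meas_fun_abs.
  - by move=> x Ix; rewrite mule_ge0 ?lee_fin ?K_ge0.
  - by apply: meas_funM; [exact: meas_fun_cst|exact: mK].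
  - apply: leb_ae_imp fb => x Ix fxb; rewrite muleC.
    by apply: lee_wpmul2r => //; rewrite lee_fin K_ge0.
rewrite leb_integralZl.
- by rewrite muleC; apply: lee_wpmul2r.
- exact: measurable_ival.
- exact: mK.
- by move=> x Ix; rewrite lee_fin K_ge0.
- by rewrite -lee_fin.
Qed.

Lemma Linfty_kernel_op_le (B : R) : 0 < L -> (0 < B)%R ->
  (forall t, I t -> \int[leb]_(x in I) (K t x)%:E <= B%:E) ->
  bounded_on L (Linfty_norm L) T.
Proof.
move=> L0 B0 BP; exists B; split => // f mf.
have Bb : 0 <= B%:E * Linfty_norm L f by rewrite mule_ge0 ?Linfty_norm_ge0// lee_fin ltW.
apply/(Linfty_leP L0 _ Bb); apply: aeW => t It.
by apply: le_trans (abs_kernel_op It mf) _; apply: kernel_op_abs_le_Linfty => //; exact: BP.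
Qed.

(** The finiteness hypotheses make the integral defining T g(t) absolutely convergent at every t,
    for every g in the sum space. Hence T is additive pointwise, with no indeterminate differences,
    and the bounds on the two spaces carry over to their sum. *)
Lemma kernel_op_admissible N0 N1 : 0 < L -> N0 (fun=> 0) = 0 -> N1 (fun=> 0) = 0 ->
  (forall f, 0 <= N0 f) -> (forall f, 0 <= N1 f) ->
  bounded_on L N0 T -> bounded_on L N1 T ->
  (forall g t, meas_fun L g -> N0 g < +oo -> I t -> T (fun x => `|g x|) t < +oo) ->
  (forall g t, meas_fun L g -> N1 g < +oo -> I t -> T (fun x => `|g x|) t < +oo) ->
  admissible L N0 N1 T.
Proof.
move=> L0 N00 N10 N0p N1p b0 b1 fin0 fin1; split => //.
have mI := @measurable_ival R L.
have Tae f g t : I t -> meas_fun L f -> meas_fun L g -> ae_eq leb I f g -> T f t = T g t.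
  move=> It mf mg fg; apply: leb_ae_eq_integral => //; try exact: meas_kernel_mul.
  by apply: leb_ae_imp fg => x Ix ->.
have dec g : fspace L (sum_norm L N0 N1) g -> exists g1 g2, [/\ meas_fun L g1, meas_fun L g2,
    ae_eq leb I g (g1 \+ g2), N0 g1 < +oo & N1 g2 < +oo].
  move=> [mg /ereal_inf_lt[_ [[g1 g2] [mg1 mg2 gE] <-] /= Nlt]].
  exists g1, g2; split => //; apply: le_lt_trans Nlt; [exact: leeDl|exact: leeDr].
have fin g t : fspace L (sum_norm L N0 N1) g -> I t ->
    leb.-integrable I (fun x => (K t x)%:E * g x : \bar R).
  move=> Vg It; have [mg _] := Vg; have [g1 [g2 [m1 m2 gE n1 n2]]] := dec g Vg.
  apply/integrableP; split; first exact: meas_kernel_mul.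
  rewrite (_ : \int[leb]_(x in I) _ = T (fun x => `|g x|) t); last first.
    by apply: eq_integral => x /set_mem Ix; rewrite abseM [`|_%:E|]gee0_abs// lee_fin K_ge0.
  have m12 := meas_funD m1 m2.
  rewrite (Tae _ (fun x => `|(g1 \+ g2) x|) t It); last 3 first.
  - exact: meas_fun_abs.
  - exact: meas_fun_abs.
  - by apply: leb_ae_imp gE => x Ix ->.
  have ma1 := meas_fun_abs m1; have ma2 := meas_fun_abs m2.
  apply: (@le_lt_trans _ _ (T (fun x => `|g1 x| + `|g2 x|) t)).
    apply: kernel_op_le => //; first exact: meas_fun_abs.
      exact: meas_funD.
    by move=> x _; exact: lee_abs_add.
  rewrite /kernel_op; under eq_integral => x /set_mem Ix do rewrite (pmuleD _ _ (K_ge0 It Ix)).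
  rewrite leb_integralD//; try exact: meas_kernel_mul.
  - by apply: lte_add_pinfty; [exact: fin0|exact: fin1].
  - by move=> x Ix; rewrite mule_ge0 ?lee_fin ?K_ge0.
  - by move=> x Ix; rewrite mule_ge0 ?lee_fin ?K_ge0.
have TD f g t : I t -> fspace L (sum_norm L N0 N1) f -> fspace L (sum_norm L N0 N1) g ->
    T (f \+ g) t = T f t + T g t.
  move=> It Vf Vg; rewrite /kernel_op -(integralD mI (fin f t Vf It) (fin g t Vg It)).
  by apply: eq_integral => x /set_mem Ix; rewrite /= pmuleD// K_ge0.
split.
- move=> g Vg; have [mg _] := Vg; split; first exact: meas_kernel_op.
  have [g1 [g2 [m1 m2 gE n1 n2]]] := dec g Vg.
  have V1 : fspace L (sum_norm L N0 N1) g1.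
    by split => //; apply: le_lt_trans n1; exact: sum_norm_le_left.
  have V2 : fspace L (sum_norm L N0 N1) g2.
    by split => //; apply: le_lt_trans n2; exact: sum_norm_le_right.
  apply: (@le_lt_trans _ _ (N0 (T g1) + N1 (T g2))).
    apply: ereal_inf_lbound; exists (T g1, T g2) => //=; split => //=.
    + exact: meas_kernel_op.
    + exact: meas_kernel_op.
    + apply: aeW => t It; rewrite (Tae g (g1 \+ g2))//; last exact: meas_funD.
      exact: TD.
  have [B0 [B00 B0P]] := b0; have [B1 [B10 B1P]] := b1.
  apply: lte_add_pinfty.
    by apply: le_lt_trans (B0P _ m1) _; rewrite lte_mul_pinfty ?lee_fin ?(ltW B00).
  by apply: le_lt_trans (B1P _ m2) _; rewrite lte_mul_pinfty ?lee_fin ?(ltW B10).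
- by move=> f g [mf _] [mg _] fg; apply: aeW => t It; exact: Tae.
- by move=> f g Vf Vg; apply: aeW => t It; exact: TD.
- move=> a f Vf; apply: aeW => t It; rewrite /kernel_op -(integralZl mI (fin f t Vf It)).
  by apply: eq_integral => x _; rewrite muleCA.
Qed.

End kernel_operator.

(** * The block kernel and its transpose on the two couples *)

Section partition_kernel.
Context {R : realType} {L : \bar R} {phi : R -> R} {c c0 : R}.
Context {kappa : R -> nat} {s : nat -> R}.
Implicit Types (f g h u v : R -> \bar R) (t x : R).
Local Notation I := (ival L).
Local Notation "f ^*" := (rearrangement L f).
Local Notation xi := (fun t : R => (phi t)^-1)%R.
Local Notation M := (weak_norm L phi).
Local Notation Lam := (Lambda1_norm L xi).

Hypothesis L0 : 0 < L.
Hypothesis phi_gt0 : forall t, I t -> (0 < phi t)%R.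
Hypothesis phi_nd : forall s t, I s -> I t -> (s <= t)%R -> (phi s <= phi t)%R.
Hypothesis avg : forall t, I t ->
  \int[leb]_(s in ival t%:E) ((phi s)^-1)%:E <= (c * (t * (phi t)^-1))%:E.
Hypothesis mkappa : forall n, leb_measurable (I `&` [set t | kappa t = n]).
Hypothesis sI : forall n, I (s n).
Hypothesis c0_gt0 : (0 < c0)%R.
Hypothesis le_s : forall t, I t -> (t <= c0 * s (kappa t))%R.

Let mI := @measurable_ival R L.
Let mxi : meas_fun L (fun t => (xi t)%:E) := meas_xi phi_gt0 phi_nd.
Let xi_pos t : I t -> 0 <= (xi t)%:E := @xi_ge0 _ _ _ phi_gt0 t.
Let s_gt0 n : (0 < s n)%R := (sI n).1.
Let c_ge1 : (1 <= c)%R := avg_ge1 L0 phi_gt0 phi_nd avg.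
Let c_gt0 : (0 < c)%R := lt_le_trans ltr01 c_ge1.

Definition block n : set R := [set x : R | (s n / 2 < x)%R /\ (x < s n)%R].

(** This is phi(s) divided by the length s/2 of the block, so the operator averages over the block
    and multiplies by phi(s). On the block, x is comparable to s, and f^* is at least f^*(s). *)
Definition block_coef n : R := (2 * phi (s n) / s n)%R.

(* For s near the supremum of phi f^* over [t, L), the operator with this kernel maps
   f^* to at least phi(s) f^*(s) / phi(t). *)
Definition block_ker (t x : R) : R :=
  ((phi t)^-1 * (block_coef (kappa t) * \1_(block (kappa t)) x))%R.

Let J n : set R := I `&` [set t | kappa t = n].

Let trivJ : trivIset [set: nat] J.
Proof. by apply/trivIsetP => i j _ _ ij; rewrite -subset0 => t [[_ ti] [_ tj]]; move/eqP: ij; rewrite -ti -tj. Qed.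

Let cupJ : \bigcup_n J n = I.
Proof. by apply/seteqP; split => t; [case=> n _ []|move=> It; exists (kappa t)]. Qed.

Let JI n : J n `<=` I. Proof. by move=> t []. Qed.

Lemma block_sub n : block n `<=` I.
Proof.
move=> x [x1 x2]; split; first by apply: lt_trans x1; rewrite divr_gt0.
by apply: lt_trans (sI n).2; rewrite lte_fin.
Qed.

Lemma measurable_block n : leb_measurable (block n).
Proof.
rewrite (_ : block n = `](s n / 2)%R, s n[%classic).
  by apply: borel_leb_measurable; exact: measurable_itv.
by apply/seteqP; split => x /=; rewrite in_itv/=; [move=> [-> ->]|move=> /andP].
Qed.

Lemma leb_block n : leb (block n) = (s n / 2)%:E.
Proof.
rewrite (_ : block n = `](s n / 2)%R, s n[%classic); last first.
  by apply/seteqP; split => x /=; rewrite in_itv/=; [move=> [-> ->]|move=> /andP].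
rewrite -[LHS]/(lebesgue_measure `](s n / 2)%R, s n[%classic) lebesgue_measure_itv/=.
rewrite lte_fin ltr_pdivrMr// ltr_pMr// ltr1n -EFinD; congr (_%:E).
by rewrite {1}(splitr (s n)) addrK.
Qed.

Lemma block_coef_gt0 n : (0 < block_coef n)%R.
Proof. by rewrite divr_gt0// mulr_gt0// phi_gt0. Qed.

Lemma block_ker_ge0 t x : I t -> (0 <= block_ker t x)%R.
Proof.
move=> It; rewrite mulr_ge0//; first by have := xi_pos It; rewrite lee_fin.
by rewrite mulr_ge0// ltW// block_coef_gt0.
Qed.

(** The kernel depends on t only through phi(t) and the countably valued index [kappa];
    measurability in t is glued from the level sets of [kappa]. *)
Lemma meas_kappa (w : nat -> R -> \bar R) : (forall n, meas_fun L (w n)) ->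
  meas_fun L (fun t => w (kappa t) t).
Proof.
move=> mw _ Y mY.
rewrite (_ : I `&` _ = \bigcup_n (J n `&` (I `&` w n @^-1` Y))).
  apply: (@bigcupT_measurable _ (lebesgue_line R)) => n.
  by apply: (@measurableI _ (lebesgue_line R)); [exact: mkappa|exact: mw].
apply/seteqP; split => [t [It wY]|t [n _ [[It <-] [_ wY]]]//].
by exists (kappa t).
Qed.

Lemma integral_kappa (w : nat -> R -> \bar R) : (forall n, meas_fun L (w n)) ->
  (forall n t, I t -> 0 <= w n t) ->
  \int[leb]_(t in I) w (kappa t) t = \sum_(n <oo) \int[leb]_(t in J n) w n t.
Proof.
move=> mw w0; have mk : leb_measurable_fun (\bigcup_n J n) (fun t => w (kappa t) t).
  by rewrite cupJ; exact: meas_kappa.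
have k0 t : (\bigcup_n J n) t -> 0 <= w (kappa t) t by rewrite cupJ => It; exact: w0.
have := @ge0_integral_bigcup _ (lebesgue_line R) R leb J (fun t => w (kappa t) t) mkappa mk k0 trivJ.
rewrite cupJ => ->; apply: eq_eseriesr => n _.
by apply: eq_integral => t /set_mem[_ <-].
Qed.

Lemma meas_block_indic n : meas_fun L (fun x : R => (\1_(block n) x)%:E).
Proof.
apply: (@measurable_funTS _ _ (lebesgue_line R)).
apply/(@measurable_EFinP _ (lebesgue_line R)).
by apply: (@measurable_indic _ (lebesgue_line R)); exact: measurable_block.
Qed.

Lemma meas_block_ker t : meas_fun L (fun x : R => (block_ker t x)%:E).
Proof.
rewrite (_ : (fun x => _) = fun x => (((phi t)^-1)%:E * ((block_coef (kappa t))%:E * (\1_(block (kappa t)) x)%:E))).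
  apply: meas_funM; first exact: meas_fun_cst.
  by apply: meas_funM; [exact: meas_fun_cst|exact: meas_block_indic].
by apply/funext => x; rewrite -!EFinM.
Qed.

Let W n x t : \bar R := ((phi t)^-1)%:E * (block_coef n * \1_(block n) x)%:E.

Let mW n x : meas_fun L (W n x).
Proof. by apply: meas_funM => //; exact: meas_fun_cst. Qed.

Let W0 n x t : I t -> 0 <= W n x t.
Proof.
move=> It; rewrite mule_ge0 ?xi_pos// lee_fin mulr_ge0// ltW//.
exact: block_coef_gt0.
Qed.

Lemma meas_block_ker_swap x : meas_fun L (fun t : R => (block_ker t x)%:E).
Proof. exact: (meas_kappa (fun n => mW n x)). Qed.

Lemma block_kernel_op_coef g t : meas_fun L g -> (forall x, I x -> 0 <= g x) -> I t ->
  kernel_op L block_ker g t =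
  ((phi t)^-1)%:E * ((block_coef (kappa t))%:E * \int[leb]_(x in I) ((\1_(block (kappa t)) x)%:E * g x)).
Proof.
move=> mg g0 It; rewrite -!leb_integralZl//.
- by apply: eq_integral => x _; rewrite /block_ker !EFinM -!muleA.
- by apply: meas_funM; [exact: meas_fun_cst|apply: meas_funM => //; exact: meas_block_indic].
- by move=> x Ix; rewrite !mule_ge0 ?g0// lee_fin ltW// block_coef_gt0.
- by have := xi_pos It; rewrite lee_fin.
- by apply: meas_funM => //; exact: meas_block_indic.
- by move=> x Ix; rewrite mule_ge0 ?g0// lee_fin.
- by rewrite ltW// block_coef_gt0.
Qed.

Let V g n := \int[leb]_(x in I) ((\1_(block n) x)%:E * g x).
Let Q u n := \int[leb]_(t in J n) ((xi t)%:E * u t).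

Lemma meas_block_kernel_op_ge0 g : meas_fun L g -> (forall x, 0 <= g x) ->
  meas_fun L (kernel_op L block_ker g).
Proof.
move=> mg g0; apply: (@eq_measurable_fun _ _ (lebesgue_line R) _ _ (fun t =>
  ((phi t)^-1)%:E * ((block_coef (kappa t))%:E * \int[leb]_(x in I) ((\1_(block (kappa t)) x)%:E * g x)))).
  by move=> t /set_mem It; rewrite block_kernel_op_coef.
apply: (meas_kappa (w := fun n t => ((phi t)^-1)%:E * ((block_coef n)%:E * V g n))) => n.
by apply: meas_funM => //; exact: meas_fun_cst.
Qed.

Let V0 g n : (forall x, I x -> 0 <= g x) -> 0 <= V g n.
Proof. by move=> g0; apply: integral_ge0 => x Ix; rewrite mule_ge0 ?g0// lee_fin. Qed.

Let Q0 u n : (forall x, I x -> 0 <= u x) -> 0 <= Q u n.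
Proof. by move=> u0; apply: integral_ge0 => t [It _]; rewrite mule_ge0 ?u0 ?xi_pos. Qed.

(** Splitting the integral over the level sets of [kappa] turns the transposed operator into a
    series of multiples of block indicators. *)
Lemma block_kernel_swap_series u x : meas_fun L u -> (forall t, I t -> 0 <= u t) ->
  kernel_op L (fun x t => block_ker t x) u x =
  \sum_(n <oo) ((block_coef n)%:E * Q u n) * (\1_(block n) x)%:E.
Proof.
move=> mu u0; rewrite /kernel_op.
rewrite (integral_kappa (w := fun n t => W n x t * u t)).
- apply: eq_eseriesr => n _.
  rewrite (_ : \int[leb]_(t in J n) _ =
      \int[leb]_(t in J n) ((block_coef n * \1_(block n) x)%:E * ((xi t)%:E * u t))).
    rewrite leb_integralZl.
    - by rewrite EFinM muleAC.
    - exact: mkappa.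
    - by apply: (leb_measurable_funS (JI (n := n))); exact: meas_funM.
    - by move=> t [It _]; rewrite mule_ge0 ?u0 ?xi_pos.
    - by rewrite mulr_ge0// ltW// block_coef_gt0.
  by apply: eq_integral => t _; rewrite /W muleA [_ * (phi t)^-1%:E]muleC.
- by move=> n; apply: meas_funM => //; exact: mW.
- by move=> n t It; rewrite mule_ge0 ?W0 ?u0.
Qed.

Lemma meas_block_kernel_swap_ge0 u : meas_fun L u -> (forall t, 0 <= u t) ->
  meas_fun L (kernel_op L (fun x t => block_ker t x) u).
Proof.
move=> mu u0.
rewrite (_ : kernel_op _ _ _ = fun x => \sum_(n <oo) ((block_coef n)%:E * Q u n) * (\1_(block n) x)%:E).
  apply: (@ge0_emeasurable_sum _ (lebesgue_line R)) => [n x _ _|n _].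
    by rewrite !mule_ge0 ?Q0 ?lee_fin// ltW// block_coef_gt0.
  by apply: meas_funM; [exact: meas_fun_cst|exact: meas_block_indic].
by apply/funext => x; apply: block_kernel_swap_series => // t _.
Qed.

(** Both sides equal the sum over n of [block_coef n] times the integral of v over the n-th block
    and that of xi u over the n-th level set of [kappa]; only a sum and an integral are
    interchanged. *)
Lemma block_kernel_tonelli u v : meas_fun L u -> meas_fun L v ->
  (forall t, 0 <= u t) -> (forall x, 0 <= v x) ->
  \int[leb]_(t in I) (u t * kernel_op L block_ker v t) =
  \int[leb]_(x in I) (v x * kernel_op L (fun x t => block_ker t x) u x).
Proof.
move=> mu mv u0 v0.
have b0 n : 0 <= (block_coef n)%:E by rewrite lee_fin ltW// block_coef_gt0.
have VV n : 0 <= V v n by apply: V0.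
have QQ n : 0 <= Q u n by apply: Q0.
transitivity (\sum_(n <oo) ((block_coef n)%:E * V v n) * Q u n).
  rewrite (_ : \int[leb]_(t in I) _ = \int[leb]_(t in I) (fun n t => ((block_coef n)%:E * V v n) * ((xi t)%:E * u t)) (kappa t) t).
    rewrite (integral_kappa (w := fun n t => ((block_coef n)%:E * V v n) * ((xi t)%:E * u t))).
    - apply: eq_eseriesr => n _; rewrite leb_integralZle.
      + by [].
      + exact: mkappa.
      + by apply: (leb_measurable_funS (JI (n := n))); exact: meas_funM.
      + by move=> t [It _]; rewrite mule_ge0 ?xi_pos.
      + by rewrite mule_ge0.
    - by move=> n; apply: meas_funM; [exact: meas_fun_cst|exact: meas_funM].
    - by move=> n t It; rewrite !mule_ge0 ?xi_pos.
  apply: eq_integral => t /set_mem It; rewrite block_kernel_op_coef//.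
  by rewrite muleA [RHS]muleC [u t * _]muleC.
under [RHS]eq_integral do rewrite block_kernel_swap_series//.
rewrite (_ : \int[leb]_(x in I) _ = \int[leb]_(x in I)
   \sum_(n <oo) (((block_coef n)%:E * Q u n) * ((\1_(block n) x)%:E * v x))).
  rewrite (@integral_nneseries _ (lebesgue_line R) R leb I mI).
  - apply: eq_eseriesr => n _; rewrite leb_integralZle.
    + by rewrite muleAC.
    + exact: mI.
    + by apply: meas_funM => //; exact: meas_block_indic.
    + by move=> x _; rewrite mule_ge0// lee_fin.
    + by rewrite mule_ge0.
  - move=> n; apply: meas_funM; first exact: meas_fun_cst.
    by apply: meas_funM => //; exact: meas_block_indic.
  - by move=> n x _; rewrite !mule_ge0// lee_fin.
apply: eq_integral => x _; rewrite -nneseriesZle//.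
  by apply: eq_eseriesr => n _; rewrite muleCA; congr (_ * _); rewrite muleC.
by move=> n; rewrite !mule_ge0// lee_fin.
Qed.

(** As x < s on the block, quasi-monotonicity of phi(t)/t gives phi(s)/s <= c phi(x)/x. *)
Lemma block_coef_le n x : block n x -> (block_coef n <= 2 * c * (phi x / x))%R.
Proof.
move=> bx; have Ix := block_sub bx; have [x0 _] := Ix; have [_ xs] := bx.
have px := phi_gt0 Ix; have ps := phi_gt0 (sI n).
have := xi_quasi_incr phi_gt0 phi_nd avg Ix (sI n) (ltW xs).
rewrite ler_pdivrMr// => h; rewrite /block_coef -!mulrA ler_wpM2l//.
rewrite ler_pdivrMr//.
rewrite (_ : c * (phi x / x) * s n = (c * (s n / phi (s n)) * phi x) * (phi (s n) / x))%R; last first.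
  by field; rewrite !gt_eqF.
rewrite -{1}(divfK (lt0r_neq0 x0) (phi (s n))) mulrC.
by apply: ler_wpM2r => //; rewrite divr_ge0// ltW.
Qed.

(** If x lies in the block assigned to t, then t <= c0 s < 2 c0 x. For fixed x the kernel thus lives
    on an interval of length comparable to x. *)
Lemma block_ker_le t x : I t -> I x ->
  (block_ker t x <= 2 * c * (phi x / x) * ((phi t)^-1 * \1_(ival (2 * c0 * x)%:E) t))%R.
Proof.
move=> It Ix; have [x0 _] := Ix; have px := phi_gt0 Ix; have pt := phi_gt0 It.
rewrite /block_ker; have [bx|nbx] := pselect (block (kappa t) x); last first.
  rewrite [\1_(block _) x]indicE memNset// !mulr0.
  by rewrite !mulr_ge0 ?invr_ge0 ?(ltW c_gt0) ?(ltW px) ?(ltW x0) ?(ltW pt).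
rewrite [\1_(block _) x]indicE mem_set// mulr1 indicE mem_set ?mulr1; last first.
  split; first by case: It.
  rewrite lte_fin; apply: le_lt_trans (le_s It) _.
  rewrite (_ : 2 * c0 * x = c0 * (x * 2))%R; last by ring.
  rewrite ltr_pM2l// -ltr_pdivrMr//.
  by case: bx.
rewrite mulrC; apply: ler_wpM2r; first by rewrite invr_ge0 ltW.
exact: block_coef_le.
Qed.

(** On (0, x) use the averaging condition, and beyond x the bound xi <= xi(x). The indicator is kept
    inside the integral over (0, L), since b x may exceed L. *)
Lemma prefix_xi_dilate (b : R) x : I x -> (0 < b)%R ->
  \int[leb]_(t in I) ((phi t)^-1 * \1_(ival (b * x)%:E) t)%:E <= ((c + b) * (x * (phi x)^-1))%:E.
Proof.
move=> Ix b0; have [x0 xL] := Ix; have px := phi_gt0 Ix.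
have mind y : meas_fun L (fun t : R => (\1_(ival y) t)%:E) by exact: meas_indic.
apply: (@le_trans _ _ (\int[leb]_(t in I) ((xi t)%:E * (\1_(ival x%:E) t)%:E +
    (xi x)%:E * (\1_(ival (b * x)%:E) t)%:E))).
  apply: leb_le_integral => //.
  - rewrite (_ : (fun t => _) = (fun t => (xi t)%:E * (\1_(ival (b * x)%:E) t)%:E)).
      exact: meas_funM.
    by apply/funext => t; rewrite EFinM.
  - apply: meas_funD; first exact: meas_funM.
    by apply: meas_funM => //; exact: meas_fun_cst.
  - by move=> t It; rewrite EFinM mule_ge0 ?xi_pos// lee_fin.
  move=> t It; rewrite EFinM; have [tx|xt] := ltP t x.
    have -> : \1_(ival x%:E) t = 1%R :> R by rewrite indicE mem_set//; split; [case: It|rewrite lte_fin].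
    rewrite mule1; apply: (@le_trans _ _ (xi t)%:E).
      rewrite -[leRHS]mule1; apply: lee_wpmul2l; first exact: xi_pos.
      by rewrite lee_fin indicE; case: (_ \in _).
    by rewrite leeDl// mule_ge0 ?xi_pos// lee_fin.
  apply: (@le_trans _ _ ((xi x)%:E * (\1_(ival (b * x)%:E) t)%:E)).
    by apply: lee_wpmul2r; rewrite ?lee_fin//; exact: (xi_nonincr phi_gt0 phi_nd).
  by rewrite leeDr// mule_ge0 ?xi_pos// lee_fin.
rewrite leb_integralD//; last 4 first.
- exact: meas_funM.
- by apply: meas_funM => //; exact: meas_fun_cst.
- by move=> t It; rewrite mule_ge0 ?xi_pos// lee_fin.
- by move=> t It; rewrite mule_ge0 ?xi_pos// lee_fin.
rewrite mulrDl EFinD; apply: leeD.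
  by rewrite integral_ival_indic ?(ltW xL)//; exact: avg.
rewrite leb_integralZl//; last 2 first.
- exact: mind.
- by have := xi_pos Ix; rewrite lee_fin.
rewrite (_ : b * (x * (phi x)^-1) = (phi x)^-1 * (b * x))%R; last by ring.
rewrite [(_ * (b * x))%:E]EFinM; apply: lee_wpmul2l; first exact: xi_pos.
have bx0 : (0 <= b * x)%R by rewrite mulr_ge0// ltW.
rewrite (@integral_indic _ (lebesgue_line R) R leb I mI); last exact: measurable_ival.
apply: (@le_trans _ _ (leb (ival (b * x)%:E))); last by rewrite leb_ival ?lee_fin.
by apply: leb_le; [apply: (@measurableI _ (lebesgue_line R)) => //; exact: measurable_ival|exact: measurable_ival|move=> t []].
Qed.

Let B1 : R := (2 * c * (c + 2 * c0))%R.

Let B1_gt0 : (0 < B1)%R.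
Proof. by rewrite !mulr_gt0// addr_gt0// mulr_gt0. Qed.

(** The factors x/phi(x) and phi(x)/x cancel. This single bound yields the boundedness of the
    operator on L^1 and of its transpose on L^oo. *)
Lemma integral_block_ker_le x : I x -> \int[leb]_(t in I) (block_ker t x)%:E <= B1%:E.
Proof.
move=> Ix; have [x0 _] := Ix; have px := phi_gt0 Ix.
have k0 : (0 <= 2 * c * (phi x / x))%R by rewrite !mulr_ge0 ?invr_ge0 ?(ltW c_gt0) ?(ltW px) ?(ltW x0).
have mi : meas_fun L (fun t : R => ((phi t)^-1 * \1_(ival (2 * c0 * x)%:E) t)%:E).
  rewrite (_ : (fun t => _) = (fun t => (xi t)%:E * (\1_(ival (2 * c0 * x)%:E) t)%:E)).
    by apply: meas_funM => //; exact: meas_indic.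
  by apply/funext => t; rewrite EFinM.
have i0 t : I t -> 0 <= ((phi t)^-1 * \1_(ival (2 * c0 * x)%:E) t)%:E.
  by move=> It; rewrite EFinM mule_ge0 ?xi_pos// lee_fin.
apply: (@le_trans _ _ (\int[leb]_(t in I) ((2 * c * (phi x / x))%:E *
    ((phi t)^-1 * \1_(ival (2 * c0 * x)%:E) t)%:E))).
  apply: leb_le_integral => //.
  - exact: meas_block_ker_swap.
  - by apply: meas_funM => //; exact: meas_fun_cst.
  - by move=> t It; rewrite lee_fin block_ker_ge0.
  - by move=> t It; rewrite -EFinM lee_fin; exact: block_ker_le.
rewrite leb_integralZl//.
apply: (@le_trans _ _ ((2 * c * (phi x / x))%:E * ((c + 2 * c0) * (x * (phi x)^-1))%:E)).
  by apply: lee_wpmul2l; [rewrite lee_fin|apply: prefix_xi_dilate => //; rewrite mulr_gt0].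
rewrite -EFinM lee_fin le_eqVlt; apply/orP; left; apply/eqP; rewrite /B1.
by field; rewrite !gt_eqF.
Qed.

Lemma weak_norm_le_pointwise g (B : R) : meas_fun L g -> (0 <= B)%R ->
  (forall t, I t -> `|g t| <= (xi t)%:E * B%:E) -> M g <= B%:E.
Proof.
move=> mg B0 gB; apply: weak_norm_le => // t It.
have mxB : meas_fun L (fun t => (xi t)%:E * B%:E) by apply: meas_funM => //; exact: meas_fun_cst.
have xB0 x : I x -> 0 <= (xi x)%:E * B%:E by move=> Ix; rewrite mule_ge0 ?xi_pos// lee_fin.
apply: (@le_trans _ _ ((fun t => (xi t)%:E * B%:E)^* t)).
  apply: le_rearrangement => m m0; apply: le_distribution_fun => // x Ix.
  by rewrite [leRHS]gee0_abs ?xB0//; exact: gB.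
apply: (rearrangement_noninc_le mxB) => // x y Ix Iy xy.
by apply: lee_wpmul2r; rewrite ?lee_fin//; exact: (xi_nonincr phi_gt0 phi_nd).
Qed.

Lemma integral_indic_mul E f : leb_measurable E -> E `<=` I ->
  \int[leb]_(x in I) ((\1_E x)%:E * f x) = \int[leb]_(x in E) f x.
Proof.
move=> mE EI; rewrite [LHS]integral_mkcond [RHS]integral_mkcond; apply: eq_integral => x _.
rewrite !patchE indicE; case: ifPn => [/set_mem Ix|nIx]; case: ifPn => [/set_mem ax|nax] //.
- by rewrite mul1e.
- by rewrite mul0e.
- by case/negP: nIx; rewrite inE; exact: EI.
Qed.

(** The integral of |g| over the block is at most that of g^* over (0, s), hence at most [M g] times
    the integral of xi, which averaging bounds by c s/phi(s). The coefficient 2 phi(s)/s leaves the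
    constant 2 c. *)
Lemma block_kernel_op_le_weak g t : meas_fun L g -> I t ->
  kernel_op L block_ker (fun x => `|g x|) t <= (xi t)%:E * ((2 * c)%:E * M g).
Proof.
move=> mg It; rewrite block_kernel_op_coef//; last exact: meas_fun_abs.
apply: lee_wpmul2l; first exact: xi_pos.
set n := kappa t; have [s0 sL] := sI n; have ps := phi_gt0 (sI n).
have := weak_norm_ge0 L0 phi_gt0 g; case E : (M g) => [m| |]// m0; last first.
  by rewrite gt0_muley ?leey// lte_fin mulr_gt0.
rewrite integral_indic_mul; [|exact: measurable_block|exact: block_sub].
apply: (@le_trans _ _ ((block_coef n)%:E * (m%:E * (c * (s n * (phi (s n))^-1))%:E))); last first.
  rewrite -!EFinM lee_fin le_eqVlt; apply/orP; left; apply/eqP; rewrite /block_coef.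
  by field; rewrite !gt_eqF.
apply: lee_wpmul2l; first by rewrite lee_fin ltW// block_coef_gt0.
apply: le_trans (integral_le_prefix L0 (@measurable_block n) (@block_sub n) mg) _.
have mxs : meas_fun (s n)%:E (fun t => (xi t)%:E) := meas_funS (ltW sL) mxi.
apply: (@le_trans _ _ (\int[leb]_(x in ival (s n)%:E) g^* x)).
  apply: leb_subset_integral; [exact: measurable_ival|exact: measurable_ival| | |].
  - exact: meas_funS (ltW sL) (meas_rearrangement g).
  - by move=> x _; exact: rearrangement_ge0.
  - by apply: ivalS; rewrite leb_block lee_fin ler_pdivrMr// ler_pMr// ler1n.
apply: (@le_trans _ _ (m%:E * \int[leb]_(x in ival (s n)%:E) (xi x)%:E)).
  rewrite -leb_integralZl.
  - apply: leb_le_integral; first exact: measurable_ival.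
    + exact: meas_funS (ltW sL) (meas_rearrangement g).
    + by apply: meas_funM => //; exact: meas_fun_cst.
    + by move=> x _; exact: rearrangement_ge0.
    + move=> x /(ivalS (ltW sL)) Ix; rewrite muleC -E.
      exact: (rearrangement_le_weak phi_gt0).
  - exact: measurable_ival.
  - exact: mxs.
  - by move=> x /(ivalS (ltW sL)); exact: xi_pos.
  - by rewrite -lee_fin.
by apply: lee_wpmul2l => //; exact: avg.
Qed.

Lemma block_kernel_op_ge f t : meas_fun L f -> I t ->
  (xi t)%:E * ((phi (s (kappa t)))%:E * f^* (s (kappa t))) <= kernel_op L block_ker f^* t.
Proof.
move=> mf It; rewrite block_kernel_op_coef//; last 2 first.
- exact: meas_rearrangement.
- by move=> x _; exact: rearrangement_ge0.
apply: lee_wpmul2l; first exact: xi_pos.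
set n := kappa t; have [s0 sL] := sI n; have ps := phi_gt0 (sI n).
rewrite integral_indic_mul; [|exact: measurable_block|exact: block_sub].
apply: (@le_trans _ _ ((block_coef n)%:E * (f^* (s n) * (s n / 2)%:E))).
  rewrite muleCA muleC [leRHS]muleC -EFinM.
  rewrite (_ : block_coef n * (s n / 2) = phi (s n))%R; last first.
    by rewrite /block_coef; field; rewrite gt_eqF.
  by rewrite muleC.
apply: lee_wpmul2l; first by rewrite lee_fin ltW// block_coef_gt0.
rewrite -leb_block -leb_integral_cst; last exact: measurable_block.
apply: leb_le_integral; first exact: measurable_block.
- exact: (@measurable_cst _ _ (lebesgue_line R)).
- exact: leb_measurable_funS (@block_sub n) (meas_rearrangement f).
- by move=> x _; exact: rearrangement_ge0.
- by move=> x [_ /ltW xs]; exact: rearrangement_nonincr.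
Qed.

Let ker0 t x : I t -> I x -> (0 <= block_ker t x)%R.
Proof. by move=> It _; exact: block_ker_ge0. Qed.

Let ker0' x t : I x -> I t -> (0 <= block_ker t x)%R.
Proof. by move=> _ It; exact: block_ker_ge0. Qed.

Let mker t : I t -> meas_fun L (fun x : R => (block_ker t x)%:E).
Proof. by move=> _; exact: meas_block_ker. Qed.

Let mker' x : I x -> meas_fun L (fun t : R => (block_ker t x)%:E).
Proof. by move=> _; exact: meas_block_ker_swap. Qed.

Local Notation S := (kernel_op L block_ker).
Local Notation S' := (kernel_op L (fun x t => block_ker t x)).

(** On L^1, Tonelli's theorem and the bound on the kernel integrated in t; on the weak space, the
    pointwise bound of the image by a multiple of xi. *)
Lemma block_kernel_op_admissible : admissible L (L1_norm L) M S.
Proof.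
have mS g : meas_fun L g -> meas_fun L (S g).
  exact: (meas_kernel_op ker0 meas_block_kernel_op_ge0).
apply: (kernel_op_admissible ker0 mker meas_block_kernel_op_ge0 L0).
- exact: L1_norm0.
- exact: weak_norm0.
- exact: L1_norm_ge0.
- exact: weak_norm_ge0.
- apply: (L1_kernel_op_le ker0 mker meas_block_kernel_op_ge0 B1_gt0) => v mv v0.
  have m1 : meas_fun L (fun=> 1) by exact: meas_fun_cst.
  rewrite (_ : \int[leb]_(t in I) _ = \int[leb]_(t in I) (1 * S v t)); last first.
    by apply: eq_integral => t _; rewrite mul1e.
  rewrite (block_kernel_tonelli m1 mv)// -leb_integralZl//; last exact: ltW.
  apply: leb_le_integral => //.
  + by apply: meas_funM => //; exact: meas_block_kernel_swap_ge0.
  + by apply: meas_funM => //; exact: meas_fun_cst.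
  + by move=> x Ix; rewrite mule_ge0//; apply: (kernel_op_ge0 ker0').
  + move=> x Ix; rewrite muleC; apply: lee_wpmul2r => //.
    by rewrite /kernel_op; under eq_integral do rewrite mule1; exact: integral_block_ker_le.
- exists (2 * c)%R; split; first by rewrite mulr_gt0.
  move=> f mf; have := weak_norm_ge0 L0 phi_gt0 f; case E : (M f) => [m| |]// m0; last first.
    by rewrite gt0_muley ?leey// lte_fin mulr_gt0.
  rewrite -EFinM; apply: weak_norm_le_pointwise; first exact: mS.
    by rewrite mulr_ge0 ?mulr_ge0 ?(ltW c_gt0)// -lee_fin.
  move=> t It; rewrite EFinM -E; apply: le_trans (abs_kernel_op ker0 mker It mf) _.
  exact: block_kernel_op_le_weak.
- move=> g t mg + It; rewrite L1_normE => g1.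
  rewrite block_kernel_op_coef//; last exact: meas_fun_abs.
  rewrite !lte_mul_pinfty ?xi_pos ?lee_fin ?(ltW (block_coef_gt0 _))//.
  rewrite integral_indic_mul; [|exact: measurable_block|exact: block_sub].
  apply: le_lt_trans g1; apply: leb_subset_integral => //.
  + exact: measurable_block.
  + exact: meas_fun_abs.
  + exact: block_sub.
- move=> g t mg gM It; apply: le_lt_trans (block_kernel_op_le_weak mg It) _.
  by rewrite !lte_mul_pinfty ?xi_pos ?lee_fin ?mulr_ge0 ?(ltW c_gt0)//.
Qed.

Lemma xi_integral_le_Lambda g : meas_fun L g ->
  \int[leb]_(t in I) (`|g t| * (xi t)%:E) <= Lam g.
Proof.
move=> mg; rewrite (_ : \int[leb]_(t in I) _ = \int[leb]_(t in I) (`|g t| * `|(xi t)%:E|)); last first.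
  by apply: eq_integral => t /set_mem It; rewrite [`|_%:E|]gee0_abs// xi_pos.
apply: le_trans (hardy_littlewood L0 mg mxi) _.
apply: leb_le_integral => //.
- by apply: meas_funM; exact: meas_rearrangement.
- by apply: meas_funM => //; exact: meas_rearrangement.
- by move=> t It; rewrite mule_ge0 ?rearrangement_ge0.
- move=> t It; apply: lee_wpmul2l; first exact: rearrangement_ge0.
  apply: (rearrangement_noninc_le mxi) => // x y Ix Iy xy; rewrite lee_fin.
  exact: (xi_nonincr phi_gt0 phi_nd).
Qed.

(** For Lambda^1_xi, resonance tests the image against functions h whose distribution function is at
    most that of xi. These have weak norm at most 1, so after transposition the operator maps h to a
    function bounded by 2 c xi, and what remains is the integral of |f| xi. *)
Lemma block_kernel_swap_admissible : admissible L Lam (Linfty_norm L) S'.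
Proof.
have mS g : meas_fun L g -> meas_fun L (S' g).
  exact: (meas_kernel_op ker0' meas_block_kernel_swap_ge0).
apply: (kernel_op_admissible ker0' mker' meas_block_kernel_swap_ge0 L0).
- exact: Lambda1_norm0.
- exact: Linfty_norm0.
- move=> f; apply: integral_ge0 => t It; rewrite mule_ge0 ?rearrangement_ge0//.
  exact: xi_pos.
- exact: Linfty_norm_ge0.
- exists (2 * c)%R; split; first by rewrite mulr_gt0.
  move=> f mf; have mSf := mS f mf.
  apply: (@le_trans _ _ (\int[leb]_(x in I) ((S' f)^* x * (fun t => (xi t)%:E)^* x))).
    apply: (integral_noninc_rearrangement L0) => //.
    + exact: meas_rearrangement.
    + by move=> x _; exact: rearrangement_ge0.
    + by move=> x y Ix Iy xy; rewrite lee_fin; exact: (xi_nonincr phi_gt0 phi_nd).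
  apply: (resonance L0 mSf mxi) => h mh h0 Dh.
  have maf := meas_fun_abs mf.
  have mSaf : meas_fun L (S' (fun x => `|f x|)) by exact: mS.
  apply: (@le_trans _ _ (\int[leb]_(x in I) (h x * S' (fun x => `|f x|) x))).
    apply: leb_le_integral => //.
    + by apply: meas_funM => //; exact: meas_fun_abs.
    + exact: meas_funM.
    + by move=> x _; rewrite mule_ge0.
    + by move=> x Ix; rewrite muleC; apply: lee_wpmul2l => //; exact: (abs_kernel_op ker0' mker').
  rewrite -(block_kernel_tonelli maf mh)//.
  have Mh : M h <= 1.
    apply: weak_norm_le => // t It; rewrite mule1.
    apply: (@le_trans _ _ ((fun t => (xi t)%:E)^* t)); first exact: le_rearrangement.
    apply: (rearrangement_noninc_le mxi) => // x y Ix Iy xy; rewrite lee_fin.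
    exact: (xi_nonincr phi_gt0 phi_nd).
  apply: le_trans (lee_wpmul2l _ (xi_integral_le_Lambda mf)); last by rewrite lee_fin mulr_ge0// ltW.
  rewrite -leb_integralZl//; last 3 first.
  + exact: meas_funM.
  + by move=> t It; rewrite mule_ge0 ?xi_pos.
  + by rewrite mulr_ge0// ltW.
  have mSh : meas_fun L (S h) by exact: meas_block_kernel_op_ge0.
  apply: leb_le_integral => //.
  + exact: meas_funM.
  + by apply: meas_funM; [exact: meas_fun_cst|exact: meas_funM].
  + by move=> t It; rewrite mule_ge0//; apply: (kernel_op_ge0 ker0).
  move=> t It; rewrite muleCA; apply: lee_wpmul2l => //.
  have -> : h = fun x => `|h x| by apply/funext => x; rewrite gee0_abs.
  apply: le_trans (block_kernel_op_le_weak mh It) _.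
  rewrite muleC; apply: lee_wpmul2r; first exact: xi_pos.
  rewrite -[leRHS]mule1; apply: lee_wpmul2l => //.
  by rewrite lee_fin mulr_ge0// ltW.
- apply: (Linfty_kernel_op_le ker0' mker' L0 B1_gt0) => x Ix.
  exact: integral_block_ker_le.
- move=> g x mg gL Ix; have [x0 _] := Ix; have px := phi_gt0 Ix.
  have k0 : (0 <= 2 * c * (phi x / x))%R by rewrite !mulr_ge0 ?invr_ge0 ?(ltW c_gt0) ?(ltW px) ?(ltW x0).
  have mag := meas_fun_abs mg.
  apply: (@le_lt_trans _ _ ((2 * c * (phi x / x))%:E * Lam g)); last by rewrite lte_mul_pinfty ?lee_fin.
  apply: le_trans (lee_wpmul2l _ (xi_integral_le_Lambda mg)); last by rewrite lee_fin.
  rewrite -leb_integralZl//; last 2 first.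
  + exact: meas_funM.
  + by move=> t It; rewrite mule_ge0 ?xi_pos.
  apply: leb_le_integral => //.
  + by apply: meas_funM => //; exact: mker'.
  + by apply: meas_funM; [exact: meas_fun_cst|exact: meas_funM].
  + by move=> t It; rewrite mule_ge0// lee_fin ker0'.
  move=> t It; rewrite [`|g t| * _]muleC muleA; apply: lee_wpmul2r => //.
  rewrite -EFinM lee_fin; apply: le_trans (block_ker_le It Ix) _.
  apply: ler_wpM2l => //; rewrite -[leRHS]mulr1; apply: ler_wpM2l.
    by have := xi_pos It; rewrite lee_fin.
  by rewrite indicE; case: (_ \in _).
- move=> g x mg gL Ix; apply: le_lt_trans (kernel_op_abs_le_Linfty ker0' mker' L0 B1_gt0 mg Ix _) _.
    exact: integral_block_ker_le.
  by rewrite lte_mul_pinfty ?lee_fin ?(ltW B1_gt0).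
Qed.

End partition_kernel.

(** * The supremum operator from interpolation *)

Section near_maximizers.
Context {R : realType} {L : \bar R} {phi : R -> R}.
Implicit Types (f : R -> \bar R) (t u : R).
Local Notation I := (ival L).
Local Notation "f ^*" := (rearrangement L f).
Local Notation H := (tail_sup L phi).
Hypothesis L0 : 0 < L.
Hypothesis phi_gt0 : forall t, I t -> (0 < phi t)%R.

Lemma near_maximizer f u : I u -> H f u < +oo ->
  exists s : R, [/\ I s, (u <= s)%R & H f u <= 2%:E * ((phi s)%:E * f^* s)].
Proof.
move=> Iu; have := tail_sup_ge0 phi_gt0 f Iu.
case E : (H f u) => [r| |]// r0 _; rewrite lee_fin in r0.
have [r_gt0|r_le0] := ltP 0%R r; last first.
  exists u; split => //; apply: (@le_trans _ _ 0); first by rewrite lee_fin.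
  by rewrite !mule_ge0 ?rearrangement_ge0 ?lee_fin// ltW// phi_gt0.
have : (r / 2)%:E < H f u by rewrite E lte_fin ltr_pdivrMr// ltr_pMr// ltr1n.
move=> /ereal_sup_gt[_ [s [Is us] <-] h]; exists s; split => //.
by rewrite -lee_pdivrMl// -EFinM mulrC ltW.
Qed.

(* On each of the intervals [e^k, e^(k+1)) one near maximizer is chosen, so that the
   selection is measurable. *)
Lemma near_maximizers f : (forall t, I t -> H f t < +oo) ->
  exists (kappa : R -> nat) (s : nat -> R),
  [/\ forall n, leb_measurable (I `&` [set t | kappa t = n]), forall n, I (s n),
      forall t, I t -> (t <= expR 1 * s (kappa t))%R &
      forall t, I t -> H f t <= 2%:E * ((phi (s (kappa t)))%:E * f^* (s (kappa t)))].
Proof.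
move=> Hfin.
have [sigma sigmaP] : {sigma : R -> R & forall u, I u -> [/\ I (sigma u), (u <= sigma u)%R &
    H f u <= 2%:E * ((phi (sigma u))%:E * f^* (sigma u))]}.
  apply: (@choice _ _ (fun u s => I u -> [/\ I s, (u <= s)%R &
    H f u <= 2%:E * ((phi s)%:E * f^* s)])) => u.
  have [Iu|nIu] := pselect (I u); last by exists u.
  by have [s sP] := near_maximizer Iu (Hfin u Iu); exists s.
have [a Ia] := ival_nonempty L0.
pose fl (t : R) : int := Num.floor (ln t).
(* The integer part of ln t, encoded as a natural number. *)
pose kappa t := pickle (fl t).
(* The default [a] serves the indices that encode no integer k with e^k in (0, L); these are not
   values of [kappa] on (0, L). *)
pose s n := if unpickle n is Some k then
  (if `[< I (expR (k%:~R)) >] then sigma (expR k%:~R) else a) else a.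
have flP t : I t -> [/\ I (expR (fl t)%:~R), (expR (fl t)%:~R <= t)%R & (t <= expR 1 * expR (fl t)%:~R)%R].
  move=> [t0 tL]; have tE : expR (ln t) = t by rewrite lnK.
  have le_t : (expR (fl t)%:~R <= t)%R by rewrite -[leRHS]tE ler_expR; exact: floor_le.
  split => //; first by split; [exact: expR_gt0|apply: le_lt_trans tL; rewrite lee_fin].
  rewrite -expRD -[leLHS]tE ler_expR addrC -[1%R]/(1%:~R) -intrD ltW//.
  exact: floorD1_gt.
have sE t : I t -> s (kappa t) = sigma (expR (fl t)%:~R).
  by move=> It; rewrite /s /kappa pickleK; case: asboolP => //; case: (flP t It).
exists kappa, s; split.
- move=> n; apply: borel_leb_measurable; apply: is_interval_measurable.
  move=> x y [Ix kx] [Iy ky] z /andP[xz zy].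
  have [x0 _] := Ix; have [y0 yL] := Iy; have z0 : (0 < z)%R := lt_le_trans x0 xz.
  split; first by split => //; apply: le_lt_trans yL; rewrite lee_fin.
  have fxy : fl x = fl y by apply: (pcan_inj (@pickleK int)); rewrite -/(kappa x) -/(kappa y) kx ky.
  rewrite /= -kx; congr pickle; apply/eqP; rewrite eq_le; apply/andP; split.
    by rewrite fxy; apply: le_floor; rewrite ler_ln ?posrE.
  by apply: le_floor; rewrite ler_ln ?posrE.
- move=> n; rewrite /s; case: unpickle => // k; case: asboolP => // Ik.
  by case: (sigmaP _ Ik).
- move=> t It; rewrite sE//; have [Ie _ te] := flP t It; have [_ es _] := sigmaP _ Ie.
  by apply: le_trans te _; rewrite ler_pM2l ?expR_gt0.
- move=> t It; rewrite sE//; have [Ie et _] := flP t It; have [_ _ h] := sigmaP _ Ie.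
  (* The maximizer belongs to the left end e^k <= t, where H f is at least as large; the price is
     that s is only known to be at least e^k >= t/e. *)
  by apply: le_trans h; exact: tail_sup_nonincr.
Qed.

End near_maximizers.

Section interpolation_bounded.
Context {R : realType} {L : \bar R} {phi : R -> R} {c : R} {N : functional R}.
Implicit Types (f g h : R -> \bar R) (t x : R).
Local Notation I := (ival L).
Local Notation "f ^*" := (rearrangement L f).
Local Notation xi := (fun t : R => (phi t)^-1)%R.
Local Notation U := (tail_op L phi).
Local Notation H := (tail_sup L phi).
Local Notation M := (weak_norm L phi).
Local Notation Lam := (Lambda1_norm L xi).
Local Notation A := (assoc_norm L N).

Hypothesis L0 : 0 < L.
Hypothesis phi_gt0 : forall t, I t -> (0 < phi t)%R.
Hypothesis phi_nd : forall s t, I s -> I t -> (s <= t)%R -> (phi s <= phi t)%R.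
Hypothesis avg : forall t, I t ->
  \int[leb]_(s in ival t%:E) ((phi s)^-1)%:E <= (c * (t * (phi t)^-1))%:E.
Hypothesis N_ri : ri_norm L N.

Let c_ge1 : (1 <= c)%R := avg_ge1 L0 phi_gt0 phi_nd avg.
Let c_gt0 : (0 < c)%R := lt_le_trans ltr01 c_ge1.
Let mU f : meas_fun L (U f) := meas_tail_op phi_gt0 phi_nd f.

(** [G] stands for a contribution from L^1 and [m] for one from the weak space. After multiplication
    by phi(s)/s the second is constant, and the first is bounded on [t, L) because phi(s)/s is
    nonincreasing up to the factor [c]. *)
Lemma tail_sup_lty f (G m : R) : (0 <= G)%R ->
  (forall s, I s -> s%:E * f^* s <= (G + m * (s * (phi s)^-1))%:E) ->
  forall t, I t -> H f t < +oo.
Proof.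
move=> G0 fG t It; have [t0 _] := It; have pt := phi_gt0 It.
apply: (@le_lt_trans _ _ (c * (phi t / t) * G + m)%:E); last exact: ltry.
apply: ge_ereal_sup => _ [s [Is ts] <-]; have [s0 _] := Is; have ps := phi_gt0 Is.
have -> : (phi s)%:E * f^* s = (phi s / s)%:E * (s%:E * f^* s).
  by rewrite muleA -EFinM divfK// gt_eqF.
apply: (@le_trans _ _ ((phi s / s)%:E * (G + m * (s * (phi s)^-1))%:E)).
  by apply: lee_wpmul2l; [rewrite lee_fin divr_ge0// ltW|exact: fG].
rewrite -EFinM lee_fin mulrDr.
rewrite (_ : phi s / s * (m * (s / phi s)) = m)%R; last by field; rewrite !gt_eqF.
rewrite lerD2r; apply: ler_wpM2r => //.
have := xi_quasi_incr phi_gt0 phi_nd avg It Is ts; rewrite ler_pdivrMr// => h.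
rewrite ler_pdivrMr// -(ler_pM2r t0).
rewrite (_ : c * (phi t / t) * s * t = phi s * (c * (s / phi s) * phi t))%R; last first.
  by field; rewrite !gt_eqF.
by rewrite ler_pM2l.
Qed.

Lemma tail_op_le_block kappa (s : nat -> R) f t : meas_fun L f ->
  (forall n, I (s n)) ->
  H f t <= 2%:E * ((phi (s (kappa t)))%:E * f^* (s (kappa t))) -> I t ->
  U f t <= 2%:E * kernel_op L (block_ker (phi := phi) (kappa := kappa) (s := s)) f^* t.
Proof.
move=> mf sI Hs It.
apply: le_trans (lee_wpmul2l _ (block_kernel_op_ge phi_gt0 sI mf It)) => //.
rewrite muleCA; apply: lee_wpmul2l => //; exact: (xi_ge0 phi_gt0).
Qed.

(** It suffices to show that U f lies in X' for each f in X'. A decomposition of f^* in the sum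
    space gives finiteness of H f, hence near maximizers, and the resulting block operator is
    bounded on X'. *)
Lemma bounded_of_interpolation_L1_weak : interpolation L (L1_norm L) M (ext_norm A) ->
  exists C : R, (0 < C)%R /\ forall f, meas_fun L f -> A (U f) <= C%:E * A (fun x => `|f x|).
Proof.
move=> [[_ [e [e0 eP]]] int]; apply: (tail_op_uniformly_bounded phi_gt0 phi_nd N_ri) => f mf Af.
have mF : meas_fun L f^* := meas_rearrangement f.
have F0 x : 0 <= f^* x := rearrangement_ge0 _ _.
have absF : (fun x => `|f^* x|) = f^* by apply/funext => x; rewrite gee0_abs.
have AF : A f^* < +oo := le_lt_trans (assoc_rearrangement L0 N_ri mf) Af.
have : sum_norm L (L1_norm L) M f^* < +oo.
  apply: le_lt_trans (eP _ mF) _; rewrite /ext_norm absF.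
  by apply: lte_mul_pinfty; [rewrite lee_fin ltW|by []|exact: AF].
move=> /ereal_inf_lt[_ [[g h] [/= mg mh gE] <-] /= Nlt].
have g0 := L1_norm_ge0 (L := L) g; have h0 := weak_norm_ge0 L0 phi_gt0 h.
have gfin : L1_norm L g \is a fin_num.
  by rewrite ge0_fin_numE//; apply: le_lt_trans Nlt; exact: leeDl.
have hfin : M h \is a fin_num.
  by rewrite ge0_fin_numE//; apply: le_lt_trans Nlt; exact: leeDr.
have Hfin : forall t, I t -> H f t < +oo.
  apply: (@tail_sup_lty f (fine (L1_norm L g)) (fine (M h) * c)%R); first exact: fine_ge0.
  move=> s Is; have [s0 /ltW sL] := Is.
  apply: le_trans (mul_rearrangement_le_prefix f Is) _.
  have mag := meas_fun_abs mg; have mah := meas_fun_abs mh.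
  apply: (@le_trans _ _ (\int[leb]_(x in ival s%:E) (`|g x| + `|h x|))).
    apply: (@ae_ge0_le_integral _ (lebesgue_line R) R leb _ (@measurable_ival R s%:E)).
    - by move=> x _; exact: F0.
    - exact: meas_funS mF.
    - by move=> x _; rewrite adde_ge0.
    - by apply: (meas_funS sL); exact: meas_funD.
    - case: gE => Z [mZ Z0 PZ]; exists Z; split => // x /= nx; apply: PZ => /= xE.
      apply: nx => /(ivalS sL)/xE fE; rewrite -[leLHS]gee0_abs// fE.
      exact: lee_abs_add.
  rewrite leb_integralD//; last 3 first.
  - exact: measurable_ival.
  - exact: meas_funS mag.
  - exact: meas_funS mah.
  rewrite EFinD; apply: leeD.
    rewrite fineK// L1_normE; apply: leb_subset_integral => //.
    - exact: measurable_ival.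
    - exact: measurable_ival.
    - exact: ivalS.
  apply: le_trans (integral_le_prefix L0 (@measurable_ival R s%:E) (ivalS sL) mh) _.
  rewrite leb_ival ?lee_fin ?(ltW s0)//.
  apply: (@le_trans _ _ ((fine (M h))%:E * \int[leb]_(x in ival s%:E) (xi x)%:E)).
    rewrite -leb_integralZl.
    - apply: leb_le_integral; first exact: measurable_ival.
      + exact: meas_funS (meas_rearrangement h).
      + apply: (meas_funS sL); apply: meas_funM; first exact: meas_fun_cst.
        exact: (meas_xi phi_gt0 phi_nd).
      + by move=> x _; exact: rearrangement_ge0.
      + move=> x /(ivalS sL) Ix; rewrite muleC fineK//.
        exact: (rearrangement_le_weak phi_gt0).
    - exact: measurable_ival.
    - exact: (meas_funS sL (meas_xi phi_gt0 phi_nd)).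
    - by move=> x /(ivalS sL); exact: (xi_ge0 phi_gt0).
    - exact: fine_ge0.
  rewrite -mulrA EFinM; apply: lee_wpmul2l; first by rewrite lee_fin fine_ge0.
  exact: avg.
have [kappa [s [mk sI le_s Hs]]] := near_maximizers L0 phi_gt0 Hfin.
have [B [B0 BP]] := int _ (block_kernel_op_admissible L0 phi_gt0 phi_nd avg mk sI (expR_gt0 1) le_s).
set S := kernel_op L _ in BP.
have mSF : meas_fun L (S f^*) by exact: (meas_block_kernel_op_ge0 phi_gt0 phi_nd mk sI).
have SF0 x : I x -> 0 <= S f^* x.
  move=> Ix; apply: integral_ge0 => y _; rewrite mule_ge0 ?F0// lee_fin.
  exact: (block_ker_ge0 phi_gt0 sI _ Ix).
apply: (@le_lt_trans _ _ (A (fun t => 2%:E * S f^* t))).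
  apply: (assoc_le N_ri) => //.
  - by apply: meas_funM => //; exact: meas_fun_cst.
  - by move=> x Ix; exact: tail_op_ge0.
  - by move=> t It; exact: tail_op_le_block (Hs t It) It.
apply: le_lt_trans (assocZ N_ri mSF SF0 _) _; first by [].
apply: lte_mul_pinfty; [by rewrite lee_fin|by []|].
have -> : A (S f^*) = ext_norm A (S f^*) by apply: assoc_eq => x Ix; rewrite gee0_abs// SF0.
apply: le_lt_trans (BP _ mF) _; rewrite /ext_norm absF lte_mul_pinfty ?lee_fin//.
exact: ltW.
Qed.

(** Here H f is finite because f^* is integrable over the bounded interval. The interpolation
    property bounds the transposed operator on X; moving it onto the test function w in X bounds the
    image of f^* in X'. *)
Lemma bounded_of_interpolation_Lambda_Linfty : L < +oo ->
  interpolation L Lam (Linfty_norm L) (ext_norm N) ->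
  exists C : R, (0 < C)%R /\ forall f, meas_fun L f -> A (U f) <= C%:E * A (fun x => `|f x|).
Proof.
move=> Lfin [_ int]; apply: (tail_op_uniformly_bounded phi_gt0 phi_nd N_ri) => f mf Af.
have mF : meas_fun L f^* := meas_rearrangement f.
have F0 x : 0 <= f^* x := rearrangement_ge0 _ _.
have AF : A f^* < +oo := le_lt_trans (assoc_rearrangement L0 N_ri mf) Af.
have IF : \int[leb]_(x in I) f^* x \is a fin_num.
  rewrite ge0_fin_numE; last by apply: integral_ge0 => x _.
  have lE : (fine L)%:E = L by rewrite fineK// ge0_fin_numE// ltW.
  have lL : (fine L)%:E <= L by rewrite lE.
  have [k k0 kP] := assoc_prefix N_ri lL; rewrite lE in kP.
  apply: le_lt_trans (kP _ mF (fun x _ => F0 x)) _.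
  by rewrite lte_mul_pinfty ?lee_fin ?(ltW k0).
have Hfin : forall t, I t -> H f t < +oo.
  apply: (@tail_sup_lty f (fine (\int[leb]_(x in I) f^* x)) 0%R).
    by apply: fine_ge0; apply: integral_ge0 => x _.
  move=> s Is; have [s0 /ltW sL] := Is; rewrite mul0r addr0 fineK//.
  apply: le_trans (mul_rearrangement_le_prefix f Is) _.
  apply: leb_subset_integral => //; [exact: measurable_ival|exact: measurable_ival|exact: ivalS].
have [kappa [s [mk sI le_s Hs]]] := near_maximizers L0 phi_gt0 Hfin.
have [B [B0 BP]] := int _ (block_kernel_swap_admissible L0 phi_gt0 phi_nd avg mk sI (expR_gt0 1) le_s).
set S' := kernel_op L _ in BP.
set S := kernel_op L (block_ker (phi := phi) (kappa := kappa) (s := s)).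
have mSF : meas_fun L (S f^*) by exact: (meas_block_kernel_op_ge0 phi_gt0 phi_nd mk sI).
have SF0 x : I x -> 0 <= S f^* x.
  move=> Ix; apply: integral_ge0 => y _; rewrite mule_ge0 ?F0// lee_fin.
  exact: (block_ker_ge0 phi_gt0 sI _ Ix).
apply: (@le_lt_trans _ _ (A (fun t => 2%:E * S f^* t))).
  apply: (assoc_le N_ri) => //.
  - by apply: meas_funM => //; exact: meas_fun_cst.
  - by move=> x Ix; exact: tail_op_ge0.
  - by move=> t It; exact: tail_op_le_block (Hs t It) It.
apply: le_lt_trans (assocZ N_ri mSF SF0 _) _; first by [].
apply: lte_mul_pinfty; [by rewrite lee_fin|by []|].
apply: (@le_lt_trans _ _ (B%:E * A f^*)); last by rewrite lte_mul_pinfty ?lee_fin// ltW.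
apply: (assoc_ub N_ri mSF SF0) => w mw w0 Nw.
have mS'w : meas_fun L (S' w) by exact: (meas_block_kernel_swap_ge0 phi_gt0 phi_nd mk sI).
have -> : \int[leb]_(x in I) (S f^* x * w x) = \int[leb]_(x in I) (w x * S f^* x).
  by apply: eq_integral => x _; rewrite muleC.
rewrite (block_kernel_tonelli phi_gt0 phi_nd mk sI mw mF w0 F0).
have -> : \int[leb]_(x in I) (f^* x * S' w x) = \int[leb]_(x in I) (f^* x * `|S' w x|).
  apply: eq_integral => x /set_mem Ix; rewrite [`|_|]gee0_abs//.
  by apply: integral_ge0 => t It; rewrite mule_ge0// lee_fin; exact: (block_ker_ge0 phi_gt0 sI _ It).
apply: (assoc_holder N_ri) => //; first exact: meas_fun_abs.
apply: le_trans (BP w mw) _; rewrite -[leRHS]mule1; apply: lee_wpmul2l; first by rewrite lee_fin ltW.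
by rewrite /ext_norm (norm_abs N_ri (nneg_of_ge0 mw w0)).
Qed.

End interpolation_bounded.

(** * The implications between the three statements *)

Theorem theorem3p16 (R : realType) (L : \bar R) (N : functional R)
    (phi : R -> R)
    (L_gt0 : 0 < L)
    (N_ri : ri_norm L N)
    (phi_meas : leb_measurable_fun (ival L) phi)
    (phi_gt0 : forall t, ival L t -> (0 < phi t)%R)
    (phi_equiv : equiv_continuous_nondecreasing L phi) :
  let xi : R -> R := fun t => ((phi t)^-1)%R in
  averaging L xi ->
  let psi : R -> \bar R := fun t => t%:E / primitive0 xi t in
  let X := ext_norm N in
  let X' := ext_norm (assoc_norm L N) in
  let stm_i := bounded_on L X' (sup_operator L phi) in
  let stm_ii := interpolation L (Lambda1_norm L xi) (Linfty_norm L) X in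
  let stm_iii := interpolation L (L1_norm L) (Mpsi_norm L psi) X' in
  (L < +oo -> (stm_i <-> stm_ii) /\ (stm_ii <-> stm_iii)) /\
  (L = +oo -> (stm_i -> stm_ii) /\ (stm_iii -> stm_i)).

Proof.
move=> xi av psi X X' stm_i stm_ii stm_iii.
have [phi0 [phi0_gt0 _ phi0_nd [K [K0 KP]]]] := phi_equiv.
have phi_le t : ival L t -> (phi t <= K * phi0 t)%R by move=> /KP[].
have phi0_le t : ival L t -> (phi0 t <= K * phi t)%R by move=> /KP[].
have [c avg] := averaging_everywhere phi_meas phi_gt0 phi0_gt0 phi0_nd K0 phi_le phi0_le av.
have c0 : (0 < c)%R := lt_le_trans ltr01 (avg_ge1 L_gt0 phi0_gt0 phi0_nd avg).
set Lam0 := Lambda1_norm L (fun t => (phi0 t)^-1)%R.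
(* Statement (i) in terms of U for the nondecreasing weight; every implication passes through this
   form. *)
pose bounded := exists C : R, (0 < C)%R /\ forall f, meas_fun L f ->
  assoc_norm L N (tail_op L phi0 f) <= C%:E * assoc_norm L N (fun x => `|f x|).
have iE : stm_i <-> bounded.
  exact: (bounded_sup_operatorP L_gt0 phi_meas phi_gt0 phi0_gt0 phi0_nd K0 phi_le phi0_le N_ri).
have Lam_ge0 f : 0 <= Lambda1_norm L xi f.
  apply: integral_ge0 => t It; rewrite mule_ge0 ?rearrangement_ge0// lee_fin invr_ge0 ltW//.
  exact: phi_gt0.
have Lam0_ge0 f : 0 <= Lam0 f.
  apply: integral_ge0 => t It; rewrite mule_ge0 ?rearrangement_ge0// lee_fin invr_ge0 ltW//.
  exact: phi0_gt0.
have Linf_ge0 f : 0 <= Linfty_norm L f := Linfty_norm_ge0 f.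
have L1_ge0 f : 0 <= L1_norm L f := L1_norm_ge0 f.
have weak_ge0 f : 0 <= weak_norm L phi0 f := weak_norm_ge0 L_gt0 phi0_gt0 f.
have M_ge0 f : 0 <= Mpsi_norm L psi f.
  exact: (Mpsi_ge0 L_gt0 phi_meas phi_gt0 phi0_gt0 phi0_nd K0 phi_le phi0_le avg).
have Lam_dom : dominates (Lambda1_norm L xi) Lam0.
  by exists K; split => // f; exact: (le_Lambda1 phi_meas phi_gt0 phi0_gt0 phi0_nd K0 phi_le).
have Lam0_dom : dominates Lam0 (Lambda1_norm L xi).
  by exists K; split => // f; exact: (Lambda1_le phi_meas phi_gt0 phi0_gt0 phi0_nd K0 phi0_le).
have M_dom : dominates (Mpsi_norm L psi) (weak_norm L phi0).
  exists (K * c)%R; split; first by rewrite mulr_gt0.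
  by move=> f; exact: (weak_le_Mpsi L_gt0 phi_meas phi_gt0 phi0_gt0 phi0_nd K0 phi_le phi0_le avg).
have weak_dom : dominates (weak_norm L phi0) (Mpsi_norm L psi).
  exists K; split => // f.
  exact: (Mpsi_le_weak L_gt0 phi_meas phi_gt0 phi0_gt0 phi0_nd K0 phi_le phi0_le avg).
have refl_dom (P : functional R) : dominates P P.
  by exists 1%R; split => // f; rewrite mul1e.
have iiE : stm_ii <-> interpolation L Lam0 (Linfty_norm L) X.
  by split; apply: interpolation_equivalent.
have iiiE : stm_iii <-> interpolation L (L1_norm L) (weak_norm L phi0) X'.
  by split; apply: interpolation_equivalent.
have i_ii : bounded -> stm_ii.
  move=> [C [C0 CP]]; apply/iiE.
  exact: (interpolation_Lambda_Linfty L_gt0 phi0_gt0 phi0_nd N_ri C0 CP).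
have iii_i : stm_iii -> bounded.
  by move=> /iiiE; exact: (bounded_of_interpolation_L1_weak L_gt0 phi0_gt0 phi0_nd avg N_ri).
have [i_bounded bounded_i] := iE.
split=> [Lfin|_]; last by split=> [h|h]; [exact: i_ii (i_bounded h)|exact: bounded_i (iii_i h)].
have ii_i : stm_ii -> bounded.
  by move=> /iiE; exact: (bounded_of_interpolation_Lambda_Linfty L_gt0 phi0_gt0 phi0_nd avg N_ri Lfin).
have i_iii : bounded -> stm_iii.
  move=> [C [C0 CP]]; apply/iiiE.
  exact: (interpolation_L1_weak L_gt0 phi0_gt0 phi0_nd N_ri C0 CP Lfin).
split; split.
- by move=> h; exact: i_ii (i_bounded h).
- by move=> h; exact: bounded_i (ii_i h).
- by move=> h; exact: i_iii (ii_i h).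
- by move=> h; exact: i_ii (iii_i h).
Qed.
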